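(* Let $\mathbf{A}$ be an $n\times d$ real matrix, $\ell\in\mathbb{N}$, $k$ a target rank and $\varepsilon>0$ an accuracy parameter, and let $\mathbf{M} = (\mathbf{A}^\top\mathbf{A})^\ell$ or $\mathbf{M} = \mathbf{A}(\mathbf{A}^\top\mathbf{A})^\ell$. Then for any $p\ge 1$ there exists an algorithm that uses at most $O(k\ell\log(nk)p^{1/6}/\varepsilon^{1/3})$ matrix-vector products (with $\mathbf{A}$ and $\mathbf{A}^\top$) and with probability at least $9/10$ outputs a matrix $\mathbf{Z}\in\mathbb{R}^{d\times k}$ with orthonormal columns such that \[ \|\mathbf{M}(\mathbf{I}-\mathbf{Z}\mathbf{Z}^\top)\|_{\mathcal{S}_p} \le (1+\varepsilon)\min_{\mathbf{U}:\ \mathbf{U}^\top\mathbf{U}=\mathbf{I}_k}\|\mathbf{M}(\mathbf{I}-\mathbf{U}\mathbf{U}^\top)\|_{\mathcal{S}_p}. \]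
   Context: In the matrix-vector product model the algorithm may adaptively choose vectors $v$ and receive $\mathbf{A}v$ or $\mathbf{A}^\top v$. $\|\mathbf{N}\|_{\mathcal{S}_p} = (\sum_i\sigma_i(\mathbf{N})^p)^{1/p}$; the minimum is over $d\times k$ matrices $\mathbf{U}$ with orthonormal columns.
   Formalization: In the bound on the number of products, log(nk) is read as max(1, log(nk)) and ε as min(1, ε), since the literal bound fails for n = k = 1 and for very large ε (rank-k inputs force exact recovery); ℓ ≥ 1, n ≥ 1 and 1 ≤ k ≤ d are assumed. *)

(* Defs.v *)
From HB Require Import structures.
From mathcomp Require Import all_boot all_order all_algebra.
From mathcomp Require polyrcf.
From mathcomp Require Import all_classical all_reals all_analysis.

Set Implicit Arguments.
Unset Strict Implicit.
Unset Printing Implicit Defensive.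

Import Order.TTheory GRing.Theory Num.Theory.

Local Open Scope classical_set_scope.
Local Open Scope ring_scope.

(* The square roots of the eigenvalues of N^T N, with algebraic multiplicity.
   There are d of them for N of size m x d, so when m < d the list is padded
   with zeros, which do not contribute to the Schatten norms. *)
Definition singular_values (R : realType) (m d : nat) (N : 'M[R]_(m, d)) :
    seq R :=
  let chi := char_poly (N^T *m N) in
  flatten [seq nseq (mup x chi) (Num.sqrt x) | x <- polyrcf.rootsR chi].

Definition schatten_norm (R : realType) (m d : nat) (p : R)
    (N : 'M[R]_(m, d)) : R :=
  (\sum_(s <- singular_values N) s `^ p) `^ p^-1.

Definition orthonormal_columns (R : realType) (d k : nat) (U : 'M[R]_(d, k)) :
    Prop :=
  U^T *m U = 1%:M.

Definition approx_error (R : realType) (m d k : nat) (p : R)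
    (M : 'M[R]_(m, d)) (U : 'M[R]_(d, k)) : R :=
  schatten_norm p (M *m (1%:M - U *m U^T)).

(* The infimum is a minimum when k <= d: the error is continuous in U and the
   set of matrices with orthonormal columns is compact and nonempty. *)
Definition min_approx_error (R : realType) (m d : nat) (k : nat) (p : R)
    (M : 'M[R]_(m, d)) : R :=
  inf [set approx_error p M U |
         U in [set U : 'M[R]_(d, k) | orthonormal_columns U]].

(* What one matrix-vector product returns: A v in the first component, or
   A^T u in the second one; the other component is set to 0.  Tuples are used
   instead of column vectors because they carry the product sigma-algebra. *)
Notation mv_answer R n d := ((n.-tuple R) * (d.-tuple R))%type.

Definition mv_oracle (R : realType) (n d : nat) (A : 'M[R]_(n, d))
    (right : bool) (v : 'cV[R]_d) (u : 'cV[R]_n) : mv_answer R n d :=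
  if right then ([tuple (A *m v) i 0 | i < n], [tuple 0 | _ < d])
  else ([tuple 0 | _ < n], [tuple (A^T *m u) j 0 | j < d]).

(* A randomized adaptive algorithm making q matrix-vector products (fewer can
   be padded by products with 0), with random seed in Omega.  At step t it
   sees the seed and the t previous answers, and chooses the matrix (A if
   mv_right holds, A^T otherwise) and the vector (mv_vec for A, mv_covec for
   A^T).  Joint measurability makes all the queries and the output random
   variables; for arbitrary functions of the answers the model degenerates:
   under the continuum hypothesis, a well-ordering of the matrices lets one
   recover A almost surely from a single random product. *)
Record mv_algorithm (R : realType) (n d k q : nat) (disp : measure_display)
    (Omega : measurableType disp) := MVAlgorithm {
  mv_right : forall t : nat, Omega * t.-tuple (mv_answer R n d) -> bool ;
  mv_vec : forall t : nat, Omega * t.-tuple (mv_answer R n d) -> 'cV[R]_d ;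
  mv_covec : forall t : nat, Omega * t.-tuple (mv_answer R n d) -> 'cV[R]_n ;
  mv_output : Omega * q.-tuple (mv_answer R n d) -> 'M[R]_(d, k) ;
  measurable_mv_right : forall t, measurable_fun setT (@mv_right t) ;
  measurable_mv_vec : forall t i j,
    measurable_fun setT (fun x => @mv_vec t x i j) ;
  measurable_mv_covec : forall t i j,
    measurable_fun setT (fun x => @mv_covec t x i j) ;
  measurable_mv_output : forall i j,
    measurable_fun setT (fun x => mv_output x i j)
}.

Fixpoint mv_answers (R : realType) (n d k q : nat) (disp : measure_display)
    (Omega : measurableType disp) (alg : mv_algorithm R n d k q Omega)
    (A : 'M[R]_(n, d)) (w : Omega) (t : nat) : t.-tuple (mv_answer R n d) :=
  match t with
  | 0 => [tuple]
  | t'.+1 =>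
      let h := mv_answers alg A w t' in
      [tuple of rcons h
         (mv_oracle A (mv_right alg (w, h)) (mv_vec alg (w, h))
                      (mv_covec alg (w, h)))]
  end.

Definition mv_run (R : realType) (n d k q : nat) (disp : measure_display)
    (Omega : measurableType disp) (alg : mv_algorithm R n d k q Omega)
    (A : 'M[R]_(n, d)) (w : Omega) : 'M[R]_(d, k) :=
  mv_output alg (w, mv_answers alg A w q).

Definition near_optimal (R : realType) (m d k : nat) (p eps : R)
    (M : 'M[R]_(m, d)) (Z : 'M[R]_(d, k)) : Prop :=
  orthonormal_columns Z /\
  approx_error p M Z <= (1 + eps) * min_approx_error k p M.

(* Success with probability at least 9/10 on every fixed input A, where
   M = F A is the matrix to approximate. *)
Definition mv_solves (R : realType) (n d k q m : nat) (disp : measure_display)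
    (Omega : measurableType disp) (P : probability Omega R)
    (alg : mv_algorithm R n d k q Omega) (p eps : R)
    (F : 'M[R]_(n, d) -> 'M[R]_(m, d)) : Prop :=
  forall A : 'M[R]_(n, d), exists E : set Omega,
    [/\ measurable E, ((9 / 10)%:E <= P E)%E &
        forall w, E w -> near_optimal p eps (F A) (mv_run alg A w)].

Definition gram_power (R : realType) (n d l : nat) (A : 'M[R]_(n, d)) :
    'M[R]_(d, d) :=
  (A^T *m A) ^+ l.

Definition odd_gram_power (R : realType) (n d l : nat) (A : 'M[R]_(n, d)) :
    'M[R]_(n, d) :=
  A *m (A^T *m A) ^+ l.

(* k l log(nk) p^(1/6) / eps^(1/3), with two conventions at the degenerate
   ends of the ranges.  The logarithm is read as at least 1, since ln (n k) = 0
   for n = k = 1, where one product is still needed; and eps is capped at 1,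
   since the expression tends to 0 as eps grows, whereas an exact answer is
   required whenever M has rank at most k. *)
Definition query_bound (R : realType) (n k l : nat) (p eps : R) : R :=
  k%:R * l%:R * Num.max 1 (ln (n * k)%:R) * p `^ 6^-1
    / (Num.min 1 eps) `^ 3^-1.

(* Main.v *)
(* Write [S = M^T M = B^N] with [B = A^T A] and let [R] be its square root. Chains of products
   with [A^T] and [A] give vectors [x] of a block Krylov space together with [S x]; from these
   pairs alone one computes [R P R], where [P] projects onto the image by [R] of the Krylov
   space, and [Z] collects its top [k] eigenvectors.
   Ky Fan's inequality bounds the partial sums of the singular values [mu_j] of
   [M (I - Z Z^T)] by those of the tail [s_(k+j)] plus the total loss of the Ritz values
   [rho_i] with respect to the [s_i]. Convexity of [t^p] and Abel summation turn this into a
   bound of the Schatten norm by that of the tail, a lower bound for every projection by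
   interlacing.
   The Ritz values are estimated with Chebyshev polynomials. One Krylov space has [k] start
   vectors and the other [k + b] start vectors. If the spectrum drops between [k] and [k + b],
   the wide block converges quickly; otherwise the tail is so heavy that the low accuracy of
   the narrow block suffices. Balancing the two costs gives the exponents 1/6 and 1/3.
   The start vectors have independent entries uniform on an integer grid, so that moving one
   entry shows that, with high probability, their components along the leading singular
   vectors are well conditioned. *)
Require Import Defs.
From HB Require Import structures.
From mathcomp Require Import all_boot all_order all_algebra.
From mathcomp Require polyrcf.
From mathcomp Require Import all_classical all_reals all_analysis.
From mathcomp Require Import measurable_realfun.
From mathcomp Require Import ring lra zify.
Import Order.TTheory GRing.Theory Num.Theory.
Import numFieldNormedType.Exports.
Set Implicit Arguments.
Unset Strict Implicit.
Unset Printing Implicit Defensive.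
Local Open Scope ring_scope.

(** * Symmetric matrices and spectral decomposition *)

(** The exponents come from the following count, up to logarithms and the factor [l]. A relative
    accuracy [g] costs the narrow block [k / sqrt g] products. If the drop from [s k] to [s (k + b)]
    is below a relative [1 / p], their p-th powers are comparable and the tail is at least of order
    [b * s k ^ p]; a relative error [eps] then allows an excess of order [p * eps * b * s k ^ p].
    Losing [g * s k] in each Ritz value causes an excess of order [p * k * g * s k ^ p], so
    [g = eps * b / k] is affordable. A larger drop costs the wide block [(k + b) * sqrt p]. Equating
    [k / sqrt g] with [b * sqrt p] gives [b = k / (p * eps) ^ (1/3)]. When [p * eps >= 1], a wide
    block of order [k] and a gap of order [eps] are enough. Two constraints shape the algorithm. For
    an odd power of [A^T A] the square root cannot be applied by a few products with [A] and [A^T],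
    so it must cancel out of everything that is computed. And the output must be a measurable
    function of the answers, so eigenvectors are obtained as limits of explicit expressions rather
    than chosen, while the seed is a natural number. *)

Definition dot (R : realType) (d : nat) (x y : 'cV[R]_d) : R :=
  \sum_i x i 0 * y i 0.

Section Dot.
Variables (R : realType).
Implicit Types d : nat.

Lemma dotC d (x y : 'cV[R]_d) : dot x y = dot y x.
Proof. by apply: eq_bigr => i _; rewrite mulrC. Qed.

Lemma dotDl d (x y z : 'cV[R]_d) : dot (x + y) z = dot x z + dot y z.
Proof. by rewrite -big_split; apply: eq_bigr => i _; rewrite mxE mulrDl. Qed.

Lemma dotZl d a (x z : 'cV[R]_d) : dot (a *: x) z = a * dot x z.
Proof. by rewrite mulr_sumr; apply: eq_bigr => i _; rewrite mxE mulrA. Qed.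

Lemma dotNl d (x z : 'cV[R]_d) : dot (- x) z = - dot x z.
Proof. by rewrite -scaleN1r dotZl mulN1r. Qed.

Lemma dotBl d (x y z : 'cV[R]_d) : dot (x - y) z = dot x z - dot y z.
Proof. by rewrite dotDl dotNl. Qed.

Lemma dot0l d (z : 'cV[R]_d) : dot 0 z = 0.
Proof. by rewrite -(scale0r 0) dotZl mul0r. Qed.

Lemma dotDr d (x y z : 'cV[R]_d) : dot z (x + y) = dot z x + dot z y.
Proof. by rewrite dotC dotDl !(dotC z). Qed.

Lemma dotZr d a (x z : 'cV[R]_d) : dot z (a *: x) = a * dot z x.
Proof. by rewrite dotC dotZl dotC. Qed.

Lemma dotNr d (x z : 'cV[R]_d) : dot z (- x) = - dot z x.
Proof. by rewrite dotC dotNl dotC. Qed.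

Lemma dotBr d (x y z : 'cV[R]_d) : dot z (x - y) = dot z x - dot z y.
Proof. by rewrite dotDr dotNr. Qed.

Lemma dot0r d (z : 'cV[R]_d) : dot z 0 = 0.
Proof. by rewrite dotC dot0l. Qed.

Lemma dot_suml d (I : Type) (r : seq I) (P : pred I) (F : I -> 'cV[R]_d) z :
  dot (\sum_(i <- r | P i) F i) z = \sum_(i <- r | P i) dot (F i) z.
Proof.
by apply: (big_ind2 (fun x y => dot x z = y)) => [|x a y b <- <-|//];
  rewrite ?dot0l ?dotDl.
Qed.

Lemma dot_sumr d (I : Type) (r : seq I) (P : pred I) (F : I -> 'cV[R]_d) z :
  dot z (\sum_(i <- r | P i) F i) = \sum_(i <- r | P i) dot z (F i).
Proof. by rewrite dotC dot_suml; apply: eq_bigr => i _; rewrite dotC. Qed.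

Lemma dotE d (x y : 'cV[R]_d) : dot x y = (x^T *m y) 0 0.
Proof. by rewrite mxE; apply: eq_bigr => i _; rewrite mxE. Qed.

Lemma dot_mulmxl d m (A : 'M[R]_(d, m)) x y :
  dot (A *m x) y = dot x (A^T *m y).
Proof. by rewrite !dotE trmx_mul mulmxA. Qed.

Lemma dot_mulmxr d m (A : 'M[R]_(d, m)) x y :
  dot y (A *m x) = dot (A^T *m y) x.
Proof. by rewrite dotC dot_mulmxl dotC. Qed.

Lemma dot_ge0 d (x : 'cV[R]_d) : 0 <= dot x x.
Proof. by apply: sumr_ge0 => i _; rewrite -expr2 sqr_ge0. Qed.

Lemma dot_eq0 d (x : 'cV[R]_d) : (dot x x == 0) = (x == 0).
Proof.
apply/eqP/eqP => [/eqP|->]; last by rewrite dot0l.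
rewrite psumr_eq0 => [|i _]; last by rewrite -expr2 sqr_ge0.
move=> /allP x0; apply/colP => i; rewrite mxE.
by have := x0 i (mem_index_enum _); rewrite /= mulf_eq0 orbb => /eqP.
Qed.

Lemma dot_gt0 d (x : 'cV[R]_d) : (0 < dot x x) = (x != 0).
Proof. by rewrite lt_def dot_ge0 andbT dot_eq0. Qed.

Lemma mul_col_rowE d (x y z : 'cV[R]_d) : (x *m y^T) *m z = dot y z *: x.
Proof.
rewrite -mulmxA; apply/colP => i; rewrite !mxE big_ord1.
by rewrite -[(y^T *m z) 0 0]dotE mulrC.
Qed.

Lemma coord_delta d (x : 'cV[R]_d) i : dot (delta_mx i 0) x = x i 0.
Proof.
rewrite /dot (bigD1 i) //= big1 ?addr0 => [|j ji].
  by rewrite mxE !eqxx mul1r.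
by rewrite mxE (negPf ji) mul0r.
Qed.

Lemma exists_orthogonal d m (F : 'I_m -> 'cV[R]_d) : (m < d)%N ->
  exists2 x : 'cV[R]_d, x != 0 & forall i, dot (F i) x = 0.
Proof.
move=> md; pose A : 'M[R]_(d, m) := \matrix_(j, i) F i j 0.
have rk : \rank (kermx A) != 0%N.
  rewrite mxrank_ker subn_eq0 -ltnNge.
  exact: leq_ltn_trans (rank_leq_col _) md.
have /rowV0Pn[v vk v0] : kermx A != 0 by rewrite -mxrank_eq0.
exists v^T; first by rewrite -(inj_eq (@trmx_inj _ _ _)) trmxK trmx0.
move=> i; have /sub_kermxP /matrixP /(_ 0 i) := vk.
rewrite !mxE => <-; apply: eq_bigr => j _; by rewrite !mxE mulrC.
Qed.

(** On the line [z + t * G z] the quadratic form has no constant term, so its linear coefficient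
    [2 * |G z|^2] must vanish for the form to stay nonnegative. *)
Lemma psd_isotropic d (G : 'M[R]_d) (z : 'cV[R]_d) :
  G^T = G -> (forall x, 0 <= dot x (G *m x)) -> dot z (G *m z) = 0 ->
  G *m z = 0.
Proof.
move=> Gs Gp Gz; apply/eqP; rewrite -dot_eq0; set y := G *m z.
have E t : dot (z + t *: y) (G *m (z + t *: y)) =
    2 * t * dot y y + t ^+ 2 * dot y (G *m y).
  rewrite mulmxDr -scalemxAr !(dotDl, dotDr, dotZl, dotZr) Gz.
  rewrite (_ : dot z (G *m y) = dot y y); last by rewrite dot_mulmxr Gs.
  rewrite -/y; ring.
have := Gp y; rewrite le_eqVlt => /orP[/eqP y0|y0].
  have := Gp (z + (-1) *: y); rewrite E -y0 mulr0 addr0.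
  move=> h; rewrite eq_le dot_ge0 andbT; lra.
have := Gp (z + (- dot y y / dot y (G *m y)) *: y); rewrite E.
set a := dot y y; set b := dot y (G *m y).
have -> : 2 * (- a / b) * a + (- a / b) ^+ 2 * b = - (a ^+ 2 / b).
  by field; rewrite gt_eqF.
rewrite oppr_ge0 => h.
have : a ^+ 2 / b = 0.
  by apply/eqP; rewrite eq_le h divr_ge0 ?sqr_ge0 // ltW.
by move=> /eqP; rewrite mulf_eq0 expf_eq0 invr_eq0 (gt_eqF y0) orbF.
Qed.

(** The quadratic form attains its maximum on the unit sphere by compactness. At a maximiser [v] the
    matrix [f v - H] is positive semidefinite and isotropic, and [psd_isotropic] yields the
    eigenvector equation. *)
Lemma exists_top_eigenvector d (H : 'M[R]_d) : (0 < d)%N -> H^T = H ->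
  exists (z : 'cV[R]_d) (l : R), [/\ dot z z = 1, H *m z = l *: z &
    forall x, dot x (H *m x) <= l * dot x x].
Proof.
move=> d0 Hs.
pose f (v : 'rV[R]_d) := dot v^T (H *m v^T).
pose g (v : 'rV[R]_d) := dot v^T v^T.
pose S := [set v : 'rV[R]_d | g v = 1]%classic.
have cc (i : 'I_d) : continuous (fun v : 'rV[R]_d => v 0 i).
  exact: coord_continuous.
have csum (I : Type) (r : seq I) (F : I -> 'rV[R]_d -> R) :
    (forall i, continuous (F i)) -> continuous (fun v => \sum_(i <- r) F i v).
  move=> cF; elim: r => [|i r IH].
    by under eq_fun do rewrite big_nil; exact: cst_continuous.
  under eq_fun do rewrite big_cons.
  by move=> v; apply: continuousD; [exact: cF|exact: IH].
have cg : continuous g.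
  apply: (csum) => i v; under eq_fun do rewrite mxE.
  by apply: continuousM; exact: cc.
have cf : continuous f.
  apply: (csum) => i v; under eq_fun do rewrite !mxE.
  apply: continuousM; first exact: cc.
  apply: (@csum _ (index_enum _) (fun j (w : 'rV[R]_d) => H i j * w^T j 0)).
  move=> j w; under eq_fun do rewrite mxE.
  by apply: continuousM; [exact: cst_continuous|exact: cc].
have SC : compact S.
  apply: bounded_closed_compact.
    exists 1; split => // M M1 v; rewrite /S /= => gv.
    rewrite /Num.norm /= mx_normrE; apply/bigmax_leP; split => /=.
      by rewrite (le_trans ler01) // ltW.
    move=> [i j] _ /=; rewrite ord1.
    have : `|v 0 j| ^+ 2 <= 1.
      rewrite real_normK ?num_real // -gv /g /dot (bigD1 j) //= !mxE -expr2.
      by rewrite lerDl; apply: sumr_ge0 => l _; rewrite -expr2 sqr_ge0.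
    rewrite expr_le1 // => h; exact: le_trans h (ltW M1).
  by apply: (@closed_comp _ _ g [set 1%R]%classic) => [v _|]; [exact: cg|exact: closed_eq].
have S0 : (S !=set0)%classic.
  exists (delta_mx 0 (Ordinal d0)); rewrite /S /g /= trmx_delta coord_delta.
  by rewrite mxE !eqxx.
have [v /[!inE] vS vmax] := compact_EVT_max S0 SC (continuous_subspaceT cf).
exists v^T, (f v).
have bd x : dot x (H *m x) <= f v * dot x x.
  have [->|x0] := eqVneq x 0; first by rewrite mulmx0 !dot0l mulr0.
  have xx : 0 < dot x x by rewrite dot_gt0.
  pose a := (Num.sqrt (dot x x))^-1.
  have aa : a * a = (dot x x)^-1.
    by rewrite /a -invfM -expr2 sqr_sqrtr ?ltW.
  have := vmax (a *: x)^T; rewrite inE /S /g /= trmxK => /(_ _).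
  rewrite dotZl dotZr mulrA aa mulVf ?gt_eqF // => /(_ erefl).
  rewrite {1}/f trmxK -scalemxAr dotZl dotZr mulrA aa.
  by rewrite mulrC ler_pdivrMr.
split => //; apply/eqP; rewrite eq_sym -subr_eq0 -mul_scalar_mx -mulmxBl.
apply/eqP; apply: psd_isotropic.
- by rewrite linearB /= Hs tr_scalar_mx.
- by move=> x; rewrite mulmxBl mul_scalar_mx dotBr dotZr subr_ge0 bd.
- by rewrite mulmxBl mul_scalar_mx dotBr dotZr -/(g v) vS mulr1 subrr.
Qed.

End Dot.

(** * Greedy extraction of eigenvectors by deflation *)

Definition psd (R : realType) (d : nat) (H : 'M[R]_d) : Prop :=
  H^T = H /\ forall x, 0 <= dot x (H *m x).

(** The selector is abstract because it is instantiated twice: by the axiom of choice to prove the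
    spectral theorem, then by the measurable [power_top], whose correctness rests on that
    theorem. *)
Definition top_eigenvector (R : realType) (d : nat) (top : 'M[R]_d -> 'cV[R]_d) :=
  forall H : 'M[R]_d, psd H -> H != 0 ->
  dot (top H) (top H) = 1 /\
  exists2 l, H *m top H = l *: top H &
    forall x, dot x (H *m x) <= l * dot x x.

Fixpoint deflate (R : realType) (d : nat) (top : 'M[R]_d -> 'cV[R]_d)
    (H : 'M[R]_d) (i : nat) : 'M[R]_d :=
  if i is j.+1 then
    let H' := deflate top H j in
    let z := top H' in H' - dot z (H' *m z) *: (z *m z^T)
  else H.

Definition greedy_vec (R : realType) (d : nat) (top : 'M[R]_d -> 'cV[R]_d)
    (H : 'M[R]_d) (i : nat) : 'cV[R]_d := top (deflate top H i).

Section Greedy.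
Variables (R : realType) (d : nat) (top : 'M[R]_d -> 'cV[R]_d).
Hypothesis topP : top_eigenvector top.
Variable H : 'M[R]_d.
Hypotheses (Hs : H^T = H) (Hp : forall x, dot x x <= dot x (H *m x)).

Local Notation D := (deflate top H).
Local Notation z := (greedy_vec top H).

Lemma deflateS i : D i.+1 = D i - dot (z i) (D i *m z i) *: (z i *m (z i)^T).
Proof. by []. Qed.

Lemma deflate_mul i x :
  D i.+1 *m x = D i *m x - (dot (z i) (D i *m z i) * dot (z i) x) *: z i.
Proof. by rewrite deflateS mulmxBl -scalemxAl mul_col_rowE scalerA. Qed.

(** The found vectors lie in the kernel of [D i], which agrees with [H] on their orthogonal
    complement. Since [H] dominates the identity, [D i] cannot vanish before [d] vectors have been
    found. *)
Lemma greedy_invariant i : (i <= d)%N ->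
  [/\ psd (D i),
      forall a b, (a < i)%N -> (b < i)%N -> dot (z a) (z b) = (a == b)%:R,
      forall a, (a < i)%N -> D i *m z a = 0,
      forall x, (forall a, (a < i)%N -> dot (z a) x = 0) -> D i *m x = H *m x &
      forall a, (a < i)%N -> exists l, H *m z a = l *: z a /\
        forall x, (forall b, (b < a)%N -> dot (z b) x = 0) ->
          dot x (H *m x) <= l * dot x x].
Proof.
elim: i => [|i IH] id.
  split=> //; split=> // x; exact: le_trans (dot_ge0 x) (Hp x).
have [[Ds Dp] zo Dz DH He] := IH (ltnW id).
(* [D i] acts as [H] on this vector, so it is nonzero and [top] applies to it with a positive
   eigenvalue. *)
have [x x0 xz] := exists_orthogonal (fun a : 'I_i => z a) id.
have xz' a : (a < i)%N -> dot (z a) x = 0 by move=> ai; exact: xz (Ordinal ai).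
have xD : 0 < dot x (D i *m x).
  by rewrite DH // (lt_le_trans _ (Hp x)) // dot_gt0.
have D0 : D i != 0 by apply: contraTneq xD => ->; rewrite mul0mx dot0r ltxx.
have [z1 [l zl lmax]] := topP (conj Ds Dp) D0.
rewrite -/(z i) in z1 zl.
have l0 : 0 < l.
  rewrite ltNge; apply/negP => l0; have := lt_le_trans xD (lmax x).
  by rewrite ltNge mulr_le0_ge0 ?dot_ge0.
have lE : dot (z i) (D i *m z i) = l by rewrite zl dotZr z1 mulr1.
have zia a : (a < i)%N -> dot (z a) (z i) = 0.
  move=> ai; have : dot (z a) (D i *m z i) = 0.
    by rewrite dot_mulmxr Ds Dz // dot0l.
  by rewrite zl dotZr => /eqP; rewrite mulf_eq0 gt_eqF //= => /eqP.
have zort a b : (a < i.+1)%N -> (b < i.+1)%N -> dot (z a) (z b) = (a == b)%:R.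
  rewrite !ltnS leq_eqVlt => /orP[/eqP->|ai]; rewrite leq_eqVlt => /orP[/eqP->|bi].
  - by rewrite z1 eqxx.
  - by rewrite dotC zia // eq_sym ltn_eqF.
  - by rewrite zia // ltn_eqF.
  - exact: zo.
split=> //.
- split.
    by rewrite deflateS linearB linearZ /= trmx_mul trmxK Ds.
  move=> y; pose w := y - dot (z i) y *: z i.
  (* As [z i] is an eigenvector, the deflation is also the compression of [D i] to its orthogonal
     complement. *)
  suff -> : dot y (D i.+1 *m y) = dot w (D i *m w) by exact: Dp.
  rewrite deflate_mul lE /w mulmxBr -scalemxAr zl.
  rewrite !(dotBl, dotBr, dotZl, dotZr) z1 [dot (z i) (D i *m y)]dot_mulmxr Ds zl.
  rewrite !dotZl (dotC y (z i)); ring.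
- move=> a; rewrite ltnS leq_eqVlt => /orP[/eqP->|ai].
    by rewrite deflate_mul lE zl z1 mulr1 subrr.
  by rewrite deflate_mul Dz // (dotC (z i) (z a)) zia // mulr0 scale0r subr0.
- move=> y yz; rewrite deflate_mul yz // mulr0 scale0r subr0.
  by apply: DH => a ai; apply: yz; exact: ltnW.
- move=> a; rewrite ltnS leq_eqVlt => /orP[/eqP->|]; last exact: He.
  exists l; split; first by rewrite -DH // => b bi; rewrite zort ?ltn_eqF // ltnW.
  by move=> y yz; rewrite -DH.
Qed.

Lemma greedy_orthonormal a b : (a < d)%N -> (b < d)%N ->
  dot (z a) (z b) = (a == b)%:R.
Proof. by have [_ + _ _ _] := greedy_invariant (leqnn d); exact. Qed.

Lemma greedy_eigen a : (a < d)%N -> exists l, H *m z a = l *: z a /\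
  forall x, (forall b, (b < a)%N -> dot (z b) x = 0) ->
    dot x (H *m x) <= l * dot x x.
Proof. by have [_ _ _ _] := greedy_invariant (leqnn d); exact. Qed.

End Greedy.

Lemma exists_topP (R : realType) (d : nat) :
  exists top : 'M[R]_d -> 'cV[R]_d, top_eigenvector top.
Proof.
have /choice[top topP] : forall H : 'M[R]_d, exists z : 'cV[R]_d,
    psd H -> H != 0 -> dot z z = 1 /\
  exists2 l, H *m z = l *: z & forall x, dot x (H *m x) <= l * dot x x.
  move=> H; have [[[Hs Hp] H0]|h] := pselect (psd H /\ H != 0); last first.
    by exists 0 => h1 h2; case: h.
  have d0 : (0 < d)%N.
    by case: (posnP d) => // d0; case/eqP: H0; subst d; rewrite flatmx0.
  by have [z [l [h1 h2 h3]]] := exists_top_eigenvector d0 Hs; exists z; split => //; exists l.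
by exists top.
Qed.

(** The shift keeps the eigenvectors and makes the greedy procedure find a full basis even when [T]
    is singular. *)
Lemma psd_eq_shift (R : realType) d (T : 'M[R]_d) : psd T ->
  (T + 1%:M)^T = T + 1%:M /\
  forall x, dot x x <= dot x ((T + 1%:M) *m x).
Proof.
move=> [Ts Tp]; split; first by rewrite linearD /= Ts tr_scalar_mx.
by move=> x; rewrite mulmxDl mul1mx dotDr lerDr.
Qed.

(** The eigenvalues are stored through their square roots, which are the singular values of [N] when
    [H = N^T N]. Indexing by [nat], with zeros from [d] on, lets tails [s (k + j)] be written
    without bounds. *)
Definition sorted_eigenbasis (R : realType) (d : nat) (H V : 'M[R]_d)
    (s : nat -> R) :=
  [/\ V^T *m V = 1%:M, V *m V^T = 1%:M,
      H = V *m diag_mx (\row_i (s i ^+ 2)) *m V^T,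
      (forall i, 0 <= s i) /\ (forall i, (d <= i)%N -> s i = 0) &
      forall i j, (i <= j)%N -> s j <= s i].

Lemma trmx_mul_dot (R : realType) d k m (U : 'M[R]_(d, k)) (W : 'M[R]_(d, m)) i j :
  (U^T *m W) i j = dot (col i U) (col j W).
Proof. by rewrite mxE; apply: eq_bigr => a _; rewrite !mxE. Qed.

Lemma spectral (R : realType) (d : nat) (T : 'M[R]_d) : psd T ->
  exists V s, sorted_eigenbasis T V s.
Proof.
move=> Tpsd; have [Hs Hp] := psd_eq_shift Tpsd.
have [top topP] := exists_topP R d.
pose z i := greedy_vec top (T + 1%:M) i.
have zo a b : (a < d)%N -> (b < d)%N -> dot (z a) (z b) = (a == b)%:R.
  exact: greedy_orthonormal.
pose l i := dot (z i) (T *m z i).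
have ze a : (a < d)%N -> T *m z a = l a *: z a /\
  forall x, (forall b, (b < a)%N -> dot (z b) x = 0) ->
    dot x (T *m x) <= l a * dot x x.
  move=> ad; have [m [Hm mx]] := greedy_eigen topP Hs Hp ad.
  have Tz : T *m z a = (m - 1) *: z a.
    by rewrite scalerBl scale1r -Hm mulmxDl mul1mx addrK.
  have lE : l a = m - 1 by rewrite /l Tz dotZr zo // eqxx mulr1.
  rewrite lE; split => // x xz; have := mx x xz.
  by rewrite mulmxDl mul1mx dotDr mulrBl mul1r lerBrDr.
pose s i := if (i < d)%N then Num.sqrt (l i) else 0.
have l0 i : 0 <= l i by apply: Tpsd.2.
pose V : 'M[R]_d := \matrix_(i, j) z j i 0.
have colV j : col j V = z j by apply/colP => i; rewrite !mxE.
have VV : V^T *m V = 1%:M.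
  by apply/matrixP => i j; rewrite trmx_mul_dot !colV zo // mxE.
have VV' : V *m V^T = 1%:M by exact: mulmx1C.
exists V, s; split => //.
- have TV : T *m V = V *m diag_mx (\row_i (s i ^+ 2)).
    apply/matrixP => i j; rewrite mul_mx_diag.
    have -> : (T *m V) i j = (T *m z j) i 0.
      by rewrite -colV !mxE; apply: eq_bigr => a _; rewrite !mxE.
    by rewrite (ze j _).1 // !mxE /s ltn_ord sqr_sqrtr // mulrC.
  by rewrite -TV -mulmxA VV' mulmx1.
- split=> [i|i]; rewrite /s; first by case: ifP => // _; exact: sqrtr_ge0.
  by rewrite ltnNge => ->.
- move=> i j ij; rewrite /s; case: ltnP => jd; last first.
    by case: ifP => // _; exact: sqrtr_ge0.
  rewrite (leq_ltn_trans ij jd) ler_sqrt //.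
  have := (ze i (leq_ltn_trans ij jd)).2 (z j).
  rewrite zo // eqxx mulr1; apply => b bi.
  by rewrite zo // ?ltn_eqF //; [exact: leq_trans bi ij|exact: ltn_trans (leq_trans bi ij) jd].
Qed.

(** * Functions of a symmetric matrix and Schatten norms *)

Definition spectral_fun (R : realType) (d : nat) (V : 'M[R]_d) (g : nat -> R) :=
  V *m diag_mx (\row_i g i) *m V^T.

Section SpectralFun.
Variables (R : realType) (d : nat) (V : 'M[R]_d).
Hypotheses (VV : V^T *m V = 1%:M) (VV' : V *m V^T = 1%:M).
Local Notation c i x := (dot (col i V) x).

Lemma coordE (i : 'I_d) x : c i x = (V^T *m x) i 0.
Proof. by rewrite /dot mxE; apply: eq_bigr => j _; rewrite !mxE. Qed.

Lemma spectral_funE g x y : dot x (spectral_fun V g *m y) =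
  \sum_(i < d) g i * (c i x * c i y).
Proof.
rewrite /spectral_fun -!mulmxA dot_mulmxr; apply: eq_bigr => i _.
by rewrite mul_diag_mx !coordE 3!mxE mulrCA.
Qed.

Lemma parseval x y : dot x y = \sum_(i < d) c i x * c i y.
Proof.
rewrite -[y in LHS]mul1mx -VV' -mulmxA dot_mulmxr.
by apply: eq_bigr => i _; rewrite !coordE.
Qed.

Lemma coord_col (i j : 'I_d) : c i (col j V) = (i == j)%:R.
Proof. by rewrite -trmx_mul_dot VV mxE. Qed.

Lemma spectral_fun_sym g : (spectral_fun V g)^T = spectral_fun V g.
Proof. by rewrite /spectral_fun !trmx_mul trmxK tr_diag_mx mulmxA. Qed.

Lemma coord_spectral_fun g (i : 'I_d) x : c i (spectral_fun V g *m x) = g i * c i x.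
Proof.
rewrite spectral_funE (bigD1 i) //= big1 ?addr0 => [|j ji].
  by rewrite coord_col eqxx mul1r.
by rewrite coord_col (negPf ji) mul0r mulr0.
Qed.

Lemma eq_coord (x y : 'cV[R]_d) : (forall i, c i x = c i y) -> x = y.
Proof.
move=> h; apply/eqP; rewrite -subr_eq0 -dot_eq0 parseval.
by apply/eqP/big1 => i _; rewrite dotBr h subrr mul0r.
Qed.

Lemma spectral_fun_comp f g :
  spectral_fun V f *m spectral_fun V g = spectral_fun V (fun i => f i * g i).
Proof.
rewrite /spectral_fun -!mulmxA [V^T *m (V *m _)]mulmxA VV mul1mx.
congr (_ *m _); rewrite !mulmxA; congr (_ *m _).
apply/matrixP => i j; rewrite mul_diag_mx !mxE.
by case: (i == j); rewrite ?mulr1n ?mulr0n // mulr0.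
Qed.

Lemma spectral_fun_exp f n :
  spectral_fun V f ^+ n = spectral_fun V (fun i => f i ^+ n).
Proof.
elim: n => [|n IH].
  rewrite expr0 /spectral_fun.
  have -> : diag_mx (\row_(i < d) (f i ^+ 0)) = 1%:M.
    apply/matrixP => i j; rewrite !mxE expr0.
    by case: (i == j).
  by rewrite mulmx1 VV'.
rewrite exprS IH; under [in RHS]eq_fun do rewrite exprS.
exact: spectral_fun_comp.
Qed.

Lemma spectral_fun_col g (i : 'I_d) : spectral_fun V g *m col i V = g i *: col i V.
Proof.
apply: eq_coord => j; rewrite coord_spectral_fun dotZr coord_col.
by have [->|] := eqVneq j i; rewrite ?mulr0.
Qed.

Lemma char_poly_spectral_fun g :
  char_poly (spectral_fun V g) = \prod_(i < d) ('X - (g i)%:P).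
Proof.
have -> : \prod_(i < d) ('X - (g i)%:P) = char_poly (diag_mx (\row_(i < d) g i)).
  rewrite char_poly_trig ?diag_mx_is_trig //.
  by apply: eq_bigr => i _; rewrite !mxE eqxx mulr1n.
rewrite /char_poly /char_poly_mx /spectral_fun !map_mxM /=.
set P := map_mx _ V; set P' := map_mx _ V^T; set D := map_mx _ _.
have PP : P *m P' = 1%:M by rewrite -map_mxM VV' map_mx1.
have -> : 'X%:M - P *m D *m P' = P *m ('X%:M - D) *m P'.
  rewrite mulmxBr mulmxBl; congr (_ - _).
  by rewrite mul_mx_scalar -scalemxAl PP scalemx1.
rewrite !det_mulmx mulrC mulrA -det_mulmx (mulmx1C PP) det1 mul1r //.
Qed.

End SpectralFun.

(** The roots of the characteristic polynomial, repeated with multiplicity, are a permutation of the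
    [s i ^ 2]. *)
Lemma schatten_norm_spectral (R : realType) m d (N : 'M[R]_(m, d)) V s p :
  sorted_eigenbasis (N^T *m N) V s ->
  schatten_norm p N = (\sum_(i < d) s i `^ p) `^ p^-1.
Proof.
move=> [VV VV' NE [s0 sd] _]; rewrite /schatten_norm; congr (_ `^ _).
rewrite /singular_values.
have iotaE : iota 0 d = index_iota 0 d by rewrite /index_iota subn0.
have -> : char_poly (N^T *m N) = \prod_(x <- [seq s i ^+ 2 | i <- iota 0 d]) ('X - x%:P).
  have -> : N^T *m N = spectral_fun V (fun i => s i ^+ 2) by [].
  rewrite char_poly_spectral_fun // big_map.
  by rewrite iotaE big_mkord.
set S := [seq s i ^+ 2 | i <- iota 0 d]; set chi := \prod_(x <- S) _.
have chi0 : chi != 0 by rewrite monic_neq0 // monic_prod_XsubC.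
rewrite big_flatten /= big_map.
under eq_bigr => x _ do rewrite big_nseq mu_prod_XsubC.
transitivity (\sum_(x <- flatten [seq nseq (count_mem x S) x | x <- undup S])
   Num.sqrt x `^ p).
  rewrite big_flatten /= big_map; under [in RHS]eq_bigr => x _ do rewrite big_nseq.
  apply: perm_big; apply: uniq_perm; rewrite ?undup_uniq //.
    exact: polyrcf.uniq_roots.
  move=> x; rewrite -(polyrcf.roots_on_rootsR chi0) mem_undup.
  by rewrite root_prod_XsubC in_itv.
rewrite (perm_big _ (perm_count_undup _)) big_map.
rewrite iotaE big_mkord.
by apply: eq_bigr => i _; rewrite sqrtr_sqr ger0_norm.
Qed.

(** * Ky Fan's inequality and Ritz values *)

(** Norms at most one, instead of one, admit the zero vectors produced by dividing by a vanishing
    singular or Ritz value. *)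
Definition bessel_family (R : realType) (d : nat) (I : finType) (p : I -> 'cV[R]_d) :=
  (forall i j, i != j -> dot (p i) (p j) = 0) /\ (forall i, dot (p i) (p i) <= 1).

Lemma bessel (R : realType) d (I : finType) (p : I -> 'cV[R]_d) x :
  bessel_family p -> \sum_i dot (p i) x ^+ 2 <= dot x x.
Proof.
move=> [po p1]; pose y := \sum_i dot (p i) x *: p i.
have xy : dot x y = \sum_i dot (p i) x ^+ 2.
  by rewrite dot_sumr; apply: eq_bigr => i _; rewrite dotZr (dotC x).
have yy : dot y y <= \sum_i dot (p i) x ^+ 2.
  rewrite {1}/y dot_suml; apply: ler_sum => i _.
  rewrite dotZl /y dot_sumr (bigD1 i) //= big1 ?addr0 => [|j ji].
    by rewrite dotZr mulrA -expr2 ler_piMr ?sqr_ge0.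
  by rewrite dotZr po 1?eq_sym // mulr0.
by have := dot_ge0 (x - y); rewrite dotBl !dotBr (dotC y x) xy; lra.
Qed.

(** After [s r] is subtracted from every coefficient, only the indices below [r] contribute
    positively, each with weight at most one. *)
Lemma sum_weights_le (R : realType) d r (s : nat -> R) (c : 'I_d -> R) :
  (forall i, 0 <= s i) -> (forall i j, (i <= j)%N -> s j <= s i) ->
  (forall i, 0 <= c i <= 1) -> \sum_i c i <= r%:R ->
  \sum_(i < d) s i * c i <= \sum_(i < r) s i.
Proof.
move=> s0 sd c01 cr.
have -> : \sum_(i < d) s i * c i =
    \sum_(i < d) (s i - s r) * c i + s r * \sum_i c i.
  by rewrite mulr_sumr -big_split; apply: eq_bigr => i _ /=; rewrite mulrBl subrK.
have -> : \sum_(i < r) s i = \sum_(i < r) (s i - s r) + s r * r%:R.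
  rewrite sumrB sumr_const card_ord -mulr_natr; ring.
apply: lerD; last by rewrite ler_wpM2l.
apply: (@le_trans _ _ (\sum_(i < d | (i < r)%N) (s i - s r))).
  rewrite [leRHS]big_mkcond; apply: ler_sum => i _ /=.
  have /andP[c0 c1] := c01 i; case: ltnP => ir.
    by rewrite ler_piMr // subr_ge0 sd // ltnW.
  by rewrite mulr_le0_ge0 // subr_le0 sd.
have le0 i : (i < r)%N -> 0 <= s i - s r by move=> ir; rewrite subr_ge0 sd // ltnW.
case: (leqP d r) => dr.
  under eq_bigl => i do rewrite (leq_trans (ltn_ord i) dr).
  rewrite -(big_mkord xpredT (fun i => s i - s r)).
  rewrite -(big_mkord xpredT (fun i => s i - s r)).
  rewrite [leRHS](big_cat_nat (n := d)) //= lerDl big_nat.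
  by apply: sumr_ge0 => i /andP[_ ir]; exact: le0.
by rewrite (big_ord_widen _ (fun i => s i - s r) (ltnW dr)).
Qed.

(** By the arithmetic-geometric inequality the left side is at most a weighted sum of the [s j].
    Bessel's inequality bounds each weight by one, and Parseval's identity bounds their total by the
    number of vectors. *)
Lemma ky_fan (R : realType) d (H V : 'M[R]_d) s (I : finType) (p q : I -> 'cV[R]_d) :
  sorted_eigenbasis H V s -> bessel_family p -> bessel_family q ->
  \sum_i dot (p i) (spectral_fun V s *m q i) <= \sum_(j < #|I|) s j.
Proof.
move=> [VV VV' HE [s0 sz] sd] bp bq.
pose c j := (\sum_i (dot (col j V) (p i) ^+ 2 + dot (col j V) (q i) ^+ 2)) / 2.
apply: (@le_trans _ _ (\sum_(j < d) s j * c j)).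
  under eq_bigr => i _ do rewrite spectral_funE //.
  rewrite exchange_big /=; apply: ler_sum => j _.
  rewrite -mulr_sumr ler_wpM2l // /c mulr_suml; apply: ler_sum => i _.
  set a := dot _ _; set b := dot _ _; have := sqr_ge0 (a - b); nra.
have b1 (f : I -> 'cV[R]_d) j : bessel_family f -> \sum_i dot (col j V) (f i) ^+ 2 <= 1.
  move=> bf; under eq_bigr => i _ do rewrite dotC.
  by apply: le_trans (bessel _ bf) _; rewrite -trmx_mul_dot VV mxE eqxx.
apply: sum_weights_le => // [j|].
  rewrite /c divr_ge0 ?sumr_ge0 // => [|i _]; last by rewrite addr_ge0 ?sqr_ge0.
  rewrite ler_pdivrMr // mul1r big_split /=.
  by have := b1 p j bp; have := b1 q j bq; lra.
rewrite /c -mulr_suml ler_pdivrMr // exchange_big /=.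
have -> : #|I|%:R * 2 = \sum_(i : I) 2 :> R by rewrite sumr_const mulr_natl.
apply: ler_sum => i _; rewrite big_split /=.
have E (x : 'cV[R]_d) : \sum_(j < d) dot (col j V) x ^+ 2 = dot x x.
  by rewrite (parseval VV' x x); apply: eq_bigr => j _; rewrite expr2.
by rewrite !E; have := bp.2 i; have := bq.2 i; lra.
Qed.

Lemma exists_orthogonal_fin (R : realType) d (I : finType) (F : I -> 'cV[R]_d) :
  (#|I| < d)%N -> exists2 x : 'cV[R]_d, x != 0 & forall i, dot (F i) x = 0.
Proof.
move=> /(exists_orthogonal (fun a : 'I_#|I| => F (enum_val a)))[x x0 xF].
by exists x => // i; rewrite -[i]enum_rankK xF.
Qed.

Lemma quad_le (R : realType) d (H V : 'M[R]_d) s (j : nat) x :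
  sorted_eigenbasis H V s ->
  (forall a : 'I_d, (a < j)%N -> dot (col a V) x = 0) ->
  dot x (H *m x) <= s j ^+ 2 * dot x x.
Proof.
move=> [VV VV' HE [s0 sz] sd] x0.
rewrite [H](HE : H = spectral_fun V (fun i => s i ^+ 2)) spectral_funE //.
rewrite (parseval VV' x x).
rewrite mulr_sumr; apply: ler_sum => a _.
case: (ltnP a j) => aj; first by rewrite x0 // mulr0 !mulr0.
by rewrite ler_wpM2r // -?expr2 ?sqr_ge0 // lerXn2r ?nnegrE // sd.
Qed.

Lemma quad_ge (R : realType) d (H V : 'M[R]_d) s (j : nat) x :
  sorted_eigenbasis H V s ->
  (forall a : 'I_d, (j < a)%N -> dot (col a V) x = 0) ->
  s j ^+ 2 * dot x x <= dot x (H *m x).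
Proof.
move=> [VV VV' HE [s0 sz] sd] x0.
rewrite [H](HE : H = spectral_fun V (fun i => s i ^+ 2)) spectral_funE //.
rewrite (parseval VV' x x).
rewrite mulr_sumr; apply: ler_sum => a _.
case: (ltnP j a) => aj; first by rewrite x0 // mulr0 !mulr0.
by rewrite ler_wpM2r // -?expr2 ?sqr_ge0 // lerXn2r ?nnegrE // sd.
Qed.

Definition compl_proj (R : realType) (d k : nat) (U : 'M[R]_(d, k)) : 'M[R]_d :=
  1%:M - U *m U^T.

Lemma compl_proj_sym (R : realType) d k (U : 'M[R]_(d, k)) :
  (compl_proj U)^T = compl_proj U.
Proof. by rewrite linearB /= tr_scalar_mx trmx_mul trmxK. Qed.

Lemma compl_proj_fix (R : realType) d k (U : 'M[R]_(d, k)) x :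
  (forall i, dot (col i U) x = 0) -> compl_proj U *m x = x.
Proof.
move=> h; rewrite mulmxBl mul1mx -mulmxA (_ : U^T *m x = 0) ?mulmx0 ?subr0 //.
apply/colP => i; rewrite [RHS]mxE -(h i) /dot mxE.
by apply: eq_bigr => j _; rewrite !mxE.
Qed.

Lemma mul_trmx_compl_proj (R : realType) d k (U : 'M[R]_(d, k)) :
  orthonormal_columns U -> U^T *m compl_proj U = 0.
Proof. by move=> UU; rewrite mulmxBr mulmx1 mulmxA UU mul1mx subrr. Qed.

(** Some [x != 0] is orthogonal to the columns of [U], to the first [j] eigenvectors of the
    compression and to the eigenvectors of [H] of index above [k + j]: these are [d - 1] conditions.
    Its Rayleigh quotient separates the two values. *)
Lemma interlacing (R : realType) d k (H V V' : 'M[R]_d) s t (U : 'M[R]_(d, k)) j :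
  sorted_eigenbasis H V s ->
  sorted_eigenbasis (compl_proj U *m H *m compl_proj U) V' t ->
  s (k + j)%N <= t j.
Proof.
move=> HV HV'; have [_ _ _ [s0 sz] _] := HV; have [_ _ _ [t0 tz] _] := HV'.
case: (leqP d (k + j)) => kjd; first by rewrite sz.
have jd : (j < d)%N by apply: leq_ltn_trans kjd; exact: leq_addl.
pose F (i : ('I_k + 'I_j + 'I_(d - (k + j).+1))%type) : 'cV[R]_d :=
  match i with
  | inl (inl a) => col a U
  | inl (inr a) => col (widen_ord (ltnW jd) a) V'
  | inr a => col (insubd (Ordinal kjd) (k + j + a.+1)%N) V
  end.
have [|x x0 xF] := exists_orthogonal_fin F.
  by rewrite !card_sum !card_ord; clear -kjd; lia.
have xU a : dot (col a U) x = 0 by exact: xF (inl (inl a)).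
have lo : s (k + j)%N ^+ 2 * dot x x <= dot x (H *m x).
  apply: (quad_ge HV) => a ka.
  have ad : (a - (k + j).+1 < d - (k + j).+1)%N by have := ltn_ord a; lia.
  have := xF (inr (Ordinal ad)).
  congr (dot (col _ _) _ = _); apply: val_inj.
  rewrite val_insubd /=; have -> : (k + j + (a - (k + j).+1).+1 = a)%N by lia.
  by rewrite ltn_ord.
have hi : dot x (compl_proj U *m H *m compl_proj U *m x) <= t j ^+ 2 * dot x x.
  apply: (quad_le HV') => a aj.
  have := xF (inl (inr (Ordinal aj))).
  by congr (dot (col _ _) _ = _); exact: val_inj.
have : s (k + j)%N ^+ 2 * dot x x <= t j ^+ 2 * dot x x.
  apply: le_trans lo (le_trans _ hi).
  rewrite -mulmxA compl_proj_fix // -mulmxA [leRHS]dot_mulmxr compl_proj_sym.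
  by rewrite compl_proj_fix.
by rewrite ler_pM2r ?dot_gt0 // ler_pXn2r ?nnegrE.
Qed.

Section RitzKyFan.
Variables (R : realType) (d k : nat).
Variables (S V P V' : 'M[R]_d) (Z : 'M[R]_(d, k)) (s mu rho : nat -> R).
Hypothesis SV : sorted_eigenbasis S V s.
Let B := spectral_fun V s.
Hypotheses (Ps : P^T = P) (PP : P *m P = P).
Hypothesis Zo : orthonormal_columns Z.
Hypothesis TZ : forall i : 'I_k,
  B *m P *m B *m col i Z = rho i ^+ 2 *: col i Z.
Hypothesis CV : sorted_eigenbasis (compl_proj Z *m S *m compl_proj Z) V' mu.

(* Ky Fan's inequality for the Bessel families [P B z_i / rho_i], [B w_j / mu_j] and
   [z_i], [w_j], where the [z_i] are the columns of [Z] and the [w_j] those of [V']. *)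
Lemma ritz_ky_fan r m : (r <= k)%N -> (m <= d)%N ->
  \sum_(i < r) rho i + \sum_(j < m) mu j <= \sum_(i < (r + m)%N) s i.
Proof.
move=> rk md; have [VV VV' SE [s0 sz] sd] := SV.
have [WW WW' CE [m0 mz] mdec] := CV.
have Bs : B^T = B by exact: spectral_fun_sym.
have BB : B *m B = S.
  by rewrite spectral_fun_comp // SE /spectral_fun; under eq_fun do rewrite -expr2.
pose z (i : 'I_r) := col (widen_ord rk i) Z.
pose w (j : 'I_m) := col (widen_ord md j) V'.
have zz i j : dot (z i) (z j) = (i == j)%:R.
  by rewrite -trmx_mul_dot Zo mxE.
have ww i j : dot (w i) (w j) = (i == j)%:R.
  by rewrite -trmx_mul_dot WW mxE.
have Cw j : compl_proj Z *m S *m compl_proj Z *m w j = mu j ^+ 2 *: w j.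
  by rewrite CE; exact: (spectral_fun_col WW WW' (fun i => mu i ^+ 2)).
have Zw (j : 'I_m) : mu j != 0 -> forall a, dot (col a Z) (w j) = 0.
  move=> mj a; have := congr1 (dot (col a Z)) (Cw j).
  have -> : dot (col a Z) (compl_proj Z *m S *m compl_proj Z *m w j) = 0.
    rewrite -!mulmxA dot_mulmxr compl_proj_sym.
    suff -> : compl_proj Z *m col a Z = 0 by rewrite dot0l.
    apply: trmx_inj; rewrite trmx_mul compl_proj_sym trmx0.
    by rewrite tr_col -row_mul mul_trmx_compl_proj // row0.
  by rewrite dotZr => /esym/eqP; rewrite mulf_eq0 expf_eq0 (negPf mj) /= => /eqP.
have Sw (i j : 'I_m) : mu i != 0 -> mu j != 0 -> dot (w i) (S *m w j) = mu j ^+ 2 * (i == j)%:R.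
  move=> mi mj; rewrite -ww -dotZr -Cw -!mulmxA.
  by rewrite [RHS]dot_mulmxr compl_proj_sym !compl_proj_fix //; exact: Zw.
pose p (i : ('I_r + 'I_m)%type) : 'cV[R]_d := match i with
  | inl i => (rho i)^-1 *: (P *m (B *m z i))
  | inr j => (mu j)^-1 *: (B *m w j) end.
(* Eigenvectors of the compression for the eigenvalue zero need not be orthogonal to [Z], so they
   are dropped. *)
pose q (i : ('I_r + 'I_m)%type) : 'cV[R]_d := match i with
  | inl i => z i
  | inr j => (mu j != 0)%:R *: w j end.
have Tz i : B *m (P *m (B *m z i)) = rho i ^+ 2 *: z i.
  by rewrite /z -(TZ (widen_ord rk i)) -!mulmxA.
have pz i j : dot (P *m (B *m z i)) (P *m (B *m z j)) = rho j ^+ 2 * (i == j)%:R.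
  rewrite dot_mulmxl Ps [P *m (P *m _)]mulmxA PP dot_mulmxl Bs Tz dotZr zz //.
(* The Ritz equation makes the two halves of the family [p] orthogonal: this is where the columns of
   [Z] must be eigenvectors of [B P B]. *)
have pw i j : dot (P *m (B *m z i)) (B *m w j) = rho i ^+ 2 * dot (z i) (w j).
  by rewrite dot_mulmxr Bs Tz dotZl.
have wB i j : dot (B *m w i) (B *m w j) = dot (w i) (S *m w j).
  by rewrite dot_mulmxl Bs mulmxA BB.
have sqV (x : R) : (x^-1 * (x^-1 * x ^+ 2)) = (x != 0)%:R.
  by have [->|x0] := eqVneq x 0; [rewrite invr0 !mul0r|rewrite expr2 mulKf // mulVf].
have bp : bessel_family p.
  split.
    move=> [i|i] [j|j] ij; rewrite /p dotZl dotZr.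
    - by rewrite pz (_ : (i == j) = false) ?mulr0 ?mulr0 //; apply: contraNF ij => /eqP->.
    - have [->|mj] := eqVneq (mu j) 0; first by rewrite invr0 mul0r mulr0.
      by rewrite pw Zw ?mulr0.
    - have [->|mj] := eqVneq (mu i) 0; first by rewrite invr0 mul0r.
      by rewrite dotC pw Zw ?mulr0.
    - have [->|mi] := eqVneq (mu i) 0; first by rewrite invr0 mul0r.
      have [->|mj] := eqVneq (mu j) 0; first by rewrite invr0 mul0r mulr0.
      rewrite wB Sw // (_ : (i == j) = false) ?mulr0 ?mulr0 //.
      by apply: contraNF ij => /eqP->.
  move=> [i|j]; rewrite /p dotZl dotZr.
    by rewrite pz eqxx mulr1 sqV; case: eqP.
  have [->|mj] := eqVneq (mu j) 0; first by rewrite invr0 mul0r.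
  by rewrite wB Sw // eqxx mulr1 sqV mj.
have bq : bessel_family q.
  split.
    move=> [i|i] [j|j] ij; rewrite /q.
    - by rewrite zz (_ : (i == j) = false) //; apply: contraNF ij => /eqP->.
    - rewrite dotZr; have [_|mj] := eqVneq (mu j) 0; first by rewrite mul0r.
      by rewrite Zw ?mulr0.
    - rewrite dotZl; have [_|mj] := eqVneq (mu i) 0; first by rewrite mul0r.
      by rewrite dotC Zw ?mulr0.
    - rewrite dotZl dotZr ww (_ : (i == j) = false) ?mulr0 ?mulr0 //.
      by apply: contraNF ij => /eqP->.
  move=> [i|j]; rewrite /q ?zz ?eqxx // dotZl dotZr ww eqxx mulr1.
  by case: eqP; rewrite ?mulr0 ?mulr1.
have := ky_fan SV bp bq.
rewrite card_sum !card_ord; apply: le_trans; rewrite big_sumType /=.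
apply: lerD; apply: ler_sum => i _.
  rewrite dotZl -/B -[B *m z i]/(B *m z i).
  have -> : dot (P *m (B *m z i)) (B *m z i) = rho i ^+ 2.
    by rewrite dot_mulmxr Bs Tz dotZl zz eqxx mulr1.
  have [->|r0] := eqVneq (rho i) 0; first by rewrite invr0 mul0r.
  by rewrite expr2 mulrA mulVf // mul1r.
rewrite dotZl -scalemxAr dotZr -/B wB.
have [->|mj] := eqVneq (mu i) 0; first by rewrite invr0 mul0r.
by rewrite Sw // eqxx mulr1 mul1r expr2 mulrA mulVf // mul1r.
Qed.

End RitzKyFan.

(** * From Ritz values to Schatten norms *)

Lemma powRB1 (R : realType) (a p : R) : 0 <= a -> 1 <= p -> a `^ (p - 1) * a = a `^ p.
Proof.
move=> a0 p1; rewrite -{2}[a]powRr1 // -powRD ?subrK //.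
by apply/implyP => /eqP p0; exfalso; lra.
Qed.

(** This is Young's inequality for [t] and [a ^ (p - 1)] with exponents [p] and [p / (p - 1)]; for
    [p = 1] the second exponent degenerates. *)
Lemma powR_tangent (R : realType) (a t p : R) : 0 <= a -> 0 <= t -> 1 <= p ->
  a `^ p - t `^ p <= p * a `^ (p - 1) * (a - t).
Proof.
move=> a0 t0; rewrite le_eqVlt => /orP[/eqP<-|p1].
  by rewrite !powRr1 // subrr powRr0 !mul1r.
have p0 : 0 < p by lra.
pose q := p / (p - 1).
have q0 : 0 < q by rewrite divr_gt0 //; lra.
have pq : p^-1 + q^-1 = 1 by rewrite /q; field; rewrite !gt_eqF //; lra.
have := conjugate_powR t0 (powR_ge0 a (p - 1)) p0 q0 pq.
have -> : (a `^ (p - 1)) `^ q = a `^ p.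
  by rewrite -powRrM /q; congr (_ `^ _); field; rewrite gt_eqF //; lra.
move=> /(ler_wpM2l (ltW p0)).
have -> : p * (t `^ p / p + a `^ p / q) = t `^ p + (p - 1) * a `^ p.
  by rewrite /q; field; rewrite !gt_eqF //; lra.
have := powRB1 a0 (ltW p1); set b := a `^ (p - 1); set c := a `^ p.
by move=> <-; lra.
Qed.

(** The tangent is taken at [1 + x], not at [1], to keep the factor [(1 + x) ^ (p - 1)] that the
    bound on the residual produces. *)
Lemma powR_bernoulli (R : realType) (x e p : R) : 1 <= p -> 0 <= x -> 0 <= e ->
  p * (1 + x) `^ (p - 1) * (e - x) <= (1 + e) `^ p - 1.
Proof.
move=> p1 x0 e0; have x1 : 0 <= 1 + x by lra.
have e1 : 0 <= 1 + e by lra.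
have := powR_tangent x1 e1 p1.
have : 1 <= (1 + x) `^ p by rewrite -[leLHS](powRr0 (1 + x)); apply: ler_powR; lra.
have -> : 1 + x - (1 + e) = - (e - x) by ring.
rewrite mulrN; lra.
Qed.

(** The slack [del - \sum x] is nonnegative, so lowering its weight from [w m] to [w m.+1] only
    raises the bound; this is the induction step. *)
Lemma abel_le (R : realType) (m : nat) (w x : nat -> R) (del : R) :
  (forall j, w j.+1 <= w j) ->
  (forall i, (i <= m)%N -> \sum_(j < i) x j <= del) ->
  \sum_(j < m) w j * x j <= w 0%N * del - w m * (del - \sum_(j < m) x j).
Proof.
move=> wd; elim: m => [|m IH] h; first by rewrite !big_ord0 subr0 subrr.
have {}IH := IH (fun i im => h i (leqW im)).
rewrite !big_ord_recr /=; have := h m.+1 (leqnn _); rewrite big_ord_recr /=.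
have := wd m; move: IH; set a := \sum_(_ < m) _; set b := \sum_(_ < m) _; nra.
Qed.

(** An upper bound needs the slopes at the [mu j], not at the [t j]; hence the separate control [L]
    of the largest of them. *)
Lemma sum_powR_le (R : realType) (d : nat) (mu t : nat -> R) (del L p : R) :
  1 <= p -> (forall i, 0 <= mu i) -> (forall i j, (i <= j)%N -> mu j <= mu i) ->
  (forall i, 0 <= t i) -> 0 <= del ->
  (forall m, (m <= d)%N -> \sum_(j < m) mu j <= \sum_(j < m) t j + del) ->
  mu 0%N <= L ->
  \sum_(j < d) mu j `^ p <= \sum_(j < d) t j `^ p + p * L `^ (p - 1) * del.
Proof.
move=> p1 mu0 mud t0 del0 hs hL; have p0 : 0 <= p by lra.
have p10 : 0 <= p - 1 by lra.
pose w j := p * mu j `^ (p - 1).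
rewrite -lerBlDl -sumrB.
apply: (@le_trans _ _ (\sum_(j < d) w j * (mu j - t j))).
  by apply: ler_sum => j _; exact: powR_tangent.
have wd j : w j.+1 <= w j.
  rewrite /w ler_wpM2l // ge0_ler_powR ?nnegrE //.
  exact: mud (leqnSn j).
have xd i : (i <= d)%N -> \sum_(j < i) (mu j - t j) <= del.
  by move=> id; rewrite sumrB lerBlDl hs.
apply: (le_trans (@abel_le R d w (fun j => mu j - t j) del wd xd)).
rewrite -[leRHS]subr0; apply: lerB; last first.
  rewrite mulr_ge0 ?mulr_ge0 ?powR_ge0 // subr_ge0 sumrB lerBlDl; exact: hs.
rewrite ler_wpM2r // /w ler_wpM2l // ge0_ler_powR ?nnegrE //.
exact: le_trans (mu0 0%N) hL.
Qed.

Lemma psd_compress (R : realType) m d k (M : 'M[R]_(m, d)) (U : 'M[R]_(d, k)) :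
  let N := M *m (1%:M - U *m U^T) in
  N^T *m N = compl_proj U *m (M^T *m M) *m compl_proj U.
Proof. by rewrite /= -/(compl_proj U) trmx_mul compl_proj_sym !mulmxA. Qed.

Lemma psd_gram (R : realType) m d (N : 'M[R]_(m, d)) : psd (N^T *m N).
Proof.
split=> [|x]; first by rewrite trmx_mul trmxK.
by rewrite -mulmxA dot_mulmxr trmxK dot_ge0.
Qed.

Lemma approx_error_ge (R : realType) m d k p (M : 'M[R]_(m, d)) V s (U : 'M[R]_(d, k)) :
  0 < p -> sorted_eigenbasis (M^T *m M) V s ->
  (\sum_(j < d) s (k + j)%N `^ p) `^ p^-1 <= approx_error p M U.
Proof.
move=> p0 MV; have [W [t NW]] := spectral (psd_gram (M *m (1%:M - U *m U^T))).
rewrite /approx_error (schatten_norm_spectral _ NW).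
have [_ _ _ [s0 _] _] := MV; have [_ _ _ [t0 _] _] := NW.
apply: ge0_ler_powR; rewrite ?nnegrE ?invr_ge0 ?(ltW p0) //.
- by apply: sumr_ge0 => i _; exact: powR_ge0.
- by apply: sumr_ge0 => i _; exact: powR_ge0.
apply: ler_sum => j _; apply: ge0_ler_powR; rewrite ?nnegrE ?(ltW p0) //.
by move: NW; rewrite psd_compress => NW; exact: (interlacing _ MV NW).
Qed.

Section NearOptimal.
Variables (R : realType) (m d k : nat).
Variables (M : 'M[R]_(m, d)) (V P : 'M[R]_d) (Z : 'M[R]_(d, k)) (s rho : nat -> R).
Hypothesis MV : sorted_eigenbasis (M^T *m M) V s.
Let B := spectral_fun V s.
Hypotheses (Ps : P^T = P) (PP : P *m P = P).
Hypothesis Zo : orthonormal_columns Z.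
Hypothesis TZ : forall i : 'I_k,
  B *m P *m B *m col i Z = rho i ^+ 2 *: col i Z.

(** Two losses matter. The total one bounds the partial sums of the residual. The loss over the
    first [w] Ritz values bounds its largest singular value, through Ky Fan's inequality for [w]
    Ritz vectors and one residual vector. *)
Lemma ritz_near_optimal (p eps x y : R) (w : nat) :
  1 <= p -> 0 < eps -> 0 <= x -> 0 <= y -> (0 < d)%N -> (w <= k)%N ->
  \sum_(i < k) (s i - rho i) <= y * s k ->
  s w + \sum_(i < w) (s i - rho i) <= (1 + x) * s k ->
  p * (1 + x) `^ (p - 1) * y * s k `^ p <=
    ((1 + eps) `^ p - 1) * \sum_(j < d) s (k + j)%N `^ p ->
  near_optimal p eps M Z.
Proof.
move=> p1 eps0 x0 y0 d0 wk h1 h2 h3; split => //.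
have p0 : 0 < p by lra.
have [_ _ _ [s0 _] sd] := MV.
have [V' [mu NV]] := spectral (psd_gram (M *m (1%:M - Z *m Z^T))).
have [_ _ _ [mu0 _] mud] := NV.
have CV : sorted_eigenbasis (compl_proj Z *m (M^T *m M) *m compl_proj Z) V' mu.
  by rewrite -psd_compress.
have KF := ritz_ky_fan MV Ps PP Zo TZ CV.
set tail := \sum_(j < d) s (k + j)%N `^ p.
have tail0 : 0 <= tail by apply: sumr_ge0 => i _; exact: powR_ge0.
have sums : \sum_(j < d) mu j `^ p <= (1 + eps) `^ p * tail.
  have -> : (1 + eps) `^ p * tail = tail + ((1 + eps) `^ p - 1) * tail by ring.
  apply: le_trans (sum_powR_le (t := fun j => s (k + j)%N) (del := y * s k)
    (L := (1 + x) * s k) p1 mu0 mud _ _ _ _) _ => //.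
  - by rewrite mulr_ge0.
  - move=> i id; have := KF k i (leqnn k) id; rewrite big_split_ord /=.
    move: h1; rewrite sumrB; lra.
  - have := KF w 1%N wk d0; rewrite big_ord1 addn1 big_ord_recr /=.
    move: h2; rewrite sumrB; lra.
  rewrite lerD2l; apply: le_trans h3.
  rewrite powRM ?addr_ge0 ?ler01 // -(powRB1 (s0 k) p1) le_eqVlt; apply/orP; left.
  by apply/eqP; ring.
have eps1 : 0 <= 1 + eps by lra.
rewrite {1}/approx_error (schatten_norm_spectral _ NV).
apply: (@le_trans _ _ ((1 + eps) * tail `^ p^-1)).
  have -> : (1 + eps) * tail `^ p^-1 = ((1 + eps) `^ p * tail) `^ p^-1.
    rewrite powRM ?powR_ge0 // -powRrM mulfV ?gt_eqF // powRr1 //.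
  apply: ge0_ler_powR; rewrite ?nnegrE ?invr_ge0 ?(ltW p0) //.
  - by apply: sumr_ge0 => i _; exact: powR_ge0.
  - by rewrite mulr_ge0 ?powR_ge0.
rewrite ler_wpM2l // /min_approx_error; apply: lb_le_inf.
  by exists (approx_error p M Z), Z.
by move=> _ [U _ <-]; exact: (approx_error_ge _ p0 MV).
Qed.

End NearOptimal.

(** * Chebyshev filters *)

(* Chebyshev polynomials T_n and U_(n-1), generated by
   T_n + w U_(n-1) = (x + w) ^ n with w ^ 2 = x ^ 2 - 1. *)
Fixpoint chebyshev (R : realType) (n : nat) : {poly R} * {poly R} :=
  if n is m.+1 then
    let: (T, U) := chebyshev R m in
    ('X * T + ('X * 'X - 1) * U, 'X * U + T)
  else (1, 0).

Section Chebyshev.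
Variable R : realType.
Local Notation T n := (chebyshev R n).1.
Local Notation U n := (chebyshev R n).2.

Lemma chebyshevS n :
  (T n.+1 = 'X * T n + ('X * 'X - 1) * U n) * (U n.+1 = 'X * U n + T n).
Proof. by rewrite /=; case: (chebyshev R n). Qed.

Lemma size_chebyshev n : (size (T n) <= n.+1)%N /\ (size (U n) <= n)%N.
Proof.
elim: n => [|n [IHT IHU]]; first by rewrite /= size_poly1 size_poly0.
have sX (p : {poly R}) m : (size p <= m)%N -> (size ('X * p)%R <= m.+1)%N.
  move=> pm; apply: leq_trans (size_polyMleq _ _) _.
  by rewrite size_polyX.
rewrite !chebyshevS; split.
  apply: leq_trans (size_polyD _ _) _; rewrite geq_max sX //=.
  rewrite mulrBl mul1r -mulrA; apply: leq_trans (size_polyD _ _) _.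
  by rewrite geq_max !sX //= size_polyN (leq_trans IHU) // leqW.
apply: leq_trans (size_polyD _ _) _.
by rewrite geq_max sX.
Qed.

Lemma horner_chebyshev0 x : ((T 0).[x] = 1) * ((U 0).[x] = 0).
Proof. by split; rewrite /= ?horner0 // -polyC1 hornerC. Qed.

Lemma horner_chebyshevS n x :
  ((T n.+1).[x] = x * (T n).[x] + (x ^+ 2 - 1) * (U n).[x]) *
  ((U n.+1).[x] = x * (U n).[x] + (T n).[x]).
Proof. by rewrite !chebyshevS !hornerE. Qed.

Lemma chebyshev_pell n x :
  (T n).[x] ^+ 2 - (x ^+ 2 - 1) * (U n).[x] ^+ 2 = 1.
Proof.
elim: n => [|n IH]; first by rewrite !horner_chebyshev0; ring.
rewrite !horner_chebyshevS -[RHS]IH; ring.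
Qed.

Lemma chebyshev_le1 n x : 0 <= x <= 1 -> (T n).[x] ^+ 2 <= 1.
Proof.
move=> /andP[x0 x1]; have := chebyshev_pell n x.
have : 0 <= (1 - x ^+ 2) * (U n).[x] ^+ 2.
  by rewrite mulr_ge0 ?sqr_ge0 // subr_ge0 expr_le1.
lra.
Qed.

(** [T n] is the mean of [(x + w) ^ n] and [(x - w) ^ n]; the latter is nonnegative, and
    [w >= sqrt g] because [x ^ 2 - 1 >= 2 * g + g ^ 2]. *)
Lemma chebyshev_ge n x g : 0 <= g -> 1 + g <= x ->
  (1 + Num.sqrt g) ^+ n / 2 <= (T n).[x].
Proof.
move=> g0 gx; set w := Num.sqrt (x ^+ 2 - 1).
have wle : Num.sqrt g <= w by rewrite /w ler_sqrt; nra.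
have w2 : w ^+ 2 = x ^+ 2 - 1 by rewrite sqr_sqrtr //; nra.
have w0 : 0 <= w by exact: sqrtr_ge0.
have sg0 := sqrtr_ge0 g.
have TU : (T n).[x] + w * (U n).[x] = (x + w) ^+ n.
  elim: n => [|n IH]; first by rewrite !horner_chebyshev0 expr0; ring.
  rewrite exprS -IH !horner_chebyshevS -w2; ring.
have TU' : (T n).[x] - w * (U n).[x] = (x - w) ^+ n.
  elim: n {TU} => [|n IH]; first by rewrite !horner_chebyshev0 expr0; ring.
  rewrite exprS -IH !horner_chebyshevS -w2; ring.
have : (1 + Num.sqrt g) ^+ n <= (x + w) ^+ n.
  by apply: lerXn2r; rewrite ?nnegrE; lra.
have : 0 <= (x - w) ^+ n.
  apply: exprn_ge0; rewrite subr_ge0 -(ler_pXn2r (n := 2)) ?nnegrE //; last lra.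
  by rewrite w2; lra.
lra.
Qed.

(** The filter is [T q] rescaled to [[0, th]]. The weight [t] in the second clause leaves room for
    [th = 0], where a constant polynomial does. *)
Lemma chebyshev_filter (q : nat) (th g : R) : 0 <= th -> 0 <= g ->
  exists f : {poly R}, [/\ (size f <= q.+1)%N,
    forall t, 0 <= t <= th -> t * f.[t] ^+ 2 <= th &
    forall t, (1 + g) * th <= t -> (1 + Num.sqrt g) ^+ q / 2 <= f.[t]].
Proof.
rewrite le_eqVlt => /orP[/eqP<-|th0] g0.
  exists ((1 + Num.sqrt g) ^+ q / 2)%:P; split.
  - by apply: leq_trans (size_polyC_leq1 _) _.
  - by move=> t /andP[t0 t1]; rewrite (@le_anti _ _ t 0) ?t0 ?t1 // mul0r.
  - by move=> t _; rewrite hornerC.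
exists (T q \Po (th^-1 *: 'X)); split.
- apply: leq_trans (size_comp_poly_leq _ _) _.
  have s1 : (size (th^-1 *: 'X : {poly R})).-1 = 1%N.
    by rewrite size_scale ?size_polyX // invr_eq0 gt_eqF.
  rewrite s1 muln1 ltnS; have := (size_chebyshev q).1.
  by case: (size _).
- move=> t /andP[t0 tt]; rewrite horner_comp hornerZ hornerX.
  apply: le_trans (tt); rewrite ler_piMr // chebyshev_le1 //.
  by rewrite mulr_ge0 ?invr_ge0 ?(ltW th0) //= mulrC ler_pdivrMr ?mul1r.
- move=> t ht; rewrite horner_comp hornerZ hornerX; apply: chebyshev_ge => //.
  by rewrite mulrC ler_pdivlMr.
Qed.

End Chebyshev.

Lemma cauchy_schwarz (R : realType) d (x y : 'cV[R]_d) :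
  dot x y ^+ 2 <= dot x x * dot y y.
Proof.
have [->|y0] := eqVneq y 0; first by rewrite !dot0r expr0n mulr0.
have yy : 0 < dot y y by rewrite dot_gt0.
have := dot_ge0 (dot y y *: x - dot x y *: y).
rewrite !(dotBl, dotBr, dotZl, dotZr) (dotC y x) => h.
have : 0 <= dot y y * (dot x x * dot y y - dot x y ^+ 2).
  by apply: le_trans h _; rewrite le_eqVlt; apply/orP; left; apply/eqP; ring.
by rewrite pmulr_rge0 // subr_ge0.
Qed.

(** * Lower bound for one Ritz value *)

Section RitzLower.
Variables (R : realType) (n d k b : nat) (N q : nat).
Variables (A : 'M[R]_(n, d)) (V P : 'M[R]_d) (a : nat -> R).
Hypothesis AV : sorted_eigenbasis (A^T *m A) V a.
Let s i := a i ^+ N.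
Let S := (A^T *m A) ^+ N.
Let B := spectral_fun V s.
Hypotheses (Ps : P^T = P) (PP : P *m P = P).
Variables (Z : 'M[R]_(d, k)) (rho : nat -> R).
Hypothesis rho0 : forall i, 0 <= rho i.
Hypothesis Zmax : forall (i : 'I_k) x,
  (forall j : 'I_k, (j < i)%N -> dot (col j Z) x = 0) ->
  dot x (B *m P *m B *m x) <= rho i ^+ 2 * dot x x.
Variable G : 'M[R]_(n, b).
Hypothesis bd : (b <= d)%N.
Hypothesis krylov : forall j, (j <= q)%N ->
  P *m (B *m S ^+ j *m A^T *m G) = B *m S ^+ j *m A^T *m G.

(* Vanishes when [a j = 0], since [0^-1 = 0]. *)
Definition left_singular (j : 'I_d) : 'cV[R]_n := (a j)^-1 *: (A *m col j V).
Local Notation u := left_singular.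

Let VV : V^T *m V = 1%:M. Proof. by case: AV. Qed.
Let VV' : V *m V^T = 1%:M. Proof. by case: AV. Qed.
Let a0 i : 0 <= a i. Proof. by case: AV => _ _ _ []. Qed.
Let adec i j : (i <= j)%N -> a j <= a i. Proof. by case: AV => _ _ _ _; exact. Qed.
Let s0 i : 0 <= s i. Proof. exact: exprn_ge0. Qed.
Let sdec i j : (i <= j)%N -> s j <= s i.
Proof. by move=> ij; apply: lerXn2r; rewrite ?nnegrE // adec. Qed.

Lemma gram_spectral : A^T *m A = spectral_fun V (fun i => a i ^+ 2).
Proof. by case: AV. Qed.

Lemma gram_exp_spectral : S = spectral_fun V (fun i => s i ^+ 2).
Proof.
rewrite /S gram_spectral spectral_fun_exp //; congr (spectral_fun V _).
by apply/funext => i; rewrite /s exprAC.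
Qed.

Lemma mul_A_col (j : 'I_d) : A *m col j V = a j *: u j.
Proof.
rewrite /u scalerA; have [aj|aj] := eqVneq (a j) 0; last by rewrite mulfV ?scale1r.
rewrite aj mul0r scale0r; apply/eqP; rewrite -dot_eq0 dot_mulmxl mulmxA.
by rewrite gram_spectral spectral_fun_col // aj expr0n scale0r dot0r.
Qed.

Lemma left_singular_bessel : bessel_family u.
Proof.
have E i j : dot (u i) (u j) = (a i)^-1 * (a j)^-1 * a j ^+ 2 * (i == j)%:R.
  rewrite /u dotZl dotZr dot_mulmxl mulmxA gram_spectral spectral_fun_col //.
  by rewrite dotZr coord_col // !mulrA.
split=> [i j ij|i]; first by rewrite E (negPf ij) mulr0.
rewrite E eqxx mulr1; have [->|ai] := eqVneq (a i) 0.
  by rewrite invr0 !mul0r.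
by rewrite -mulrA expr2 mulKf // mulVf.
Qed.

Let fS (f : {poly R}) : 'M[R]_d := \sum_(j < size f) f`_j *: S ^+ j.

Lemma poly_spectral f : fS f = spectral_fun V (fun i => f.[s i ^+ 2]).
Proof.
apply/matrixP => i j; rewrite /spectral_fun.
have E g : (V *m diag_mx (\row_i (g i : R)) *m V^T) i j =
    \sum_(l < d) V i l * g l * V j l.
  by rewrite mxE; apply: eq_bigr => l _; rewrite mul_mx_diag !mxE.
rewrite (E (fun i => f.[s i ^+ 2])) /fS summxE.
under eq_bigr => l _.
  rewrite gram_exp_spectral spectral_fun_exp // mxE /spectral_fun.
  rewrite (E (fun i => (s i ^+ 2) ^+ l)) mulr_sumr; over.
rewrite exchange_big /=; apply: eq_bigr => l _.
rewrite horner_coef mulr_sumr mulr_suml; apply: eq_bigr => m _; ring.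
Qed.

(* The Rayleigh quotient is tested on [S x], where [x = f(S) A^T G c] and [c != 0] is
   such that [S x] is orthogonal to the first [i] Ritz vectors and [G c] to the left
   singular vectors of indices [i + 1], ..., [b - 1]. *)
Lemma ritz_lower (i : 'I_k) (f : {poly R}) (th th2 T2 Psi : R) :
  (i < b)%N -> 0 < a i -> (size f <= q.+1)%N ->
  (forall c, dot (G *m c) (G *m c) <=
     T2 * \sum_(j < b) dot (u (widen_ord bd j)) (G *m c) ^+ 2) ->
  (forall c, (forall j : 'I_b, dot (u (widen_ord bd j)) (G *m c) = 0) -> c = 0) ->
  0 <= th2 -> (forall t, 0 <= t <= th2 -> t * f.[t] ^+ 2 <= th2) ->
  0 < Psi -> (forall t, s i ^+ 2 <= t -> Psi <= f.[t]) ->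
  0 <= th <= s i -> (forall j, (b <= j)%N -> s j ^+ 2 <= th2 \/ th <= s j) ->
  th ^+ 2 * th2 * T2 <= (s i ^+ 2 - th ^+ 2) * s i ^+ 2 * Psi ^+ 2 ->
  th <= rho i.
Proof.
move=> ib ai sf cond inj th20 fle Psi0 fge /andP[th0 ths] low h.
have BB : B *m B = S.
  by rewrite gram_exp_spectral spectral_fun_comp.
have Bs : B^T = B by exact: spectral_fun_sym.
pose X := fS f *m A^T *m G.
have PX : P *m (B *m X) = B *m X.
  rewrite /X /fS !mulmx_suml !mulmx_sumr; apply: eq_bigr => j _.
  rewrite -!scalemxAl -!scalemxAr; congr (_ *: _); rewrite !mulmxA.
  by rewrite -!mulmxA !mulmxA -krylov ?mulmxA // -ltnS (leq_trans (ltn_ord j)).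
pose F (j : ('I_i + 'I_(b - i.+1))%type) : 'cV[R]_b := match j with
  | inl j => (S *m X)^T *m col (widen_ord (ltnW (ltn_ord i)) j) Z
  | inr j => G^T *m u (widen_ord bd (insubd (Ordinal ib) (i + j.+1)%N)) end.
have [|c c0 cF] := exists_orthogonal_fin F.
  by rewrite card_sum !card_ord; clear -ib; lia.
set e := G *m c in cond inj *.
pose eh (j : 'I_d) := dot (u j) e.
have emid (j : 'I_b) : (i < j)%N -> eh (widen_ord bd j) = 0.
  move=> ij.
  have jb : (j - i.+1 < b - i.+1)%N by have := ltn_ord j; lia.
  have := cF (inr (Ordinal jb)); rewrite /F /eh -dot_mulmxr.
  congr (dot (u _) _ = _); apply: val_inj; rewrite /= val_insubd /=.
  have -> : (i + (j - i.+1).+1 = j)%N by lia.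
  by rewrite ltn_ord.
set x := X *m c; set y := B *m x; set z := S *m x.
have xE (j : 'I_d) : dot (col j V) x = f.[s j ^+ 2] * (a j * eh j).
  rewrite /x /X -!mulmxA poly_spectral coord_spectral_fun // dot_mulmxr trmxK.
  by rewrite mul_A_col dotZl.
have zZ (j : 'I_k) : (j < i)%N -> dot (col j Z) z = 0.
  move=> ji; have := cF (inl (Ordinal ji)); rewrite /F -dot_mulmxr -mulmxA.
  by congr (dot (col _ _) _ = _); apply: val_inj.
have yy : dot y y = \sum_(j < d) s j ^+ 2 * dot (col j V) x ^+ 2.
  by rewrite dot_mulmxl Bs mulmxA BB gram_exp_spectral spectral_funE.
have zz : dot z z = \sum_(j < d) s j ^+ 4 * dot (col j V) x ^+ 2.
  rewrite (parseval VV' z z); apply: eq_bigr => j _.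
  rewrite /z gram_exp_spectral coord_spectral_fun //; ring.
pose E := \sum_(j < b) eh (widen_ord bd j) ^+ 2.
have si0 : 0 < s i by exact: exprn_gt0.
have big (j : 'I_d) : (j <= i)%N -> [/\ a i <= a j, s i <= s j & Psi <= f.[s j ^+ 2]].
  move=> ji; have := sdec ji => sij; split=> //; first exact: adec.
  by apply: fge; apply: lerXn2r; rewrite ?nnegrE.
have z0 : z != 0.
  apply: contra_neq c0 => z0; apply: (inj) => j; rewrite -/e -/(eh _).
  case: (leqP j i) => ij; last exact: emid.
  have [aj sj fj] := big (widen_ord bd j) ij.
  have /eqP : dot (col (widen_ord bd j) V) z = 0 by rewrite z0 dot0r.
  rewrite /z gram_exp_spectral coord_spectral_fun // xE.
  have sj0 := expf_neq0 2 (lt0r_neq0 (lt_le_trans si0 sj)).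
  rewrite mulf_eq0 (negPf sj0) /= mulf_eq0 (gt_eqF (lt_le_trans Psi0 fj)) /=.
  by rewrite mulf_eq0 (gt_eqF (lt_le_trans ai aj)) /= => /eqP.
(* In the expansion of [|z|^2 - th^2 |y|^2], [K1] bounds from below the gain of the indices up to
   [i] and [K2] from above the deficit of the others, per unit of [eh j ^ 2]. The hypothesis [h] and
   the conditioning of [G] make the gain dominate. *)
pose K1 := s i ^+ 2 * (s i ^+ 2 - th ^+ 2) * Psi ^+ 2 * a i ^+ 2.
pose K2 := th ^+ 2 * th2 * a i ^+ 2.
have th2s : th ^+ 2 <= s i ^+ 2 by apply: lerXn2r; rewrite ?nnegrE.
have K10 : 0 <= K1.
  by rewrite /K1 !mulr_ge0 ?sqr_ge0 // ?subr_ge0 // ltW.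
have K20 : 0 <= K2 by rewrite /K2 !mulr_ge0 ?sqr_ge0.
have term (j : 'I_d) : K1 * ((j <= i)%N%:R * eh j ^+ 2) - K2 * eh j ^+ 2 <=
    s j ^+ 4 * dot (col j V) x ^+ 2 - th ^+ 2 * (s j ^+ 2 * dot (col j V) x ^+ 2).
  have -> : s j ^+ 4 * dot (col j V) x ^+ 2 -
      th ^+ 2 * (s j ^+ 2 * dot (col j V) x ^+ 2) =
      (s j ^+ 2 * (s j ^+ 2 - th ^+ 2)) * f.[s j ^+ 2] ^+ 2 * a j ^+ 2 * eh j ^+ 2.
    by rewrite xE; ring.
  have ej := sqr_ge0 (eh j).
  case: (leqP j i) => ij.
    have [aj sj fj] := big j ij.
    have ss : s i ^+ 2 <= s j ^+ 2 by apply: lerXn2r; rewrite ?nnegrE.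
    rewrite mul1r -mulrBl ler_wpM2r //.
    apply: (@le_trans _ _ K1); first by rewrite lerBlDr lerDl.
    rewrite /K1; apply: ler_pM => //.
    - by apply: mulr_ge0; [apply: mulr_ge0; rewrite ?sqr_ge0 ?subr_ge0|exact: sqr_ge0].
    - exact: sqr_ge0.
    - apply: ler_pM; rewrite ?sqr_ge0 //.
      + by apply: mulr_ge0; rewrite ?sqr_ge0 ?subr_ge0.
      + by apply: ler_pM; rewrite ?sqr_ge0 ?subr_ge0 ?lerD2r.
      by apply: lerXn2r; rewrite ?nnegrE // ltW // (lt_le_trans Psi0).
    - by apply: lerXn2r; rewrite ?nnegrE.
  rewrite mul0r mulr0 add0r.
  case: (ltnP j b) => jb.
    have := emid (Ordinal jb) ij; rewrite (_ : widen_ord _ _ = j) => [->|].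
      by rewrite expr0n !mulr0 oppr0.
    exact: val_inj.
  rewrite -mulNr ler_wpM2r //.
  (* An index with [th <= s j] contributes a nonnegative term whatever the filter does there; only
     the others need the filter to be small. *)
  have [sj|sj] := low j jb; last first.
    apply: (@le_trans _ _ 0); first by rewrite oppr_le0.
    apply: mulr_ge0; last exact: sqr_ge0.
    apply: mulr_ge0; last exact: sqr_ge0.
    apply: mulr_ge0; first exact: sqr_ge0.
    by rewrite subr_ge0; apply: lerXn2r; rewrite ?nnegrE.
  have fj := fle (s j ^+ 2); rewrite sqr_ge0 sj in fj; have {}fj := fj isT.
  have aj : a j ^+ 2 <= a i ^+ 2 by apply: lerXn2r; rewrite ?nnegrE // adec // ltnW.
  apply: (@le_trans _ _ (- (th ^+ 2 * (s j ^+ 2 * f.[s j ^+ 2] ^+ 2) * a j ^+ 2))).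
    have fs0 : 0 <= s j ^+ 2 * f.[s j ^+ 2] ^+ 2 by apply: mulr_ge0; exact: sqr_ge0.
    rewrite lerN2 /K2; apply: ler_pM; rewrite ?sqr_ge0 //.
      by apply: mulr_ge0; rewrite ?sqr_ge0.
    by rewrite ler_wpM2l ?sqr_ge0.
  rewrite -subr_ge0 (_ : _ - _ = s j ^+ 4 * f.[s j ^+ 2] ^+ 2 * a j ^+ 2); last by ring.
  by apply: mulr_ge0; [apply: mulr_ge0|]; rewrite ?sqr_ge0 ?exprn_ge0.
have bE : \sum_(j < d) (j <= i)%N%:R * eh j ^+ 2 = E.
  pose g j := eh (insubd (widen_ord bd (Ordinal ib)) j) ^+ 2.
  have gE (j : 'I_d) : g j = eh j ^+ 2.
    by rewrite /g; congr (eh _ ^+ 2); apply: val_inj; rewrite val_insubd ltn_ord.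
  have -> : E = \sum_(j < b) g j by apply: eq_bigr => j _; rewrite -gE.
  rewrite (big_ord_widen d g bd) [RHS]big_mkcond; apply: eq_bigr => j _.
  rewrite gE; case: (leqP j i) => ij; first by rewrite (leq_ltn_trans ij ib) mul1r.
  case: ltnP => jb; last by rewrite mul0r.
  have := emid (Ordinal jb) ij; rewrite (_ : widen_ord _ _ = j) => [->|].
    by rewrite expr0n mulr0.
  exact: val_inj.
have zy : th ^+ 2 * dot y y <= dot z z.
  rewrite -subr_ge0 zz yy mulr_sumr -sumrB.
  apply: le_trans (ler_sum _ (fun j _ => term j)).
  rewrite sumrB -!mulr_sumr bE subr_ge0.
  apply: (@le_trans _ _ (K2 * (T2 * E))).
    rewrite ler_wpM2l //; apply: le_trans (cond c).
    exact: (bessel e left_singular_bessel).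
  rewrite mulrA ler_wpM2r ?sumr_ge0 // => [j _|]; first exact: sqr_ge0.
  rewrite /K1 /K2.
  have -> : th ^+ 2 * th2 * a i ^+ 2 * T2 = th ^+ 2 * th2 * T2 * a i ^+ 2 by ring.
  by rewrite ler_wpM2r ?sqr_ge0 // (le_trans h) // [_ * s i ^+ 2]mulrC.
have zz0 : 0 < dot z z by rewrite dot_gt0.
have zE : z = B *m y by rewrite /y mulmxA BB.
have yy0 : 0 < dot y y.
  by rewrite dot_gt0; apply: contra_neq z0; rewrite zE => ->; rewrite mulmx0.
have zT := Zmax zZ.
have zTE : dot z (B *m P *m B *m z) = dot (P *m (B *m z)) (P *m (B *m z)).
  by rewrite dot_mulmxl Ps [P *m (P *m _)]mulmxA PP dot_mulmxl Bs !mulmxA.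
(* Since [z = B y] and [P y = y], [|z|^2] is the inner product of [P B z] with [y]; hence [|z|^4] is
   at most [|y|^2] times the quadratic form of [B P B] at [z]. *)
have cs := cauchy_schwarz (P *m (B *m z)) y.
have cE : dot (P *m (B *m z)) y = dot z z.
  have Py : P *m y = y by rewrite /y /x (mulmxA B) mulmxA PX.
  by rewrite dot_mulmxl Ps Py dot_mulmxl Bs -zE.
rewrite cE -zTE in cs.
have : dot z z * dot z z <= (rho i ^+ 2 * dot y y) * dot z z.
  rewrite -expr2 (le_trans cs) // mulrAC ler_wpM2r // ltW //.
rewrite ler_pM2r // => zr.
have : th ^+ 2 * dot y y <= rho i ^+ 2 * dot y y by exact: le_trans zr.
by rewrite ler_pM2r // ler_pXn2r ?nnegrE.
Qed.

End RitzLower.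

(** * Computing the Ritz vectors from the answers *)

(* Given [v = B ^ 2 w], turns [B P B] into [B P' B], where the range of [P'] is that
   of [P] extended by [B w], without access to [B] or [P]. If [B w] is already in the
   range of [P], then [xi = 0] and the update vanishes. *)
Definition compress_step (R : realType) (d : nat) (T : 'M[R]_d)
    (wv : 'cV[R]_d * 'cV[R]_d) : 'M[R]_d :=
  let xi := wv.2 - T *m wv.1 in T + (dot wv.1 xi)^-1 *: (xi *m xi^T).

Definition compress (R : realType) (d : nat) (r : seq ('cV[R]_d * 'cV[R]_d)) :=
  foldl (@compress_step R d) 0 r.

(** Each step is a Gram-Schmidt step seen through [B]: for the new component [h = (1 - P) B w], one
    has [xi = B h] and [dot w xi = |h|^2]. *)
Lemma compressP (R : realType) d (B : 'M[R]_d) (r : seq 'cV[R]_d) : B^T = B ->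
  exists P : 'M[R]_d, [/\ P^T = P, P *m P = P,
    compress [seq (w, B *m B *m w) | w <- r] = B *m P *m B &
    forall w, w \in r -> P *m (B *m w) = B *m w].
Proof.
move=> Bs; elim/last_ind: r => [|r w [P [Ps PP PE Pr]]].
  by exists 0; split; rewrite ?trmx0 ?mulmx0 ?mul0mx.
pose h := B *m w - P *m (B *m w); set c := (dot h h)^-1.
have hE : h = (1%:M - P) *m (B *m w) by rewrite mulmxBl mul1mx.
have Ph : P *m h = 0 by rewrite /h mulmxBr (mulmxA P P) PP subrr.
have Bwh : dot (B *m w) h = dot h h.
  by rewrite {2}/h dotBl [dot (P *m _) _]dot_mulmxl Ps Ph dot0r subr0.
have ch : (c * dot h h) *: h = h.
  have [h0|h0] := eqVneq h 0; first by rewrite h0 scaler0.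
  by rewrite /c mulVf ?scale1r // dot_eq0.
have hh : (h *m h^T) *m (h *m h^T) = dot h h *: (h *m h^T).
  by rewrite mulmxA mul_col_rowE scalemxAl.
exists (P + c *: (h *m h^T)); split.
- by rewrite linearD linearZ /= trmx_mul trmxK Ps.
- rewrite mulmxDl !mulmxDr PP -!scalemxAr -!scalemxAl.
  rewrite [P *m (h *m h^T)]mulmxA Ph mul0mx scaler0 addr0; congr (_ + _).
  have -> : (h *m h^T) *m P = 0.
    by rewrite -mulmxA -[h^T *m P]trmxK trmx_mul trmxK Ps Ph trmx0 mulmx0.
  rewrite scaler0 add0r hh !scalemxAl; congr (_ *m _).
  by rewrite !scalerA -mulrA -scalerA ch.
- rewrite map_rcons /compress -cats1 foldl_cat -/(compress _) PE /=.
  rewrite /compress_step /=.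
  have -> : B *m B *m w - B *m P *m B *m w = B *m h.
    by rewrite /h mulmxBr !mulmxA.
  rewrite [in RHS]mulmxDr [in RHS]mulmxDl; congr (_ + _).
  rewrite dot_mulmxr Bs Bwh -/c -scalemxAr -scalemxAl trmx_mul Bs.
  by rewrite !mulmxA.
- move=> x; rewrite mem_rcons inE => /orP[/eqP->|xr].
    rewrite mulmxDl -scalemxAl mul_col_rowE scalerA (dotC h) Bwh ch //.
    by rewrite addrC subrK.
  rewrite mulmxDl -scalemxAl mul_col_rowE Pr //.
  have -> : dot h (B *m x) = 0 by rewrite -Pr // dot_mulmxr Ps Ph dot0l.
  by rewrite scale0r scaler0 addr0.
Qed.

(* Powers of [H], normalised by their trace, converge to a multiple of the
   projection onto the top eigenspace. The upper limit is used because it is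
   measurable in [H] without any convergence assumption. *)
Definition power_limit (R : realType) (d : nat) (H : 'M[R]_d) : 'M[R]_d :=
  \matrix_(i, j) fine (limn_esup (fun t => ((H ^+ t) i j / \tr (H ^+ t))%:E)).

(** Every nonzero column of a multiple of the top projection is a top eigenvector, and taking the
    first one is a measurable choice. *)
Fixpoint first_column (R : realType) (d : nat) (L : 'M[R]_d) (r : seq 'I_d) : 'cV[R]_d :=
  if r is c :: r' then
    if dot (col c L) (col c L) == 0 then first_column L r'
    else (Num.sqrt (dot (col c L) (col c L)))^-1 *: col c L
  else 0.

Definition power_top (R : realType) (d : nat) (H : 'M[R]_d) : 'cV[R]_d :=
  first_column (power_limit H) (enum 'I_d).

Lemma first_columnP (R : realType) d (L : 'M[R]_d) (r : seq 'I_d) :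
  (exists2 c, c \in r & col c L != 0) ->
  dot (first_column L r) (first_column L r) = 1 /\
  exists c a, first_column L r = a *: col c L.
Proof.
elim: r => [|c r IH] [e] //; rewrite inE /=.
case: (eqVneq (dot (col c L) (col c L)) 0) => c0 /orP er e0.
  apply: IH; exists e => //; case: er => // /eqP ec; move: e0 c0.
  by rewrite ec -dot_eq0 => /negPf + /eqP => ->.
split; last by exists c, (Num.sqrt (dot (col c L) (col c L)))^-1.
rewrite dotZl dotZr mulrA -invfM -expr2 sqr_sqrtr ?dot_ge0 // mulVf //.
Qed.

Lemma scale_spectral_fun (R : realType) d (V : 'M[R]_d) a g :
  a *: spectral_fun V g = spectral_fun V (fun i => a * g i).
Proof.
rewrite /spectral_fun scalemxAl scalemxAr; congr (_ *m _ *m _).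
by apply/matrixP => i j; rewrite !mxE mulrnAr.
Qed.

(** Relative to the top eigenvalue, powers of the eigenvalues tend to one or zero; the trace then
    tends to the multiplicity of the top eigenvalue. *)
Lemma power_limit_spectral (R : realType) d (H V : 'M[R]_d) s :
  sorted_eigenbasis H V s -> 0 < s 0%N ->
  power_limit H = (\sum_(l < d) (s l == s 0%N)%:R)^-1 *:
    spectral_fun V (fun i => (s i == s 0%N)%:R).
Proof.
move=> [VV VV' HE [s0 sz] sd] s00.
have d0 : (0 < d)%N by rewrite ltnNge; apply: contraTN s00 => /sz ->; rewrite ltxx.
set E := \sum_(l < d) _.
have E0 : E != 0.
  rewrite gt_eqF // /E (bigD1 (Ordinal d0)) //= eqxx ltr_pwDl ?ltr01 //.
  by apply: sumr_ge0 => l _; exact: ler0n.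
pose r l := (s l / s 0%N) ^+ 2.
have r01 l : 0 <= r l <= 1.
  rewrite /r sqr_ge0 expr_le1 ?divr_ge0 //= ler_pdivrMr // mul1r.
  exact: sd.
have r1 l : (r l == 1) = (s l == s 0%N).
  rewrite /r sqrp_eq1 ?divr_ge0 //.
  apply/idP/idP => /eqP h; apply/eqP; last by rewrite h mulfV ?gt_eqF.
  by rewrite -[LHS](divfK (lt0r_neq0 s00)) h mul1r.
have HtE t : H ^+ t = spectral_fun V (fun i => s i ^+ 2 ^+ t).
  by rewrite [H]HE; exact: spectral_fun_exp.
have funE g i j : spectral_fun V g i j = \sum_(l < d) g l * (V i l * V j l).
  by rewrite mxE; apply: eq_bigr => l _; rewrite mul_mx_diag !mxE; ring.
have trE g : \tr (spectral_fun V g) = \sum_(l < d) g l.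
  rewrite /spectral_fun mxtrace_mulC mulmxA VV mul1mx mxtrace_diag.
  by apply: eq_bigr => l _; rewrite mxE.
have rt l : (r l ^+ t @[t --> \oo] --> ((s l == s 0%N)%:R : R))%classic.
  rewrite -r1; have /andP[r0 rl] := r01 l.
  case: eqVneq => [->|rn]; first by under eq_fun do rewrite expr1n; exact: cvg_cst.
  by apply: cvg_expr; rewrite ger0_norm // lt_neqAle rn.
have csum (c : 'I_d -> R) (ss : seq 'I_d) :
    (\sum_(i <- ss) r i ^+ t * c i @[t --> \oo] -->
     \sum_(i <- ss) (s i == s 0%N)%:R * c i)%classic.
  elim: ss => [|l ss IH].
    rewrite big_nil; under eq_fun do rewrite big_nil; exact: cvg_cst.
  rewrite big_cons; under eq_fun do rewrite big_cons.
  by apply: cvgD => //; apply: cvgM; [exact: rt|exact: cvg_cst].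
apply/matrixP => i j; rewrite [LHS]mxE.
suff cv : ((H ^+ t) i j / \tr (H ^+ t) @[t --> \oo] -->
    (\sum_(l < d) (s l == s 0%N)%:R * (V i l * V j l)) / E)%classic.
  set l := _ / E in cv.
  have /cvg_limn_einf_sup[_ ->] : (((H ^+ t) i j / \tr (H ^+ t))%:E
      @[t --> \oo] --> l%:E)%classic.
    by apply/fine_cvgP; split; [exact: nearW|exact: cv].
  by rewrite /= mxE funE mulrC.
have -> : (fun t => (H ^+ t) i j / \tr (H ^+ t)) =
    (fun t => (\sum_(l < d) r l ^+ t * (V i l * V j l)) /
              (\sum_(l < d) r l ^+ t * 1)).
  apply/funext => t; have p0 : s 0%N ^+ 2 ^+ t != 0 by rewrite !expf_neq0 ?gt_eqF.
  have rE l : r l ^+ t = s l ^+ 2 ^+ t / s 0%N ^+ 2 ^+ t.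
    by rewrite /r !exprMn !exprVn mulrACA -invfM.
  rewrite HtE funE trE.
  have Ex c : \sum_(l < d) r l ^+ t * c l = (\sum_(l < d) s l ^+ 2 ^+ t * c l) / s 0%N ^+ 2 ^+ t.
    by rewrite mulr_suml; apply: eq_bigr => l _; rewrite rE mulrAC.
  rewrite (Ex (fun l => V i l * V j l)) (Ex (fun=> 1)).
  under [X in _ = _ / (X / _)]eq_bigr do rewrite mulr1.
  by rewrite invf_div mulrA divfK.
have cE := csum (fun=> 1) (index_enum _).
rewrite (_ : \sum_(_ <- _) _ = E) in cE; last by apply: eq_bigr => l _; rewrite mulr1.
apply: cvgM; first exact: (csum (fun l => V i l * V j l)).
exact: cvgV.
Qed.

Lemma power_topP (R : realType) d : top_eigenvector (@power_top R d).
Proof.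
move=> H Hpsd H0; have [V [s HV]] := spectral Hpsd.
have [VV VV' HE [s0 sz] sd] := HV.
have s00 : 0 < s 0%N.
  rewrite lt_def s0 andbT; apply: contra_neq H0 => s00.
  rewrite HE (_ : diag_mx _ = 0) ?mulmx0 ?mul0mx //.
  apply/matrixP => i j; rewrite !mxE (_ : s i = 0) ?expr0n ?mul0rn //.
  by apply/eqP; rewrite eq_le s0 andbT -s00 sd.
have d0 : (0 < d)%N by rewrite ltnNge; apply: contraTN s00 => /sz ->; rewrite ltxx.
have LE := power_limit_spectral HV s00.
set E := \sum_(l < d) _ in LE.
have E0 : 0 < E.
  rewrite /E (bigD1 (Ordinal d0)) //= eqxx ltr_pwDl ?ltr01 //.
  by apply: sumr_ge0 => l _; exact: ler0n.
have HL : H *m power_limit H = s 0%N ^+ 2 *: power_limit H.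
  rewrite LE -scalemxAr scalerA mulrC -scalerA; congr (_ *: _).
  rewrite [H in LHS]HE -/(spectral_fun V (fun i => s i ^+ 2)) spectral_fun_comp //.
  rewrite scale_spectral_fun; congr spectral_fun; apply/funext => i.
  by case: eqP => [->|]; rewrite ?mulr0.
have [] := @first_columnP R d (power_limit H) (enum 'I_d).
  pose v := col (Ordinal d0) V.
  have Lv : power_limit H *m v = E^-1 *: v.
    by rewrite LE -scalemxAl spectral_fun_col //= eqxx scale1r.
  have /existsP[c cL] : [exists c, col c (power_limit H) != 0].
    apply: contraTT isT; rewrite negb_exists => /forallP h.
    have : power_limit H *m v = 0.
      rewrite (_ : power_limit H = 0) ?mul0mx //; apply/matrixP => i j.
      have /negPn/eqP/matrixP/(_ i 0) := h j; by rewrite !mxE.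
    move=> /(congr1 (dot v)); rewrite Lv dotZr dot0r /v coord_col // eqxx mulr1.
    by move/eqP; rewrite invr_eq0 gt_eqF.
  by exists c => //; rewrite mem_enum.
move=> z1 [c [a za]]; split => //; exists (s 0%N ^+ 2).
  rewrite /power_top za -scalemxAr scalerA mulrC -scalerA; congr (_ *: _).
  by rewrite colE mulmxA HL -scalemxAl.
by move=> x; apply: (quad_le HV).
Qed.

Definition top_eigenvectors (R : realType) (d k : nat) (T : 'M[R]_d) : 'M[R]_(d, k) :=
  \matrix_(i, j) greedy_vec (@power_top R d) (T + 1%:M) j i 0.

Lemma top_eigenvectorsP (R : realType) d k (T : 'M[R]_d) : (k <= d)%N -> psd T ->
  let Z := top_eigenvectors k T in
  orthonormal_columns Z /\ exists rho : nat -> R, [/\ forall i, 0 <= rho i,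
    forall i : 'I_k, T *m col i Z = rho i ^+ 2 *: col i Z &
    forall (i : 'I_k) x, (forall j : 'I_k, (j < i)%N -> dot (col j Z) x = 0) ->
      dot x (T *m x) <= rho i ^+ 2 * dot x x].
Proof.
move=> kd Tpsd Z; have [Hs Hp] := psd_eq_shift Tpsd.
pose z := greedy_vec (@power_top R d) (T + 1%:M).
have colZ j : col j Z = z j by apply/colP => i; rewrite !mxE.
have zo (a b : 'I_k) : dot (z a) (z b) = (a == b)%:R.
  rewrite (greedy_orthonormal (@power_topP R d) Hs Hp) //.
  - exact: leq_trans (ltn_ord a) kd.
  - exact: leq_trans (ltn_ord b) kd.
split; first by apply/matrixP => i j; rewrite trmx_mul_dot !colZ zo mxE.
pose l i := dot (z i) (T *m z i).
have l0 i : 0 <= l i by exact: Tpsd.2.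
exists (fun i => Num.sqrt (l i)).
have H (i : 'I_k) : T *m z i = l i *: z i /\
    forall x, (forall j, (j < i)%N -> dot (z j) x = 0) ->
      dot x (T *m x) <= l i * dot x x.
  have id : (i < d)%N by exact: leq_trans (ltn_ord i) kd.
  have [m [Hm mx]] := greedy_eigen (@power_topP R d) Hs Hp id.
  have Tz : T *m z i = (m - 1) *: z i.
    by rewrite scalerBl scale1r -Hm mulmxDl mul1mx addrK.
  have lE : l i = m - 1 by rewrite /l Tz dotZr zo eqxx mulr1.
  rewrite lE; split => // x xz; have := mx x xz.
  by rewrite mulmxDl mul1mx dotDr mulrBl mul1r lerBrDr.
split=> [i|i|i x xz]; first exact: sqrtr_ge0.
  by rewrite sqr_sqrtr // colZ (H i).1.
rewrite sqr_sqrtr //; apply: (H i).2 => j ji.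
by have := xz (Ordinal (ltn_trans ji (ltn_ord i))) ji; rewrite colZ.
Qed.

(** * Measurability *)

Section Measurability.
Context {disp : measure_display} {X : measurableType disp} {R : realType}.
Implicit Types (d m n : nat).

Definition mx_measurable m n (f : X -> 'M[R]_(m, n)) :=
  forall i j, measurable_fun setT (fun x => f x i j).

(** The inverse is written [f * (f ^ 2) ^ (-1)], a real power of a nonnegative base; at zeros of [f]
    both sides vanish by convention. *)
Lemma measurable_funV (f : X -> R) :
  measurable_fun setT f -> measurable_fun setT (fun x => (f x)^-1).
Proof.
move=> mf; have -> : (fun x => (f x)^-1) = (fun x => f x * (f x ^+ 2) `^ (-1)).
  apply/funext => x; have [->|f0] := eqVneq (f x) 0; first by rewrite invr0 mul0r.
  by rewrite powR_inv1 ?sqr_ge0 // expr2 invfM mulrA mulfV // mul1r.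
apply: measurable_funM => //.
have m2 : measurable_fun setT (fun x => f x ^+ 2) by exact: measurable_funX.
exact: (measurableT_comp (measurable_powR (-1)) m2).
Qed.

Lemma measurable_fun_sqrt (f : X -> R) :
  measurable_fun setT f -> measurable_fun setT (fun x => Num.sqrt (f x)).
Proof.
apply: measurableT_comp; apply: nondecreasing_measurable => //.
by move=> x y xy; exact: ler_wsqrtr.
Qed.

Lemma mx_measurable_cst m n (M : 'M[R]_(m, n)) : mx_measurable (fun=> M).
Proof. by move=> i j; exact: measurable_cst. Qed.

Lemma mx_measurableD m n (f g : X -> 'M[R]_(m, n)) :
  mx_measurable f -> mx_measurable g -> mx_measurable (fun x => f x + g x).
Proof.
by move=> mf mg i j; under eq_fun do rewrite mxE; exact: measurable_funD.
Qed.

Lemma mx_measurableB m n (f g : X -> 'M[R]_(m, n)) :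
  mx_measurable f -> mx_measurable g -> mx_measurable (fun x => f x - g x).
Proof.
by move=> mf mg i j; under eq_fun do rewrite !mxE; exact: measurable_funB.
Qed.

Lemma mx_measurableZ m n (a : X -> R) (f : X -> 'M[R]_(m, n)) :
  measurable_fun setT a -> mx_measurable f -> mx_measurable (fun x => a x *: f x).
Proof.
by move=> ma mf i j; under eq_fun do rewrite mxE; exact: measurable_funM.
Qed.

Lemma mx_measurableM m n d (f : X -> 'M[R]_(m, n)) (g : X -> 'M[R]_(n, d)) :
  mx_measurable f -> mx_measurable g -> mx_measurable (fun x => f x *m g x).
Proof.
move=> mf mg i j; under eq_fun do rewrite mxE.
by apply: measurable_sum => l; exact: measurable_funM.
Qed.

Lemma mx_measurable_tr m n (f : X -> 'M[R]_(m, n)) :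
  mx_measurable f -> mx_measurable (fun x => (f x)^T).
Proof. by move=> mf i j; under eq_fun do rewrite mxE; exact: mf. Qed.

Lemma mx_measurable_col m n (f : X -> 'M[R]_(m, n)) c :
  mx_measurable f -> mx_measurable (fun x => col c (f x)).
Proof. by move=> mf i j; under eq_fun do rewrite mxE; exact: mf. Qed.

Lemma measurable_dot n (f g : X -> 'cV[R]_n) :
  mx_measurable f -> mx_measurable g -> measurable_fun setT (fun x => dot (f x) (g x)).
Proof.
by move=> mf mg; apply: measurable_sum => l; apply: measurable_funM; [exact: mf|exact: mg].
Qed.

Lemma mx_measurableX n (f : X -> 'M[R]_n) t :
  mx_measurable f -> mx_measurable (fun x => f x ^+ t).
Proof.
move=> mf; elim: t => [|t IH].
  by under eq_fun do rewrite expr0; exact: mx_measurable_cst.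
by under eq_fun do rewrite exprS; exact: mx_measurableM.
Qed.

Lemma measurable_trace n (f : X -> 'M[R]_n) :
  mx_measurable f -> measurable_fun setT (fun x => \tr (f x)).
Proof. by move=> mf; apply: measurable_sum => i; exact: mf. Qed.

Lemma mx_measurable_power_limit n (f : X -> 'M[R]_n) :
  mx_measurable f -> mx_measurable (fun x => power_limit (f x)).
Proof.
move=> mf i j; under eq_fun do rewrite mxE.
apply: measurableT_comp; first exact: fine_measurable.
apply: measurable_fun_limn_esup => t; apply/measurable_EFinP.
apply: measurable_funM; first exact: mx_measurableX.
by apply: measurable_funV; apply: measurable_trace; exact: mx_measurableX.
Qed.

Lemma mx_measurable_first_column n (f : X -> 'M[R]_n) r :
  mx_measurable f -> mx_measurable (fun x => first_column (f x) r).
Proof.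
move=> mf; elim: r => [|c r IH] /=; first exact: mx_measurable_cst.
have mc := mx_measurable_col c mf; have md := measurable_dot mc mc.
move=> i j.
have -> : (fun x => (if dot (col c (f x)) (col c (f x)) == 0 then
     first_column (f x) r else
     (Num.sqrt (dot (col c (f x)) (col c (f x))))^-1 *: col c (f x)) i j) =
   (fun x => if dot (col c (f x)) (col c (f x)) == 0 then
     first_column (f x) r i j else
     ((Num.sqrt (dot (col c (f x)) (col c (f x))))^-1 *: col c (f x)) i j).
  by apply/funext => x; case: ifP.
apply: measurable_fun_ifT; first exact: measurable_fun_eqr.
  exact: IH.
apply: mx_measurableZ => //; apply: measurable_funV; exact: measurable_fun_sqrt.
Qed.

Lemma mx_measurable_power_top n (f : X -> 'M[R]_n) :
  mx_measurable f -> mx_measurable (fun x => power_top (f x)).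
Proof.
by move=> mf; apply: mx_measurable_first_column; exact: mx_measurable_power_limit.
Qed.

Lemma mx_measurable_deflate n (f : X -> 'M[R]_n) i :
  mx_measurable f -> mx_measurable (fun x => deflate (@power_top R n) (f x) i).
Proof.
move=> mf; elim: i => [//|i IH] /=; apply: mx_measurableB => //.
have mz := mx_measurable_power_top IH.
apply: mx_measurableZ; last by apply: mx_measurableM => //; exact: mx_measurable_tr.
by apply: measurable_dot => //; exact: mx_measurableM.
Qed.

Lemma mx_measurable_top_eigenvectors n k (f : X -> 'M[R]_n) :
  mx_measurable f -> mx_measurable (fun x => top_eigenvectors k (f x)).
Proof.
move=> mf i j; under eq_fun do rewrite mxE.
apply: mx_measurable_power_top; apply: mx_measurable_deflate.
by apply: mx_measurableD => //; exact: mx_measurable_cst.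
Qed.

Lemma mx_measurable_compress n (I : Type) (r : seq I) (w v : I -> X -> 'cV[R]_n) :
  (forall i, mx_measurable (w i)) -> (forall i, mx_measurable (v i)) ->
  mx_measurable (fun x => compress [seq (w i x, v i x) | i <- r]).
Proof.
move=> mw mv; elim/last_ind: r => [|r i IH]; first exact: mx_measurable_cst.
under eq_fun do rewrite map_rcons /compress -cats1 foldl_cat -/(compress _) /=.
rewrite /compress_step /=.
have mx : mx_measurable (fun x => v i x - compress [seq (w i x, v i x) | i <- r] *m w i x).
  by apply: mx_measurableB => //; exact: mx_measurableM.
apply: mx_measurableD => //; apply: mx_measurableZ.
  by apply: measurable_funV; exact: measurable_dot.
by apply: mx_measurableM => //; exact: mx_measurable_tr.
Qed.

End Measurability.

(** * Random grid vectors *)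

(** A seed in the discrete space [nat] makes measurability in the seed automatic; it indexes the
    enumeration of a finite type with [K.+1] elements. *)
Definition uniform_nat (R : realType) (K : nat) : set nat -> \bar R :=
  msum (fun i : nat => mscale (K.+1%:R^-1)%:nng (dirac i)) K.+1.

Section UniformNat.
Variables (R : realType) (K : nat).

HB.instance Definition _ := Measure.on (@uniform_nat R K).

Lemma uniform_natE (E : set nat) :
  uniform_nat R K E = (\sum_(i < K.+1) (nat_of_ord i \in E)%:R / K.+1%:R)%:E.
Proof.
rewrite /uniform_nat /msum -sumEFin; apply: eq_bigr => i _.
transitivity (((K.+1%:R^-1)%:E : \bar R) * \d_(nat_of_ord i) E)%E; first by [].
by rewrite diracE -EFinM mulrC.
Qed.

Let uniform_nat_setT : uniform_nat R K setT = 1%E.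
Proof.
rewrite uniform_natE; under eq_bigr => i _ do rewrite in_setT.
by rewrite sumr_const card_ord -[_ *+ K.+1]mulr_natr divfK ?pnatr_eq0.
Qed.

HB.instance Definition _ :=
  Measure_isProbability.Build _ _ R (@uniform_nat R K) uniform_nat_setT.

End UniformNat.

Lemma uniform_nat_finType (R : realType) (F : finType) (x0 : F) (bad : {set F}) K :
  #|F| = K.+1 ->
  uniform_nat R K [set w | nth x0 (enum F) w \notin bad]%classic =
    (1 - #|bad|%:R / #|F|%:R)%:E.
Proof.
move=> FK; rewrite uniform_natE; congr (_%:E); rewrite -mulr_suml FK.
have -> : 1 - #|bad|%:R / K.+1%:R = (#|F|%:R - #|bad|%:R) / K.+1%:R :> R.
  by rewrite mulrBl FK mulfV ?pnatr_eq0.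
congr (_ / _); rewrite -(cardsC bad) natrD addrAC subrr add0r.
rewrite cardE -sum1_size natr_sum.
transitivity (\sum_(x <- enum F) (x \notin bad)%:R : R).
  rewrite (big_nth x0) -cardE FK big_mkord; apply: eq_bigr => i _; congr (_%:R).
  by congr nat_of_bool; apply/idP/idP; rewrite inE.
rewrite big_enum /= [RHS]big_enum /= [RHS]big_mkcond; apply: eq_bigr => x _.
by rewrite inE; case: (_ \in _).
Qed.

(** Exchanging the stored value with an external one is an involution of [F * 'I_m]. It turns pairs
    whose element is bad into pairs whose updated element is bad, of which there is at most one for
    each [f]. *)
Lemma card_fiber_le (F : finType) (m : nat) (upd : F -> 'I_m -> F) (val : F -> 'I_m)
    (bad : {set F}) :
  (forall f v, val (upd f v) = v) -> (forall f, upd f (val f) = f) ->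
  (forall f v v', upd (upd f v) v' = upd f v') ->
  (forall f v v', upd f v \in bad -> upd f v' \in bad -> v = v') ->
  (#|bad| * m <= #|F|)%N.
Proof.
move=> h1 h2 h3 h4.
pose phi (p : F * 'I_m) := (upd p.1 p.2, val p.1).
have phiK : involutive phi by move=> [f v]; rewrite /phi /= h3 h2 h1.
have -> : (#|bad| * m = \sum_(p : F * 'I_m) (p.1 \in bad))%N.
  rewrite -(pair_bigA _ (fun f (v : 'I_m) => nat_of_bool (f \in bad))) /=.
  under eq_bigr => f _ do rewrite sum_nat_const card_ord.
  rewrite -big_distrr /= mulnC; congr muln.
  by rewrite -sum1_card big_mkcond; apply: eq_bigr => f _; case: (_ \in _).
rewrite (reindex_inj (inv_inj phiK)) /=.
rewrite -(pair_bigA _ (fun f (v : 'I_m) => nat_of_bool (upd f v \in bad))) /=.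
rewrite -sum1_card; apply: leq_sum => f _.
have [/existsP[v0 hv0]|/existsPn h] := boolP [exists v, upd f v \in bad].
  rewrite (bigD1 v0) //= hv0 big1 // => v vv0.
  by case: (boolP (upd f v \in bad)) => // /h4 /(_ hv0) /eqP; rewrite (negPf vv0).
by rewrite big1 // => v _; rewrite (negPf (h v)).
Qed.

Definition grid_mx (R : realType) (n b m : nat) (f : {ffun 'I_n * 'I_b -> 'I_m}) :
  'M[R]_(n, b) := \matrix_(i, j) (f (i, j))%:R.

Section Separation.
Variables (R : realType) (n b b' : nat).
Hypothesis bb : (b' <= b)%N.
(** Each of at most [n] columns will be bad for a proportion at most [1 / (20 * n)] of the grids,
    hence [1 / 20] in total. *)
Let m := (20 * n)%N.
Variable u : 'I_b' -> 'cV[R]_n.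
Hypothesis uo : forall i j, dot (u i) (u j) = (i == j)%:R.
Let F := {ffun 'I_n * 'I_b -> 'I_m}.
Local Notation g f j := (col (widen_ord bb j) (grid_mx R f)).

Definition normal_dirs (f : F) (t : 'I_b') : set 'cV[R]_n :=
  [set w | (exists om : 'I_b' -> R, w = \sum_j om j *: u j) /\ dot w w = 1 /\
    forall s, s != t -> dot w (g f s) = 0]%classic.

Lemma normal_dirs_nonempty f t : (normal_dirs f t !=set0)%classic.
Proof.
pose L (s : {s : 'I_b' | s != t}) : 'cV[R]_b' := \col_j dot (u j) (g f (val s)).
have [|x x0 xL] := exists_orthogonal_fin L.
  rewrite card_sig -[X in (_ < X)%N]card_ord -(cardC (pred1 t)) card1 add1n ltnS.
  by apply: eq_leq; apply: eq_card => s; rewrite !inE.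
pose w := \sum_j x j 0 *: u j.
have ww : dot w w = dot x x.
  rewrite {1}/w dot_suml; apply: eq_bigr => j _; rewrite dotZl dot_sumr.
  rewrite (bigD1 j) //= big1 ?addr0 => [|l lj]; first by rewrite dotZr uo eqxx mulr1.
  by rewrite dotZr uo eq_sym (negPf lj) mulr0.
have w0 : 0 < dot w w by rewrite ww dot_gt0.
exists ((Num.sqrt (dot w w))^-1 *: w); split; [|split].
- exists (fun j => (Num.sqrt (dot w w))^-1 * x j 0).
  by rewrite scaler_sumr; apply: eq_bigr => j _; rewrite scalerA.
- by rewrite dotZl dotZr mulrA -invfM -expr2 sqr_sqrtr ?ltW // mulVf ?gt_eqF.
- move=> s st; rewrite dotZl (_ : dot w (g f s) = 0) ?mulr0 //.
  rewrite dot_suml; under eq_bigr => j _ do rewrite dotZl.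
  rewrite -[RHS](xL (exist _ s st)); apply: eq_bigr => j _.
  by rewrite mxE mulrC.
Qed.

(** The choice depends only on the set, which does not mention column [t]; modifying that column
    therefore leaves the normal in place. *)
Definition normal_dir f t : 'cV[R]_n := xget 0 (normal_dirs f t).

Lemma normal_dirP f t : normal_dirs f t (normal_dir f t).
Proof. by have [w hw] := normal_dirs_nonempty f t; exact: (xgetI _ hw). Qed.

Definition big_coord (w : 'cV[R]_n) (x : 'I_n) : 'I_n :=
  odflt x [pick i | 1 <= w i 0 ^+ 2 * n%:R].

(** Averaging gives a coordinate of square at least [1 / n]; as it is at most one in absolute value,
    the same bound holds without the square. *)
Lemma big_coordP w x : dot w w = 1 -> n%:R^-1 <= `|w (big_coord w x) 0|.
Proof.
move=> w1; have n0 : 0 < n%:R :> R by rewrite ltr0n (leq_ltn_trans _ (ltn_ord x)).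
rewrite /big_coord; case: pickP => [i wi|h] /=; last first.
  suff : dot w w < 1 by rewrite w1 ltxx.
  apply: (@lt_le_trans _ _ (\sum_(i < n) n%:R^-1)); last first.
    by rewrite sumr_const card_ord -[_ *+ n]mulr_natl mulfV // gt_eqF.
  apply: ltr_sum; first by apply/hasP; exists x; rewrite ?mem_index_enum.
  move=> i _; rewrite -expr2 ltNge; apply/negP => hi.
  by have := h i; rewrite -ler_pdivrMr // div1r hi.
have wi1 : `|w i 0| <= 1.
  rewrite -(@expr_le1 _ 2) // real_normK ?num_real // -w1 /dot (bigD1 i) //= -expr2.
  by rewrite lerDl; apply: sumr_ge0 => j _; rewrite -expr2 sqr_ge0.
rewrite -div1r ler_pdivrMr // (le_trans wi) // ler_wpM2r ?ler0n //.
by rewrite -[w i 0 ^+ 2]real_normK ?num_real // expr2 ler_piMl.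
Qed.

Definition bad_set (t : 'I_b') : {set F} :=
  [set f | `|dot (normal_dir f t) (g f t)| < (2 * n%:R)^-1].

(* Changing the entry of column [t] at a coordinate where the unit normal to the other
   columns is at least [1 / n] moves the inner product by steps of size at least [1 / n],
   and the normal does not depend on that entry: at most one value is bad. *)
Lemma card_bad_set t : (0 < n)%N -> (#|bad_set t| * m <= #|F|)%N.
Proof.
move=> n0; pose x0 : 'I_n := Ordinal n0.
pose cd f := (big_coord (normal_dir f t) x0, widen_ord bb t).
pose upd (f : F) v : F := [ffun p => if p == cd f then v else f p].
have upd_dirs f v : normal_dir (upd f v) t = normal_dir f t.
  rewrite /normal_dir; congr (xget 0 _); apply/seteqP.
  have E (s : 'I_b') : s != t -> g (upd f v) s = g f s.
    move=> st; apply/colP => i; rewrite !mxE ffunE xpair_eqE.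
    rewrite (_ : (widen_ord bb s == widen_ord bb t) = false) ?andbF //.
    by apply: contraNF st => /eqP /(congr1 val) /= /val_inj ->.
  by split=> w [h1 [h2 h3]]; split=> //; split=> // s st; have := h3 s st; rewrite E.
have cd_upd f v : cd (upd f v) = cd f by rewrite /cd upd_dirs.
apply: (@card_fiber_le _ _ upd (fun f => f (cd f))).
- by move=> f v; rewrite cd_upd ffunE eqxx.
- by move=> f; apply/ffunP => p; rewrite ffunE; case: eqP => [->|].
- move=> f v v'; apply/ffunP => p; rewrite [LHS]ffunE [RHS]ffunE cd_upd.
  by case: ifP => // h; rewrite ffunE h.
move=> f v v'; rewrite !inE !upd_dirs.
set w := normal_dir f t; set D := _^-1 => hv hv'.
have [_ [w1 _]] := normal_dirP f t; rewrite -/w in w1.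
have wc := big_coordP x0 w1; set c := big_coord w x0 in wc.
have n0' : 0 < n%:R :> R by rewrite ltr0n.
have diff : dot w (g (upd f v) t) - dot w (g (upd f v') t) =
    w c 0 * (v%:R - v'%:R).
  rewrite -dotBr /dot (bigD1 c) //= big1 ?addr0 => [|i ic].
    by rewrite !mxE !ffunE /cd -/w -/c eqxx.
  rewrite !mxE !ffunE /cd -/w -/c xpair_eqE (negPf ic) /= subrr mulr0 //.
have : `|w c 0 * (v%:R - v'%:R)| < n%:R^-1.
  rewrite -diff (le_lt_trans (ler_normB _ _)) // (lt_le_trans (ltrD hv hv')) //.
  by rewrite /D invfM; lra.
rewrite normrM => h.
have : `|v%:R - v'%:R : R| < 1.
  rewrite ltNge; apply/negP => h1; move: h; apply/negP; rewrite -leNgt.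
  by rewrite (le_trans wc) // ler_peMr.
move=> h1; apply/val_inj/eqP; move: h1; apply: contraTT; rewrite -leNgt.
wlog : v v' {hv hv' diff h} / (v < v')%N => [hw|lt] vv'.
  move: (vv'); rewrite neq_ltn => /orP[|] lt; first exact: hw.
  by rewrite distrC; apply: hw => //; rewrite eq_sym.
by rewrite distrC -natrB ?(ltnW lt) // normr_nat ler1n subn_gt0.
Qed.

(** A quantitative linear independence of the projections of the columns on the span of the [u j]:
    [w] reads off the coefficient of column [t]. *)
Definition columns_separated (f : F) : Prop := forall t, exists w : 'cV[R]_n,
  [/\ exists om : 'I_b' -> R, w = \sum_j om j *: u j, dot w w = 1,
      forall s, s != t -> dot w (g f s) = 0 & (2 * n%:R)^-1 <= `|dot w (g f t)|].

Lemma card_not_separated : (0 < n)%N -> (b' <= n)%N -> exists bad : {set F},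
  (20 * #|bad| <= #|F|)%N /\ forall f, f \notin bad -> columns_separated f.
Proof.
move=> n0 bn; exists (\bigcup_t bad_set t); split; last first.
  move=> f /bigcupP hf t; exists (normal_dir f t).
  have [h1 [h2 h3]] := normal_dirP f t; split=> //.
  by rewrite leNgt; apply/negP => h; apply: hf; exists t => //; rewrite inE.
have h1 : (#|\bigcup_t bad_set t| <= \sum_t #|bad_set t|)%N.
  by apply: (big_ind2 (fun (A : {set F}) k => (#|A| <= k)%N)) => [|A k B l Ak Bl|//];
    rewrite ?cards0 // (leq_trans (leq_card_setU _ _)) // leq_add.
have h2 : ((\sum_t #|bad_set t|) * m <= n * #|F|)%N.
  rewrite big_distrl /=; apply: (@leq_trans (\sum_(t < b') #|F|)%N).
    by apply: leq_sum => t _; exact: card_bad_set n0.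
  by rewrite sum_nat_const card_ord leq_mul2r bn orbT.
have h3 : (#|\bigcup_t bad_set t| * m <= n * #|F|)%N.
  by apply: leq_trans h2; rewrite leq_mul2r h1 orbT.
move: h3; set B := #|_|; set C := #|F|; clearbody B C => h3.
by rewrite -(leq_pmul2l n0) mulnCA [(n * B)%N]mulnC -mulnCA.
Qed.

End Separation.

(** * Accuracy of the block Krylov space *)

Definition first_cols (R : realType) (n b b' : nat) (bb : (b' <= b)%N)
    (G : 'M[R]_(n, b)) : 'M[R]_(n, b') := colsub (widen_ord bb) G.

Definition well_conditioned (R : realType) (n b : nat) (T2 : R) (G : 'M[R]_(n, b))
    (u : 'I_b -> 'cV[R]_n) : Prop :=
  (forall c, dot (G *m c) (G *m c) <= T2 * \sum_j dot (u j) (G *m c) ^+ 2) /\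
  (forall c, (forall j, dot (u j) (G *m c) = 0) -> c = 0).

Lemma mul_mx_sum_col (R : realType) n b (G : 'M[R]_(n, b)) c :
  G *m c = \sum_j c j 0 *: col j G.
Proof.
apply/colP => i; rewrite mxE summxE; apply: eq_bigr => j _.
by rewrite !mxE mulrC.
Qed.

(** Separation bounds each [c t ^ 2] by [4 * n ^ 2] times the energy along the [u j], hence [|c|^2]
    by [4 * n ^ 3] times it. The entries of [G] are below [20 * n], so its squared Frobenius norm is
    at most [400 * n ^ 4]. *)
Lemma separated_well_conditioned (R : realType) n b b' (bb : (b' <= b)%N)
    (u : 'I_b' -> 'cV[R]_n) f : (0 < n)%N -> (b' <= n)%N ->
  (forall i j, dot (u i) (u j) = (i == j)%:R) -> columns_separated bb u f ->
  well_conditioned (1600 * n%:R ^+ 7) (first_cols bb (grid_mx R f)) u.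
Proof.
move=> n0 b'n uo sep; set G := first_cols _ _.
have n0' : 0 < n%:R :> R by rewrite ltr0n.
have colG j : col j G = col (widen_ord bb j) (grid_mx R f).
  by apply/colP => i; rewrite !mxE.
pose E c := \sum_j dot (u j) (G *m c) ^+ 2.
have cE (c : 'cV[R]_b') (t : 'I_b') : c t 0 ^+ 2 <= 4 * n%:R ^+ 2 * E c.
  have [w [[om wE] w1 worth wt]] := sep t.
  have wG : dot w (G *m c) = c t 0 * dot w (col t G).
    rewrite mul_mx_sum_col dot_sumr (bigD1 t) //= big1 ?addr0 ?dotZr // => s st.
    by rewrite dotZr colG worth ?mulr0.
  have omE : \sum_j om j ^+ 2 = 1.
    rewrite -w1 {1}wE dot_suml; apply: eq_bigr => j _; rewrite dotZl wE dot_sumr.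
    rewrite (bigD1 j) //= big1 ?addr0 => [|l lj]; first by rewrite dotZr uo eqxx mulr1 expr2.
    by rewrite dotZr uo eq_sym (negPf lj) mulr0.
  have wE2 : dot w (G *m c) ^+ 2 <= E c.
    have -> : dot w (G *m c) = dot (\col_j om j) (\col_j dot (u j) (G *m c)).
      by rewrite {1}wE dot_suml; apply: eq_bigr => j _; rewrite dotZl !mxE.
    apply: le_trans (cauchy_schwarz _ _) _.
    have -> : dot (\col_j om j) (\col_j om j) = 1.
      by rewrite -omE; apply: eq_bigr => j _; rewrite !mxE expr2.
    rewrite mul1r le_eqVlt; apply/orP; left; apply/eqP.
    by apply: eq_bigr => j _; rewrite !mxE expr2.
  rewrite wG exprMn in wE2.
  have D2 : ((2 * n%:R)^-1) ^+ 2 <= dot w (col t G) ^+ 2.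
    rewrite -(real_normK (num_real (dot w _))) colG; apply: lerXn2r; rewrite ?nnegrE //.
  have := ler_wpM2l (sqr_ge0 (c t 0)) D2 => /le_trans /(_ wE2).
  rewrite exprVn ler_pdivrMr ?exprn_gt0 ?mulr_gt0 //.
  by rewrite exprMn mulrC (_ : 2 ^+ 2 = 4) // expr2; ring.
have E0 c : 0 <= E c by apply: sumr_ge0 => j _; exact: sqr_ge0.
have cc c : dot c c <= n%:R * (4 * n%:R ^+ 2 * E c).
  apply: (@le_trans _ _ (\sum_(t < b') (4 * n%:R ^+ 2 * E c))).
    by apply: ler_sum => t _; rewrite -expr2.
  rewrite sumr_const card_ord -[_ *+ b']mulr_natl ler_wpM2r ?ler_nat //.
  by rewrite !mulr_ge0 // ltW.
split=> [c|c h].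
  apply: (@le_trans _ _ (\sum_(i < n) (n%:R * (20 * n%:R) ^+ 2) * dot c c)); last first.
    rewrite sumr_const card_ord -[_ *+ n]mulr_natl.
    apply: (@le_trans _ _ (n%:R * (n%:R * (20 * n%:R) ^+ 2 * (n%:R * (4 * n%:R ^+ 2 * E c))))).
      by rewrite ler_wpM2l // ler_wpM2l // mulr_ge0 ?sqr_ge0.
    by rewrite -/(E c) le_eqVlt; apply/orP; left; apply/eqP; ring.
  apply: ler_sum => i _; rewrite -expr2.
  have -> : (G *m c) i 0 = dot (\col_j G i j) c.
    by rewrite mxE; apply: eq_bigr => j _; rewrite !mxE.
  apply: le_trans (cauchy_schwarz _ _) _; rewrite ler_wpM2r ?dot_ge0 //.
  apply: (@le_trans _ _ (\sum_(t < b') (20 * n%:R) ^+ 2)).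
    apply: ler_sum => t _; rewrite -expr2 !mxE; apply: lerXn2r; rewrite ?nnegrE ?mulr_ge0 ?ler0n //.
    by rewrite -natrM ler_nat ltnW.
  by rewrite sumr_const card_ord -[_ *+ b']mulr_natl ler_wpM2r ?sqr_ge0 // ler_nat.
apply/eqP; rewrite -dot_eq0 eq_le dot_ge0 andbT (le_trans (cc c)) //.
by rewrite /E big1 ?mulr0 // => j _; rewrite h expr0n.
Qed.

(** * Error bounds for a well-conditioned start block *)

Section Deterministic.
Variables (R : realType) (n d k b N : nat).
Variables (A : 'M[R]_(n, d)) (V P : 'M[R]_d) (a : nat -> R).
Hypothesis AV : sorted_eigenbasis (A^T *m A) V a.
Hypothesis N0 : (0 < N)%N.
Let s i := a i ^+ N.
Let S := (A^T *m A) ^+ N.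
Let B := spectral_fun V s.
Hypotheses (Ps : P^T = P) (PP : P *m P = P).
Variables (Z : 'M[R]_(d, k)) (rho : nat -> R).
Hypothesis rho0 : forall i, 0 <= rho i.
Hypothesis Zmax : forall (i : 'I_k) x,
  (forall j : 'I_k, (j < i)%N -> dot (col j Z) x = 0) ->
  dot x (B *m P *m B *m x) <= rho i ^+ 2 * dot x x.
Variable G : 'M[R]_(n, b).
Hypothesis kb : (k <= b)%N.

Lemma gram_exp_basis : sorted_eigenbasis S V s.
Proof.
have [VV VV' _ [a0 az] ad] := AV; split=> //.
- exact: (gram_exp_spectral N AV).
- split=> i; first exact: exprn_ge0.
  by move=> di; rewrite /s az // expr0n eqn0Ngt N0.
- by move=> i j ij; apply: lerXn2r; rewrite ?nnegrE // ad.
Qed.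

Let s0 i : 0 <= s i. Proof. by case: gram_exp_basis => _ _ _ []. Qed.
Let sdec i j : (i <= j)%N -> s j <= s i. Proof. by case: gram_exp_basis => _ _ _ _; exact. Qed.
Let a0 i : 0 <= a i. Proof. by case: AV => _ _ _ []. Qed.

Definition lsing b' (bd : (b' <= d)%N) (j : 'I_b') := left_singular A V a (widen_ord bd j).

Lemma lsing_orthonormal b' (bd : (b' <= d)%N) : (forall i, (i < b')%N -> 0 < a i) ->
  forall i j, dot (lsing bd i) (lsing bd j) = (i == j)%:R.
Proof.
move=> apos i j; have [VV VV' _ _ _] := AV.
rewrite /lsing /left_singular dotZl dotZr dot_mulmxl mulmxA (gram_spectral AV).
rewrite spectral_fun_col // dotZr coord_col //.
have aj := apos j (ltn_ord j); have [->|ij] := eqVneq i j.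
  by rewrite !eqxx mulr1 expr2 mulKf ?gt_eqF // mulVf ?gt_eqF.
rewrite (_ : (widen_ord bd i == widen_ord bd j) = false) ?mulr0 //.
by apply: contraNF ij => /eqP /(congr1 val) /= /val_inj ->.
Qed.

Lemma exists_rank : exists r, [/\ (r <= d)%N, (r <= n)%N,
  forall i, (i < r)%N -> 0 < a i & forall i, (r <= i)%N -> a i = 0].
Proof.
have [VV VV' AE [_ az] adec] := AV.
have ex : exists i, a i == 0 by exists d; rewrite az.
case: (ex_minnP ex) => r /eqP ar rmin.
have rd : (r <= d)%N by apply: rmin; rewrite az.
have apos i : (i < r)%N -> 0 < a i.
  by move=> ir; rewrite lt_def a0 andbT; apply: contraTneq ir => /eqP /rmin; rewrite leqNgt.
exists r; split=> //; last first.
  by move=> i ri; apply/eqP; rewrite eq_le a0 andbT -ar adec.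
pose U : 'M[R]_(n, r) := \matrix_(i, j) lsing rd j i 0.
have UU : U^T *m U = 1%:M.
  apply/matrixP => i j; rewrite trmx_mul_dot mxE.
  have cU t : col t U = lsing rd t by apply/colP => e; rewrite !mxE.
  by rewrite !cU lsing_orthonormal.
have : \rank (1%:M : 'M[R]_r) = r by rewrite mxrank1.
by rewrite -UU => <-; apply: leq_trans (mxrankM_maxr _ _) (rank_leq_row _).
Qed.

Variable r : nat.
Hypotheses (rd : (r <= d)%N) (rpos : forall i, (i < r)%N -> 0 < a i).
Hypothesis rzero : forall i, (r <= i)%N -> a i = 0.
Variable T2 : R.
Hypothesis T20 : 0 <= T2.

Let sr i : (r <= i)%N -> s i = 0.
Proof. by move=> ri; rewrite /s rzero // expr0n eqn0Ngt N0. Qed.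

Section Block.
Variables (b0 q : nat).
(** Past the rank there are no left singular vectors to condition against and the singular values
    vanish, so the remaining start vectors are ignored. *)
Let b' := minn b0 r.
Hypotheses (b'b : (b' <= b)%N) (b'd : (b' <= d)%N).
Hypothesis cond : well_conditioned T2 (first_cols b'b G) (lsing b'd).
Hypothesis krylov : forall j (c : 'I_b), (j <= q)%N -> (c < b0)%N ->
  P *m (B *m (S ^+ j *m (A^T *m col c G))) = B *m (S ^+ j *m (A^T *m col c G)).

Let krylov' j : (j <= q)%N ->
  P *m (B *m S ^+ j *m A^T *m first_cols b'b G) = B *m S ^+ j *m A^T *m first_cols b'b G.
Proof.
move=> jq; apply/matrixP => x y; set K := _ *m first_cols _ _.
have cE (M : 'M[R]_(d, b')) : M x y = (M *m delta_mx y (0 : 'I_1)) x 0.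
  by rewrite -colE mxE.
have GE : first_cols b'b G *m delta_mx y (0 : 'I_1) = col (widen_ord b'b y) G.
  by rewrite -colE; apply/colP => i; rewrite !mxE.
have KE : K *m delta_mx y (0 : 'I_1) =
    B *m (S ^+ j *m (A^T *m col (widen_ord b'b y) G)).
  by rewrite /K -!mulmxA GE.
rewrite !cE -mulmxA KE krylov //=.
by have := ltn_ord y; rewrite /b' leq_min => /andP[].
Qed.

Let ritz (i : 'I_k) (f : {poly R}) (th th2 Psi : R) : (i < b')%N ->
  (size f <= q.+1)%N ->
  0 <= th2 -> (forall t, 0 <= t <= th2 -> t * f.[t] ^+ 2 <= th2) ->
  0 < Psi -> (forall t, s i ^+ 2 <= t -> Psi <= f.[t]) ->
  0 <= th <= s i -> (forall j, (b' <= j)%N -> s j ^+ 2 <= th2 \/ th <= s j) ->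
  th ^+ 2 * th2 * T2 <= (s i ^+ 2 - th ^+ 2) * s i ^+ 2 * Psi ^+ 2 ->
  th <= rho i.
Proof.
move=> ib sf h1 h2 h3 h4 h5 h6 h7.
have ir : (i < r)%N by move: ib; rewrite /b' leq_min => /andP[].
exact: (@ritz_lower R n d k b' N q A V P a AV Ps PP Z rho rho0 Zmax
  (first_cols b'b G) b'd krylov' i f th th2 T2 Psi ib (rpos ir) sf cond.1 cond.2).
Qed.

(** The filter is cut at [s e ^ 2] and the target is [th = s i - tau * s k]. Then [s i ^ 2 - th ^ 2]
    is at least [tau * s k ^ 2], and [tau * Psi ^ 2] outweighs the conditioning [T2]. *)
Lemma ritz_far (i : 'I_k) (g tau : R) (e : nat) :
  0 <= g -> 0 <= tau -> (b0 <= e)%N -> (k <= e)%N -> (i < b0)%N ->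
  (forall j, (b' <= j)%N -> s j <= s e) ->
  (1 + g) * s e ^+ 2 <= s i ^+ 2 ->
  s e = 0 \/ T2 <= tau * ((1 + Num.sqrt g) ^+ q / 2) ^+ 2 ->
  s i - rho i <= tau * s k.
Proof.
move=> g0 tau0 be ke ib low gap cT.
have sk0 : 0 <= tau * s k by rewrite mulr_ge0.
case: (lerP (s i - tau * s k) 0) => th0.
  by have := rho0 i; move: th0; lra.
have si : 0 < s i by move: th0 sk0; lra.
have ir : (i < r)%N by rewrite ltnNge; apply: contraTN si => /sr ->; rewrite ltxx.
have [f [sf f1 f2]] := chebyshev_filter q (sqr_ge0 (s e)) g0.
set Psi := _ / 2 in f2 cT.
have Psi0 : 0 < Psi.
  by rewrite divr_gt0 // exprn_gt0 // ltr_wpDr ?sqrtr_ge0.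
suff : s i - tau * s k <= rho i by lra.
apply: (ritz (f := f) (th2 := s e ^+ 2) (Psi := Psi)) => //.
- by rewrite /b' leq_min ib.
- exact: sqr_ge0.
- by move=> t ht; apply: f2; exact: le_trans ht.
- by rewrite (ltW th0) lerBlDr lerDl.
- by move=> j bj; left; apply: lerXn2r; rewrite ?nnegrE // low.
case: cT => [->|cT].
  rewrite expr0n mulr0 mul0r; apply: mulr_ge0; last exact: sqr_ge0.
  apply: mulr_ge0; last exact: sqr_ge0.
  rewrite subr_ge0; apply: lerXn2r; rewrite ?nnegrE ?(ltW th0) //.
  by rewrite lerBlDr lerDl.
have sek : s e <= s k by exact: sdec.
have ski : s k <= s i by apply: sdec; exact: ltnW.
set th := s i - tau * s k in th0 *.
apply: (@le_trans _ _ (s i ^+ 2 * s k ^+ 2 * (tau * Psi ^+ 2))).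
  apply: ler_pM => //.
    by apply: mulr_ge0; exact: sqr_ge0.
  apply: ler_pM; rewrite ?sqr_ge0 //; apply: lerXn2r; rewrite ?nnegrE ?(ltW th0) //.
  by rewrite /th lerBlDr lerDl.
rewrite [leLHS](_ : _ = (tau * s k * s k) * s i ^+ 2 * Psi ^+ 2); last by ring.
rewrite ler_wpM2r ?sqr_ge0 // ler_wpM2r ?sqr_ge0 //.
have -> : s i ^+ 2 - th ^+ 2 = tau * s k * (s i + th) by rewrite /th; ring.
by rewrite ler_wpM2l //; move: ski th0; lra.
Qed.

(** Without a gap below [s i], target and cutoff are both set at [th = s k / sqrt (1 + g)]: every
    index is then below the cutoff or harmless. The loss is at most [(w - 1 / w) * s k], and
    [w - 1 / w = g / w]. *)
Lemma ritz_near (i : 'I_k) (g : R) :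
  0 <= g -> b0 = k -> s i ^+ 2 <= (1 + g) * s k ^+ 2 -> 0 < s k ->
  T2 <= g * ((1 + Num.sqrt g) ^+ q / 2) ^+ 2 ->
  s i - rho i <= g * s k.
Proof.
move=> g0 b0k near sk cT.
have g1 : 0 < 1 + g by rewrite ltr_wpDr.
pose w := Num.sqrt (1 + g).
have w2 : w ^+ 2 = 1 + g by rewrite sqr_sqrtr // ltW.
have w1 : 1 <= w.
  rewrite -(ler_pXn2r (n := 2)) ?nnegrE ?sqrtr_ge0 // w2 expr1n; lra.
have w0 : 0 < w by exact: lt_le_trans w1.
have kr : (k < r)%N by rewrite ltnNge; apply: contraTN sk => /sr ->; rewrite ltxx.
pose th := s k / w.
have th0 : 0 <= th by rewrite divr_ge0 // ltW.
have th2E : (1 + g) * th ^+ 2 = s k ^+ 2.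
  by rewrite /th exprMn exprVn w2 mulrCA mulfV ?mulr1 ?gt_eqF.
have thk : th <= s k by rewrite ler_pdivrMr // ler_peMr.
have ski : s k <= s i by apply: sdec; exact: ltnW.
have siw : s i <= w * s k.
  rewrite -(ler_pXn2r (n := 2)) ?nnegrE ?mulr_ge0 ?(ltW w0) //.
  by rewrite exprMn w2.
have [f [sf f1 f2]] := chebyshev_filter q (sqr_ge0 th) g0.
set Psi := _ / 2 in f2 cT.
have Psi0 : 0 < Psi.
  by rewrite divr_gt0 // exprn_gt0 // ltr_wpDr ?sqrtr_ge0.
have : th <= rho i.
  apply: (ritz (f := f) (th2 := th ^+ 2) (Psi := Psi)) => //.
  - by rewrite /b' leq_min b0k ltn_ord (ltn_trans _ kr).
  - exact: sqr_ge0.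
  - move=> t ht; apply: f2; rewrite th2E; apply: le_trans ht.
    by apply: lerXn2r; rewrite ?nnegrE.
  - by rewrite th0 (le_trans thk).
  - move=> j _; case: (lerP (s j) th) => h; last by right; exact: ltW.
    by left; apply: lerXn2r; rewrite ?nnegrE.
  have ss : s k ^+ 2 <= s i ^+ 2 by apply: lerXn2r; rewrite ?nnegrE.
  have tt : th ^+ 2 <= s k ^+ 2 by apply: lerXn2r; rewrite ?nnegrE.
  apply: (@le_trans _ _ (th ^+ 2 * th ^+ 2 * (g * Psi ^+ 2))).
    by apply: ler_wpM2l => //; apply: mulr_ge0; exact: sqr_ge0.
  rewrite [leLHS](_ : _ = (g * th ^+ 2) * th ^+ 2 * Psi ^+ 2); last by ring.
  rewrite ler_wpM2r ?sqr_ge0 //; apply: ler_pM; rewrite ?sqr_ge0 //.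
  - by rewrite mulr_ge0 ?sqr_ge0.
  - by move: th2E ss; lra.
  - exact: le_trans ss.
have : w * s k - s k / w <= g * s k.
  have -> : w * s k - s k / w = g * s k / w.
    have -> : g = w ^+ 2 - 1 by rewrite w2 addrAC subrr add0r.
    by field; rewrite gt_eqF.
  by rewrite ler_pdivrMr // ler_peMr // mulr_ge0.
rewrite -/th; move: siw; lra.
Qed.

Variables (m : nat) (M : 'M[R]_(m, d)).
Hypothesis MS : M^T *m M = S.
Hypothesis Zo : orthonormal_columns Z.
Hypothesis TZ : forall i : 'I_k,
  B *m P *m B *m col i Z = rho i ^+ 2 *: col i Z.
Hypotheses (k0 : (0 < k)%N) (kd : (k <= d)%N).

Let d0 : (0 < d)%N. Proof. exact: leq_trans kd. Qed.

Let MV : sorted_eigenbasis (M^T *m M) V s.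
Proof. by rewrite MS; exact: gram_exp_basis. Qed.

Let tail p := \sum_(j < d) s (k + j)%N `^ p.

Let low j : (b' <= j)%N -> s j <= s b0.
Proof. by rewrite /b' geq_min => /orP[/sdec//|/sr ->]. Qed.

(** All [k] Ritz values converge, with total loss [x * s k] for [x = k * tau <= eps / 2]. The first
    term of the tail alone pays for it, since [x <= eps - x] in [powR_bernoulli]. *)
Lemma near_optimal_gap (p eps g tau : R) : 1 <= p -> 0 < eps -> 0 <= g -> 0 <= tau ->
  (k <= b0)%N -> (1 + g) * s b0 ^+ 2 <= s k ^+ 2 ->
  s b0 = 0 \/ T2 <= tau * ((1 + Num.sqrt g) ^+ q / 2) ^+ 2 ->
  k%:R * tau <= eps / 2 -> near_optimal p eps M Z.
Proof.
move=> p1 eps0 g0 tau0 kb0 gap cT kt.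
have loss (i : 'I_k) : s i - rho i <= tau * s k.
  apply: (@ritz_far i g tau b0) => //.
    exact: leq_trans (ltn_ord i) kb0.
  apply: le_trans gap _; apply: lerXn2r; rewrite ?nnegrE //.
  exact: sdec (ltnW (ltn_ord i)).
have sum : \sum_(i < k) (s i - rho i) <= k%:R * tau * s k.
  apply: le_trans (ler_sum _ (fun i _ => loss i)) _.
  by rewrite sumr_const card_ord -[_ *+ k]mulr_natl mulrA.
set x := k%:R * tau in kt sum.
have x0 : 0 <= x by rewrite mulr_ge0.
apply: (ritz_near_optimal MV Ps PP Zo TZ (x := x) (y := x) (w := k)) => //.
  by rewrite mulrDl mul1r lerD2l.
apply: (@le_trans _ _ (((1 + eps) `^ p - 1) * s k `^ p)); last first.
  rewrite ler_wpM2l //.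
    rewrite subr_ge0 -[leLHS](powRr0 (1 + eps)).
    by apply: ler_powR; lra.
  rewrite (bigD1 (Ordinal d0)) //= addn0 lerDl.
  by apply: sumr_ge0 => j _; exact: powR_ge0.
rewrite ler_wpM2r ?powR_ge0 //.
apply: le_trans (powR_bernoulli p1 x0 (ltW eps0)).
by rewrite ler_wpM2l ?mulr_ge0 ?powR_ge0 //; lra.
Qed.

(* The spectrum is flat between [k] and [k + b1]: the tail is at least of order
   [b1 * s k `^ p], so a loss of [g * s k] per Ritz value is affordable. The Ritz values
   well above [s k], those of index below [w], converge, which controls the largest
   singular value of the residual. *)
Lemma near_optimal_flat (p eps g gb tau : R) (b1 : nat) : 1 <= p -> 0 < eps ->
  0 < g <= 1 -> 0 <= gb -> 0 <= tau ->
  b0 = k -> s k ^+ 2 <= (1 + gb) * s (k + b1)%N ^+ 2 ->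
  T2 <= tau * ((1 + Num.sqrt g) ^+ q / 2) ^+ 2 ->
  k%:R * tau <= g / 2 ->
  p * (1 + g) `^ (p - 1) * (k%:R * g) * (Num.sqrt (1 + gb)) `^ p <=
    b1%:R * ((1 + eps) `^ p - 1) ->
  near_optimal p eps M Z.
Proof.
move=> p1 eps0 /andP[g0 g1] gb0 tau0 b0k flat cT kt scal.
have p0 : 0 <= p by lra.
have taug : tau <= g.
  have : tau <= k%:R * tau by rewrite ler_peMl // ler1n.
  by lra.
pose far i := (1 + g) * s k ^+ 2 <= s i ^+ 2.
have lossf (i : 'I_k) : far i -> s i - rho i <= tau * s k.
  move=> fi; apply: (@ritz_far i g tau k) => //; rewrite ?b0k ?leqnn //.
  - exact: ltW.
  - by move=> j; rewrite -b0k; exact: low.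
  - by right.
have loss (i : 'I_k) : s i - rho i <= g * s k.
  have [fi|nfi] := boolP (far i).
    by apply: le_trans (lossf i fi) _; rewrite ler_wpM2r.
  have sk : 0 < s k.
    rewrite lt_def s0 andbT; apply: contra nfi => /eqP skz.
    by rewrite /far skz expr0n mulr0 sqr_ge0.
  apply: ritz_near => //; first exact: ltW.
    by move: nfi; rewrite /far -ltNge => /ltW.
  by apply: le_trans cT _; rewrite ler_wpM2r ?sqr_ge0.
have sum : \sum_(i < k) (s i - rho i) <= k%:R * g * s k.
  apply: le_trans (ler_sum _ (fun i _ => loss i)) _.
  by rewrite sumr_const card_ord -[_ *+ k]mulr_natl mulrA.
(* Below the first index that is not far the total loss is at most [g / 2 * s k], and at that index
   [s w <= (1 + g / 2) * s k]; together they bound the residual by [(1 + g) * s k]. *)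
have [w [wk wf wn]] : exists w, [/\ (w <= k)%N, forall i, (i < w)%N -> far i &
    w = k \/ ~~ far w].
  have ex : exists w, (w == k) || ~~ far w by exists k; rewrite eqxx.
  case: (ex_minnP ex) => w hw wmin; exists w; split.
  - by apply: wmin; rewrite eqxx.
  - by move=> i iw; apply: contraTT iw => nf; rewrite -leqNgt wmin // nf orbT.
  - by case/orP: hw => [/eqP ->|]; [left|right].
have sumw : \sum_(i < w) (s i - rho i) <= k%:R * tau * s k.
  apply: (@le_trans _ _ (\sum_(i < w) tau * s k)).
    apply: ler_sum => i _.
    exact: (lossf (widen_ord wk i) (wf i (ltn_ord i))).
  rewrite sumr_const card_ord -[_ *+ w]mulr_natl -mulrA ler_wpM2r ?mulr_ge0 //.
  by rewrite ler_nat.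
have sw : s w <= (1 + g / 2) * s k.
  case: wn => [->|nf]; first by rewrite ler_peMl // lerDl; lra.
  rewrite -(ler_pXn2r (n := 2)) ?nnegrE ?mulr_ge0 ?exprMn //; last lra.
  move: nf; rewrite /far -ltNge => /ltW /le_trans; apply.
  by rewrite ler_wpM2r ?sqr_ge0 //; nra.
have kg0 : 0 <= k%:R * g by rewrite mulr_ge0 // ltW.
apply: (ritz_near_optimal MV Ps PP Zo TZ (x := g) (y := k%:R * g) (w := w)) => //.
- exact: ltW.
- apply: le_trans (lerD sw sumw) _; rewrite -mulrDl ler_wpM2r //; lra.
have tail0 : 0 <= tail p by apply: sumr_ge0 => j _; exact: powR_ge0.
have e0 : 0 <= (1 + eps) `^ p - 1.
  rewrite subr_ge0 -[leLHS](powRr0 (1 + eps)); apply: ler_powR; lra.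
set c := Num.sqrt (1 + gb) `^ p in scal.
have c0 : 0 < c by rewrite powR_gt0 // sqrtr_gt0; lra.
have tb : b1%:R * s k `^ p <= tail p * c.
  have [sb|sb] := eqVneq (s (k + b1)%N) 0.
    have -> : s k = 0.
      have : s k ^+ 2 == 0 by rewrite eq_le sqr_ge0 andbT; move: flat; rewrite sb expr0n mulr0.
      by rewrite expf_eq0 /= => /eqP.
    have pn0 : p != 0 by rewrite gt_eqF //; lra.
    by rewrite powR0 // mulr0; apply: mulr_ge0 => //; exact: ltW.
  have kbr : (k + b1 < r)%N.
    by rewrite ltnNge; apply: contra_neqN sb => /sr.
  have b1d := leq_trans (leq_addl k b1) (leq_trans (ltnW kbr) rd).
  have skb : s k <= Num.sqrt (1 + gb) * s (k + b1)%N.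
    rewrite -(ler_pXn2r (n := 2)) ?nnegrE ?mulr_ge0 ?sqrtr_ge0 //.
    by rewrite exprMn sqr_sqrtr //; lra.
  apply: (@le_trans _ _ (b1%:R * (s (k + b1)%N `^ p * c))).
    rewrite ler_wpM2l // mulrC -powRM ?sqrtr_ge0 //.
    by apply: ge0_ler_powR; rewrite ?nnegrE ?mulr_ge0 ?sqrtr_ge0.
  rewrite mulrA ler_wpM2r ?(ltW c0) //.
  apply: (@le_trans _ _ (\sum_(j < b1) s (k + j)%N `^ p)).
    have -> : b1%:R * s (k + b1)%N `^ p = \sum_(j < b1) s (k + b1)%N `^ p.
      by rewrite sumr_const card_ord mulr_natl.
    apply: ler_sum => j _.
    apply: ge0_ler_powR; rewrite ?nnegrE //; apply: sdec.
    by rewrite leq_add2l ltnW.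
  rewrite /tail (big_ord_widen d (fun j => s (k + j)%N `^ p) b1d) big_mkcond.
  by apply: ler_sum => j _; case: ifP => // _; exact: powR_ge0.
rewrite -(ler_pM2r c0) mulrAC.
apply: le_trans (ler_wpM2r (powR_ge0 _ _) scal) _.
by rewrite [b1%:R * _]mulrC -!mulrA ler_wpM2l.
Qed.

End Block.
End Deterministic.

(** * The Krylov algorithm *)

Lemma measurable_fun_nat_prod d1 d2 (T : measurableType d1) (U : measurableType d2)
    (f : nat * T -> U) :
  (forall w, measurable_fun setT (fun x => f (w, x))) -> measurable_fun setT f.
Proof.
move=> mf _ Y mY; rewrite setTI.
have -> : (f @^-1` Y = \bigcup_w ([set w] `*` ((fun x => f (w, x)) @^-1` Y)))%classic.
  apply/seteqP; split=> [[w x] /= fY|[w x] [v _ [/= -> //]]].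
  by exists w => //; split.
apply: bigcup_measurable => w _; apply: measurableX => //.
by rewrite -[X in measurable X]setTI; exact: mf.
Qed.

(* The queries form chains that start with [A^T] and alternate [A^T] and [A]; query [t]
   is number [pos t] of its chain, whose start vector [g w (t - pos t)] is drawn from
   the seed [w]. The answer [N.*2] steps later in a chain is obtained by applying
   [(A^T *m A) ^+ N], which is why [shiftable] answers can be used by [compress]. *)
Section Algorithm.
Variables (R : realType) (n d k Q N : nat).
Variables (pos : nat -> nat) (g : nat -> nat -> 'cV[R]_n).

Definition default_answer : mv_answer R n d := ([tuple 0 | _ < n], [tuple 0 | _ < d]).

Definition answer_n (h : seq (mv_answer R n d)) (t : nat) : 'cV[R]_n :=
  \col_i tnth (nth default_answer h t).1 i.

Definition answer_d (h : seq (mv_answer R n d)) (t : nat) : 'cV[R]_d :=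
  \col_i tnth (nth default_answer h t).2 i.

(** Even positions hold the answers in dimension [d]; the equality of positions excludes a restart
    of the chain during the next [N.*2] queries. *)
Definition shiftable (t : nat) : bool :=
  [&& ~~ odd (pos t), pos (t + N.*2)%N == (pos t + N.*2)%N & (t + N.*2 < Q)%N].

(** A zero pair leaves [compress] unchanged, so the list can run over all queries. *)
Definition krylov_col (h : seq (mv_answer R n d)) (t : nat) : 'cV[R]_d :=
  if shiftable t then answer_d h t else 0.

Definition gram_krylov_col (h : seq (mv_answer R n d)) (t : nat) : 'cV[R]_d :=
  if shiftable t then answer_d h (t + N.*2)%N else 0.

Lemma measurable_nth_answer t i :
  measurable_fun setT (fun h : t.-tuple (mv_answer R n d) => nth default_answer h i).
Proof.
case: (ltnP i t) => it; last first.
  have -> : (fun h : t.-tuple (mv_answer R n d) => nth default_answer h i) =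
      (fun=> default_answer).
    by apply/funext => h; rewrite nth_default // size_tuple.
  exact: measurable_cst.
have -> : (fun h : t.-tuple (mv_answer R n d) => nth default_answer h i) =
    (fun h => tnth h (Ordinal it)).
  by apply/funext => h; rewrite (tnth_nth default_answer).
exact: measurable_tnth.
Qed.

Lemma measurable_answer_n t i :
  mx_measurable (fun h : t.-tuple (mv_answer R n d) => answer_n h i).
Proof.
move=> j l; under eq_fun do rewrite mxE.
apply: (measurableT_comp (measurable_tnth j)).
exact: (measurableT_comp measurable_fst (measurable_nth_answer i)).
Qed.

Lemma measurable_answer_d t i :
  mx_measurable (fun h : t.-tuple (mv_answer R n d) => answer_d h i).
Proof.
move=> j l; under eq_fun do rewrite mxE.
apply: (measurableT_comp (measurable_tnth j)).
exact: (measurableT_comp measurable_snd (measurable_nth_answer i)).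
Qed.

Definition krylov_right (t : nat) (x : nat * t.-tuple (mv_answer R n d)) : bool :=
  odd (pos t).

Definition krylov_vec (t : nat) (x : nat * t.-tuple (mv_answer R n d)) : 'cV[R]_d :=
  answer_d x.2 t.-1.

Definition krylov_covec (t : nat) (x : nat * t.-tuple (mv_answer R n d)) : 'cV[R]_n :=
  if pos t == 0%N then g x.1 t else answer_n x.2 t.-1.

Definition krylov_output (x : nat * Q.-tuple (mv_answer R n d)) : 'M[R]_(d, k) :=
  top_eigenvectors k
    (compress [seq (krylov_col x.2 t, gram_krylov_col x.2 t) | t <- iota 0 Q]).

Lemma measurable_krylov_right t : measurable_fun setT (@krylov_right t).
Proof. exact: measurable_cst. Qed.

Lemma measurable_krylov_vec t i j :
  measurable_fun setT (fun x => @krylov_vec t x i j).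
Proof.
by apply: measurable_fun_nat_prod => w; exact: measurable_answer_d.
Qed.

Lemma measurable_krylov_covec t i j :
  measurable_fun setT (fun x => @krylov_covec t x i j).
Proof.
apply: measurable_fun_nat_prod => w; rewrite /krylov_covec.
by case: (pos t == 0%N) => /=; [exact: measurable_cst|exact: measurable_answer_n].
Qed.

Lemma measurable_krylov_output i j :
  measurable_fun setT (fun x => krylov_output x i j).
Proof.
apply: measurable_fun_nat_prod => w.
apply: mx_measurable_top_eigenvectors.
apply: (@mx_measurable_compress _ _ _ _ _ (iota 0 Q)
  (fun t (h : Q.-tuple (mv_answer R n d)) => krylov_col h t)
  (fun t (h : Q.-tuple (mv_answer R n d)) => gram_krylov_col h t)) => t.
  rewrite /krylov_col; case: shiftable; last exact: mx_measurable_cst.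
  exact: measurable_answer_d.
rewrite /gram_krylov_col; case: shiftable; last exact: mx_measurable_cst.
exact: measurable_answer_d.
Qed.

Definition krylov_algorithm : mv_algorithm R n d k Q nat :=
  MVAlgorithm measurable_krylov_right measurable_krylov_vec
    measurable_krylov_covec measurable_krylov_output.

Hypothesis pos0 : pos 0 = 0%N.
Hypothesis posS : forall t, pos t.+1 = 0%N \/ pos t.+1 = (pos t).+1.

Section Run.
Variables (A : 'M[R]_(n, d)) (w : nat).
Let ans := mv_answers krylov_algorithm A w.

Lemma nth_answers t t' : (t < t')%N ->
  nth default_answer (ans t') t =
  mv_oracle A (odd (pos t)) (krylov_vec (w, ans t)) (krylov_covec (w, ans t)).
Proof.
elim: t' => // t' IH; rewrite ltnS leq_eqVlt => /orP[/eqP ->|tt'].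
  by rewrite /ans /= nth_rcons size_tuple ltnn eqxx.
by rewrite /ans /= nth_rcons size_tuple tt' -/(ans t') IH.
Qed.

Lemma answersP t t' : (t < t')%N ->
  let x := A^T *m g w (t - pos t)%N in
  if odd (pos t) then answer_n (ans t') t = A *m ((A^T *m A) ^+ (pos t)./2 *m x)
  else answer_d (ans t') t = (A^T *m A) ^+ (pos t)./2 *m x.
Proof.
elim: t t' => [|t IH] t' tt' /=.
  rewrite pos0 /= expr0 mul1mx; apply/colP => i.
  by rewrite mxE nth_answers // /mv_oracle pos0 /= tnth_mktuple /krylov_covec pos0.
case: (posS t) => [p0|pS].
  rewrite p0 /= expr0 mul1mx subn0; apply/colP => i.
  by rewrite mxE nth_answers // /mv_oracle p0 /= tnth_mktuple /krylov_covec p0.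
have {}IH := IH t.+1 (ltnSn t).
rewrite pS subSS /=; case: (boolP (odd (pos t))) IH => /= od IH.
  apply/colP => i.
  rewrite mxE nth_answers // /mv_oracle pS /= od /= tnth_mktuple /krylov_covec pS /=.
  rewrite IH !mulmxA; congr (_ i 0).
  have -> : uphalf (pos t) = (pos t)./2.+1 by rewrite uphalf_half od.
  by rewrite exprS.
apply/colP => i.
rewrite mxE nth_answers // /mv_oracle pS /= (negPf od) /= tnth_mktuple /krylov_vec /=.
rewrite IH; congr (_ i 0).
by rewrite uphalf_half (negPf od).
Qed.

Let B := A^T *m A.

Lemma krylov_colE t : krylov_col (ans Q) t =
  if shiftable t then B ^+ (pos t)./2 *m (A^T *m g w (t - pos t)%N) else 0.
Proof.
rewrite /krylov_col; case: ifP => // /and3P[od /eqP ps tQ].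
have := @answersP t Q (leq_ltn_trans (leq_addr _ _) tQ).
by rewrite /= (negPf od).
Qed.

Lemma gram_krylov_colE t :
  gram_krylov_col (ans Q) t = B ^+ N *m krylov_col (ans Q) t.
Proof.
rewrite krylov_colE /gram_krylov_col; case: ifP => [|_]; last by rewrite mulmx0.
move=> /and3P[od /eqP ps tQ]; have := answersP tQ.
rewrite /= ps oddD odd_double addbF (negPf od) subnDr.
have -> : (pos t + N.*2)./2 = (N + (pos t)./2)%N.
  by rewrite halfD odd_double andbF add0n doubleK addnC.
by rewrite exprD => ->; exact: esym (mulmxA _ _ _).
Qed.

Lemma krylov_runP V a : (k <= d)%N -> sorted_eigenbasis B V a ->
  let s i := a i ^+ N in let Bs := spectral_fun V s in
  exists (P : 'M[R]_d) (rho : nat -> R), let Z := mv_run krylov_algorithm A w in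
  [/\ P^T = P /\ P *m P = P, orthonormal_columns Z,
      (forall i, 0 <= rho i) /\
      (forall i : 'I_k, Bs *m P *m Bs *m col i Z = rho i ^+ 2 *: col i Z),
      forall (i : 'I_k) x, (forall j : 'I_k, (j < i)%N -> dot (col j Z) x = 0) ->
        dot x (Bs *m P *m Bs *m x) <= rho i ^+ 2 * dot x x &
      forall t, (t < Q)%N -> shiftable t ->
        let x := B ^+ (pos t)./2 *m (A^T *m g w (t - pos t)%N) in
        P *m (Bs *m x) = Bs *m x].
Proof.
move=> kd AV s Bs; have [VV VV' _ _ _] := AV.
have Bss : Bs^T = Bs by exact: spectral_fun_sym.
have BB : Bs *m Bs = B ^+ N.
  rewrite (gram_exp_spectral N AV) spectral_fun_comp //.
clearbody Bs.
have [P [Ps PP PE PK]] := compressP [seq krylov_col (ans Q) t | t <- iota 0 Q] Bss.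
have TE : compress [seq (krylov_col (ans Q) t, gram_krylov_col (ans Q) t) | t <- iota 0 Q]
    = Bs *m P *m Bs.
  rewrite -PE -map_comp; congr compress; apply: eq_map => t /=.
  by rewrite BB gram_krylov_colE.
have Tpsd : psd (Bs *m P *m Bs).
  split; first by rewrite !trmx_mul Ps Bss mulmxA.
  move=> x; have -> : Bs *m P *m Bs *m x = (P *m Bs)^T *m (P *m Bs *m x).
    by rewrite trmx_mul Ps Bss !mulmxA -[Bs *m P *m P]mulmxA PP.
  by rewrite dot_mulmxr trmxK dot_ge0.
have [Zo [rho [rho0 TZ Zmax]]] := top_eigenvectorsP kd Tpsd.
have ZE : mv_run krylov_algorithm A w = top_eigenvectors k (Bs *m P *m Bs).
  by rewrite /mv_run /= /krylov_output /= TE.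
exists P, rho => Z; rewrite /Z ZE; split; [exact: (conj Ps PP)|exact: Zo|exact: (conj rho0 TZ)|exact: Zmax|].
move=> t tQ sh /=; have := PK (krylov_col (ans Q) t).
rewrite krylov_colE sh; apply; rewrite -[X in X \in _](_ : krylov_col (ans Q) t = _).
  by apply: map_f; rewrite mem_iota.
by rewrite krylov_colE sh.
Qed.

End Run.
End Algorithm.

(** * Scheduling of the two blocks *)

Section Schedule.
Variables (ka La kb Lb : nat).

(** First come [ka] chains of length [La], one after the other, then chains of length [Lb]. *)
Definition schedule_pos (t : nat) : nat :=
  if (t < ka * La)%N then (t %% La)%N else ((t - ka * La) %% Lb)%N.

Definition schedule_chain (t : nat) : nat :=
  if (t < ka * La)%N then (t %/ La)%N else ((t - ka * La) %/ Lb)%N.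

Hypotheses (La0 : (0 < La)%N) (Lb0 : (0 < Lb)%N).

Lemma modnS_cases t L : (0 < L)%N -> (t.+1 %% L = 0 \/ t.+1 %% L = (t %% L).+1)%N.
Proof. by move=> L0; rewrite modnS; case: ifP; [left|right]. Qed.

Lemma schedule_pos0 : schedule_pos 0 = 0%N.
Proof. by rewrite /schedule_pos; case: ifP; rewrite ?sub0n mod0n. Qed.

Lemma schedule_posS t :
  schedule_pos t.+1 = 0%N \/ schedule_pos t.+1 = (schedule_pos t).+1.
Proof.
rewrite /schedule_pos; case: (ltnP t.+1 (ka * La)) => h.
  by rewrite (ltnW h); exact: modnS_cases.
case: (ltnP t (ka * La)) => h'.
  by left; rewrite (_ : t.+1 - ka * La = 0)%N ?mod0n //; apply/eqP; rewrite subn_eq0.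
by rewrite subSn //; exact: modnS_cases.
Qed.

Lemma schedule_a c i : (c < ka)%N -> (i < La)%N ->
  [/\ schedule_pos (c * La + i) = i, schedule_chain (c * La + i) = c &
      (c * La + i < ka * La)%N].
Proof.
move=> cka iL.
have lt : (c * La + i < ka * La)%N.
  by apply: (@leq_trans (c.+1 * La)%N); rewrite ?leq_mul2r ?cka ?orbT // mulSnr ltn_add2l.
rewrite /schedule_pos /schedule_chain lt modnMDl modn_small //.
by rewrite divnMDl // divn_small // addn0.
Qed.

Lemma schedule_b c i : (c < kb)%N -> (i < Lb)%N ->
  [/\ schedule_pos (ka * La + (c * Lb + i)) = i,
      schedule_chain (ka * La + (c * Lb + i)) = c &
      (ka * La + (c * Lb + i) < ka * La + kb * Lb)%N].
Proof.
move=> cka iL.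
have lt : (c * Lb + i < kb * Lb)%N.
  by apply: (@leq_trans (c.+1 * Lb)%N); rewrite ?leq_mul2r ?cka ?orbT // mulSnr ltn_add2l.
rewrite /schedule_pos /schedule_chain ltnNge leq_addr /= addKn modnMDl modn_small //.
by rewrite divnMDl // divn_small // addn0 ltn_add2l.
Qed.

End Schedule.

Section RandomKrylov.
Variables (R : realType) (n d k N ka qa kb qb : nat).
Hypothesis n0 : (0 < n)%N.
Let m := (20 * n)%N.
Let F := {ffun 'I_n * 'I_kb -> 'I_m}.

Let m0 : (0 < m)%N. Proof. by rewrite muln_gt0. Qed.

Definition grid0 : F := [ffun=> Ordinal m0].

Definition grid_of (w : nat) : F := nth grid0 (enum {: F}) w.

(** One product with [A^T], then [q] applications of [(A^T A) ^ N] and one more, which supplies the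
    image of the last Krylov vector. *)
Definition chain_length (q : nat) : nat := (N.*2 * q.+1).+1.

Let La := chain_length qa.
Let Lb := chain_length qb.

(** Both blocks take their columns from the same grid matrix: the narrow block starts from the first
    [ka] columns of the wide one. *)
Definition start_vec (w t : nat) : 'cV[R]_n :=
  if insub (schedule_chain ka La Lb t) is Some c then col c (grid_mx R (grid_of w)) else 0.

Definition num_products : nat := (ka * La + kb * Lb)%N.

Definition random_krylov : mv_algorithm R n d k num_products nat :=
  @krylov_algorithm R n d k num_products N (schedule_pos ka La Lb) start_vec.

Section Run.
Variables (A : 'M[R]_(n, d)) (w : nat).

Let pos := schedule_pos ka La Lb.

Lemma random_krylov_cols V a P :
  let s i := a i ^+ N in let B := spectral_fun V s in
  (forall t, (t < num_products)%N -> shiftable num_products N pos t ->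
        let x := (A^T *m A) ^+ (pos t)./2 *m (A^T *m start_vec w (t - pos t)%N) in
        P *m (B *m x) = B *m x) ->
  forall (b0 q : nat), (b0, q) = (ka, qa) \/ (b0, q) = (kb, qb) ->
  forall j (c : 'I_kb), (j <= q)%N -> (c < b0)%N ->
  let x := ((A^T *m A) ^+ N) ^+ j *m (A^T *m col c (grid_mx R (grid_of w))) in
  P *m (B *m x) = B *m x.
Proof.
move=> s B H b0 q bq j c jq cb.
suff [t [tQ pt pt2 ct tQ2]] : exists t, [/\ (t < num_products)%N, pos t = (N.*2 * j)%N,
    pos (t + N.*2)%N = (N.*2 * j + N.*2)%N,
    schedule_chain ka La Lb (t - N.*2 * j)%N = c & (t + N.*2 < num_products)%N].
  have := H t tQ; rewrite /shiftable pt pt2 eqxx tQ2 oddM odd_double /= => /(_ isT).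
  rewrite -doubleMl doubleK exprM /start_vec doubleMl ct.
  by rewrite insubT //= => ltc; rewrite (_ : Sub _ _ = c) //; exact: val_inj.
case: bq => [] [b0E qE]; subst b0 q.
  have lt1 : (N.*2 * j < La)%N by rewrite /La /chain_length ltnS leq_mul2l (leq_trans jq) ?orbT.
  have lt2 : (N.*2 * j + N.*2 < La)%N.
    by rewrite /La /chain_length ltnS -mulnSr leq_mul2l ltnS jq orbT.
  have lt0 : (0 < La)%N by [].
  have [h1 h2 h3] := schedule_a Lb (ltn0Sn _ : (0 < La)%N) cb lt1.
  have [h4 h5 h6] := schedule_a Lb (ltn0Sn _ : (0 < La)%N) cb lt2.
  have [h7 h8 h9] := schedule_a Lb (ltn0Sn _ : (0 < La)%N) cb lt0.
  exists (c * La + N.*2 * j)%N; split=> //.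
  - by apply: leq_trans h3 _; exact: leq_addr.
  - by rewrite -addnA.
  - by rewrite addnK -[(c * La)%N]addn0.
  - by rewrite -addnA; apply: leq_trans h6 _; exact: leq_addr.
have lt1 : (N.*2 * j < Lb)%N by rewrite /Lb /chain_length ltnS leq_mul2l (leq_trans jq) ?orbT.
have lt2 : (N.*2 * j + N.*2 < Lb)%N.
  by rewrite /Lb /chain_length ltnS -mulnSr leq_mul2l ltnS jq orbT.
have lt0 : (0 < Lb)%N by [].
have [h1 h2 h3] := schedule_b ka La (ltn0Sn _ : (0 < Lb)%N) cb lt1.
have [h4 h5 h6] := schedule_b ka La (ltn0Sn _ : (0 < Lb)%N) cb lt2.
have [h7 h8 h9] := schedule_b ka La (ltn0Sn _ : (0 < Lb)%N) cb lt0.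
exists (ka * La + (c * Lb + N.*2 * j))%N; split=> //.
- by rewrite -!addnA.
- by rewrite addnA addnK -[(c * Lb)%N]addn0.
- by rewrite -!addnA.
Qed.

End Run.

Lemma card_bad_grids (A : 'M[R]_(n, d)) V a r (rd : (r <= d)%N) :
  sorted_eigenbasis (A^T *m A) V a -> (r <= n)%N ->
  (forall i, (i < r)%N -> 0 < a i) ->
  forall b0, (b0 <= kb)%N ->
  exists bad : {set F}, (20 * #|bad| <= #|{: F}|)%N /\ forall f, f \notin bad ->
    forall (bb : (minn b0 r <= kb)%N) (bd : (minn b0 r <= d)%N),
    well_conditioned (1600 * n%:R ^+ 7) (first_cols bb (grid_mx R f)) (lsing A V a bd).
Proof.
move=> AV rn apos b0 b0kb.
have bb : (minn b0 r <= kb)%N by exact: leq_trans (geq_minl _ _) b0kb.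
have bd : (minn b0 r <= d)%N by exact: leq_trans (geq_minr _ _) rd.
have bn : (minn b0 r <= n)%N by exact: leq_trans (geq_minr _ _) rn.
have uo : forall i j, dot (lsing A V a bd i) (lsing A V a bd j) = (i == j)%:R.
  apply: lsing_orthonormal => // i ib; apply: apos.
  exact: leq_trans ib (geq_minr _ _).
have [bad [h1 h2]] := card_not_separated bb uo n0 bn.
exists bad; split=> // f /h2 sep bb' bd'.
rewrite (bool_irrelevance bb' bb) (bool_irrelevance bd' bd).
exact: separated_well_conditioned.
Qed.

Lemma card_gridF_gt0 : (0 < #|{: F}|)%N.
Proof. by apply/card_gt0P; exists grid0. Qed.

(* Either the wide block is large enough for the Krylov space to be the row space
   of [A], or both the flat and the decaying spectra are covered. *)
Definition krylov_parameters (p eps : R) : Prop :=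
  (n <= kb)%N \/
  exists g gb tau : R, [/\ ka = k /\ 0 < g <= 1, 0 <= gb /\ 0 <= tau,
    (1600 * n%:R ^+ 7 <= tau * ((1 + Num.sqrt g) ^+ qa / 2) ^+ 2 /\
     1600 * n%:R ^+ 7 <= tau * ((1 + Num.sqrt gb) ^+ qb / 2) ^+ 2),
    (k%:R * tau <= g / 2 /\ k%:R * tau <= eps / 2) &
    p * (1 + g) `^ (p - 1) * (k%:R * g) * (Num.sqrt (1 + gb)) `^ p <=
      (kb - k)%:R * ((1 + eps) `^ p - 1)].

Lemma random_krylov_solves (p eps : R) (q : nat) (Fun : 'M[R]_(n, d) -> 'M[R]_(q, d)) :
  1 <= p -> 0 < eps -> (0 < N)%N -> (0 < k)%N -> (k <= d)%N -> (k <= kb)%N ->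
  (ka <= kb)%N -> krylov_parameters p eps ->
  (forall A, (Fun A)^T *m Fun A = (A^T *m A) ^+ N) ->
  mv_solves (uniform_nat R #|{: F}|.-1) random_krylov p eps Fun.
Proof.
move=> p1 eps0 N0 k0 kd kkb kakb params FA A.
have [V [a AV]] := spectral (psd_gram A).
have [r [rd rn rpos rzero]] := exists_rank AV.
have [badb [cb Hb]] := card_bad_grids rd AV rn rpos (leqnn kb).
have [bada [ca Ha]] := card_bad_grids rd AV rn rpos kakb.
(* Each bad set holds at most one grid in twenty, so the two together cost probability at most
   [1 / 10]. *)
pose E := [set w : nat | nth grid0 (enum {: F}) w \notin bada :|: badb]%classic.
exists E; split=> //.
  have FK : #|{: F}| = #|{: F}|.-1.+1 by rewrite prednK // card_gridF_gt0.
  rewrite [X in (_ <= X)%E](uniform_nat_finType R grid0 (bada :|: badb) FK) lee_fin.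
  have F0 : 0 < #|{: F}|%:R :> R by rewrite ltr0n card_gridF_gt0.
  have : #|bada :|: badb|%:R / #|{: F}|%:R <= 1 / 10 :> R.
    rewrite ler_pdivrMr // mulrAC mul1r ler_pdivlMr // -natrM ler_nat.
    have := (leq_card_setU bada badb).1; move: ca cb.
    move: #|bada :|: badb| #|bada| #|badb| #|{: F}| => x1 x2 x3 x4; clear; lia.
  by lra.
move=> w; rewrite /E /= inE negb_or => /andP[nba nbb].
have bd0 b0 : (minn b0 r <= d)%N by exact: leq_trans (geq_minr _ _) rd.
have bbb : (minn kb r <= kb)%N by exact: geq_minl.
have bba : (minn ka r <= kb)%N by exact: leq_trans (geq_minl _ _) kakb.
have condb := Hb _ nbb bbb (bd0 kb).
have conda := Ha _ nba bba (bd0 ka).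
have T20 : 0 <= 1600 * n%:R ^+ 7 :> R := mulr_ge0 (ler0n _ _) (exprn_ge0 _ (ler0n _ _)).
have [P [rho [[Ps PP] Zo [rho0 TZ] Zmax cols]]] :=
  @krylov_runP R n d k num_products N _ start_vec (schedule_pos0 ka La Lb)
    (schedule_posS ka (ltn0Sn _ : (0 < La)%N) (ltn0Sn _ : (0 < Lb)%N)) A w V a kd AV.
have kry := random_krylov_cols cols.
have kryb := kry kb qb (or_intror erefl).
have krya := kry ka qa (or_introl erefl).
have a0 i : 0 <= a i by case: AV => _ _ _ [].
case: params => [nkb|[g [gb [tau [[kak g01] [gb0 tau0] [Ta Tb] [kt1 kt2] scal]]]]].
  (* The rank is at most [n <= kb], so the singular value after the wide block vanishes and
     [near_optimal_gap] applies with zero gap and zero loss. *)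
  have sz : a kb ^+ N = 0.
    by rewrite rzero ?expr0n 1?eqn0Ngt ?N0 // (leq_trans rn).
  apply: (@near_optimal_gap R n d k kb N A V P a AV N0 Ps PP _ rho rho0 Zmax
    (grid_mx R (grid_of w)) r rpos rzero _ T20 kb qb bbb (bd0 kb) condb kryb
    q (Fun A) (FA A) Zo TZ k0 kd p eps 0 0) => //.
  - by rewrite sz expr0n mulr0 sqr_ge0.
  - by left.
  - by rewrite mulr0 divr_ge0 // ltW.
have [flat|gap] := leP ((a k ^+ N) ^+ 2) ((1 + gb) * (a kb ^+ N) ^+ 2).
  apply: (@near_optimal_flat R n d k kb N A V P a AV N0 Ps PP _ rho rho0 Zmax
    (grid_mx R (grid_of w)) r rd rpos rzero _ T20 ka qa bba (bd0 ka) conda krya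
    q (Fun A) (FA A) Zo TZ k0 kd p eps g gb tau (kb - k)%N) => //.
  by rewrite subnKC.
apply: (@near_optimal_gap R n d k kb N A V P a AV N0 Ps PP _ rho rho0 Zmax
    (grid_mx R (grid_of w)) r rpos rzero _ T20 kb qb bbb (bd0 kb) condb kryb
    q (Fun A) (FA A) Zo TZ k0 kd p eps gb tau) => //.
  exact: ltW.
by right.
Qed.

End RandomKrylov.

(** * Choice of the parameters *)

Lemma approx_error_ge0 (R : realType) m d k p (M : 'M[R]_(m, d)) (U : 'M[R]_(d, k)) :
  0 <= approx_error p M U.
Proof. exact: powR_ge0. Qed.

Lemma near_optimal_weaken (R : realType) m d k (p e eps : R) (M : 'M[R]_(m, d))
    (Z : 'M[R]_(d, k)) : e <= eps -> near_optimal p e M Z -> near_optimal p eps M Z.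
Proof.
move=> ee [Zo h]; split => //; apply: le_trans h _; rewrite ler_wpM2r ?lerD2l //.
apply: lb_le_inf; first by exists (approx_error p M Z), Z.
by move=> _ [U _ <-]; exact: approx_error_ge0.
Qed.

(** For the regime [g = gb = e / 16]: since [(1 + g) ^ 2 <= 1 + e / 2], the product of the two
    powers is absorbed by the tangent at [1 + e / 2]. *)
Lemma flat_scalar_large (R : realType) (p e : R) : 1 <= p -> 0 <= e <= 1 ->
  p * (1 + e / 16) `^ (p - 1) * (e / 16) * Num.sqrt (1 + e / 16) `^ p <=
    (1 + e) `^ p - 1.
Proof.
move=> p1 /andP[e0 e1]; set g := e / 16.
have g0 : 0 <= g by rewrite divr_ge0.
have g1 : g <= 1 / 16 by rewrite /g; lra.
have gE : e = 16 * g by rewrite /g; lra.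
have sq : Num.sqrt (1 + g) <= 1 + g.
  rewrite -(ler_pXn2r (n := 2)) ?nnegrE ?sqrtr_ge0 //; last lra.
  rewrite sqr_sqrtr; last lra.
  nra.
have p0 : 0 <= p - 1 by lra.
have h1 : Num.sqrt (1 + g) `^ p <= (1 + g) `^ (p - 1) * 2.
  apply: (@le_trans _ _ ((1 + g) `^ p)).
    by apply: ge0_ler_powR; rewrite ?nnegrE ?sqrtr_ge0 //; lra.
  rewrite -powRB1 //; last lra.
  by rewrite ler_wpM2l ?powR_ge0 //; lra.
have h2 : (1 + g) `^ (p - 1) * (1 + g) `^ (p - 1) <= (1 + e / 2) `^ (p - 1).
  rewrite -powRM; [|lra|lra].
  apply: ge0_ler_powR; rewrite ?nnegrE //; nra.
apply: le_trans (powR_bernoulli (x := e / 2) p1 _ e0); last by rewrite divr_ge0.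
set a := (1 + g) `^ (p - 1) in h1 h2 *.
have a0 : 0 <= a by exact: powR_ge0.
apply: (@le_trans _ _ (p * a * g * (a * 2))).
  by rewrite ler_wpM2l // !mulr_ge0 //; lra.
rewrite (_ : p * a * g * (a * 2) = p * (a * a) * (2 * g)); last by ring.
apply: ler_pM; [by rewrite !mulr_ge0 //; lra|lra| |rewrite gE; lra].
by rewrite ler_wpM2l //; lra.
Qed.

Lemma expR_le2 (R : realType) (x : R) : x <= 1 / 2 -> expR x <= 2.
Proof.
move=> x1; have := expR_ge1Dx (- x); rewrite expRN => h.
have : 2^-1 <= (expR x)^-1 by apply: le_trans h; lra.
by rewrite lef_pV2 ?posrE ?expR_gt0.
Qed.

Lemma powR_euler_le2 (R : realType) (p : R) : 1 <= p -> (1 + (16 * p)^-1) `^ p <= 2.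
Proof.
move=> p1; have p0 : 0 < p by lra.
have z0 : 0 < (16 * p)^-1 by rewrite invr_gt0 mulr_gt0.
apply: (@le_trans _ _ (expR (16 * p)^-1 `^ p)).
  by apply: ge0_ler_powR; rewrite ?nnegrE ?expR_ge0 ?expR_ge1Dx //; lra.
rewrite -expRM; apply: expR_le2.
by rewrite invfM -mulrA mulVf ?gt_eqF // mulr1; lra.
Qed.

(** With both accuracies at most [1 / (16 * p)] the two powers are at most 2, and
    [p * e <= (1 + e) ^ p - 1] concludes. *)
Lemma flat_scalar_small (R : realType) (p e g : R) : 1 <= p -> 0 <= e ->
  0 <= g <= (16 * p)^-1 ->
  p * (1 + g) `^ (p - 1) * (e / 16) * Num.sqrt (1 + (16 * p)^-1) `^ p <=
    (1 + e) `^ p - 1.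
Proof.
move=> p1 e0 /andP[g0 gp]; have p0 : 0 < p by lra.
set z := (16 * p)^-1 in gp *.
have z0 : 0 < z by rewrite invr_gt0 mulr_gt0.
have h2 := powR_euler_le2 p1; rewrite -/z in h2.
have h3 : (1 + g) `^ (p - 1) <= 2.
  apply: le_trans h2; apply: (@le_trans _ _ ((1 + z) `^ (p - 1))).
    by apply: ge0_ler_powR; rewrite ?nnegrE; lra.
  by apply: ler_powR; lra.
have h4 : Num.sqrt (1 + z) `^ p <= 2.
  apply: le_trans h2; apply: ge0_ler_powR; rewrite ?nnegrE ?sqrtr_ge0 ?(ltW p0) //; first lra.
  rewrite -(ler_pXn2r (n := 2)) ?nnegrE ?sqrtr_ge0 //; last lra.
  rewrite sqr_sqrtr; last lra.
  nra.
have := powR_bernoulli p1 (lexx 0) e0; rewrite addr0 powR1 subr0 mulr1.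
apply: le_trans.
have a0 := powR_ge0 (1 + g) (p - 1); have b0 := powR_ge0 (Num.sqrt (1 + z)) p.
set a := (1 + g) `^ _ in h3 a0 *; set b := _ `^ p in h4 b0 *.
have pe : 0 <= p * e by rewrite mulr_ge0 // ltW.
have ab : a * b <= 4 by nra.
rewrite (_ : p * a * (e / 16) * b = (p * e) * (a * b / 16)); last by field.
by rewrite ler_piMr //; lra.
Qed.

Lemma nat_ceil (R : realType) (z : R) : 0 <= z -> exists b : nat, z <= b%:R <= z + 1.
Proof.
move=> z0; exists (Num.truncn z).+1.
have /andP[h1 h2] := truncn_itv z0.
by rewrite (ltW h2) -natr1 lerD2r h1.
Qed.

Lemma expr_ceil_ge2 (R : realType) (z : R) (b : nat) : 0 < z -> z^-1 <= b%:R ->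
  2 <= (1 + z) ^+ b.
Proof.
move=> z0 zb; apply: (@le_trans _ _ (1 + b%:R * z)).
  have : 1 <= b%:R * z by rewrite -ler_pdivrMr // div1r.
  by lra.
elim: b {zb} => [|b IH]; first by rewrite mul0r addr0 expr0.
rewrite exprS -natr1.
apply: (@le_trans _ _ ((1 + z) * (1 + b%:R * z))).
  have : 0 <= b%:R * z * z by rewrite !mulr_ge0 // ltW.
  nra.
by rewrite ler_wpM2l //; lra.
Qed.

(** The number of doublings that reach [n ^ 15]. Its square, divided by 4, exceeds the conditioning
    [1600 * n ^ 7] times the inverse accuracy [32 * n ^ 4] as soon as [n >= 2]. *)
Definition log_rounds (n : nat) : nat := (15 * (trunc_log 2 n).+1)%N.

Lemma log_rounds_pow n : (n ^ 15 <= 2 ^ log_rounds n)%N.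
Proof. by rewrite /log_rounds mulnC expnM leq_exp2r // ltnW // trunc_log_ltn. Qed.

(** As [ln 2 >= 1 / 2], the binary logarithm is at most [2 * L]; adding one gives [3 * L], and 45 is
    15 times 3. *)
Lemma log_rounds_le (R : realType) (n k : nat) : (0 < n)%N -> (0 < k)%N ->
  (log_rounds n)%:R <= 45 * Num.max 1 (ln (n * k)%:R) :> R.
Proof.
move=> n0 k0; set L := Num.max _ _.
have L1 : 1 <= L by rewrite le_max lexx.
have Ln : ln n%:R <= L.
  rewrite le_max; apply/orP; right; rewrite ler_ln ?posrE ?ltr0n ?muln_gt0 ?n0 ?k0 //.
  by rewrite ler_nat leq_pmulr.
have t2 : (trunc_log 2 n)%:R / 2 <= L.
  apply: le_trans Ln.
  have : (2 ^ trunc_log 2 n <= n)%N by exact: trunc_logP.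
  rewrite -(ler_nat R) natrX => tn.
  have : ln (2 ^+ trunc_log 2 n : R) <= ln n%:R by rewrite ler_ln ?posrE ?exprn_gt0 ?ltr0n.
  rewrite lnXn // -[_ *+ _]mulr_natl => h; apply: le_trans h.
  by rewrite ler_wpM2l // -ler_expR lnK ?posrE // expR_le2 //; lra.
rewrite /log_rounds natrM -natr1; lra.
Qed.

Lemma amplification_ge (R : realType) (n c : nat) (z : R) : (1 < n)%N -> 0 < z ->
  z^-1 <= c%:R ->
  1600 * n%:R ^+ 7 <= (32 * n%:R ^+ 4)^-1 * ((1 + z) ^+ (log_rounds n * c) / 2) ^+ 2.
Proof.
move=> n1 z0 zc; have n0 : 0 < n%:R :> R by rewrite ltr0n ltnW.
have n2 : 2 <= n%:R :> R by rewrite ler_nat.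
have h : n%:R ^+ 15 <= (1 + z) ^+ (log_rounds n * c).
  apply: (@le_trans _ _ (2 ^+ log_rounds n)).
    by rewrite -!natrX ler_nat log_rounds_pow.
  rewrite mulnC exprM; apply: lerXn2r; rewrite ?nnegrE ?exprn_ge0 //; last exact: expr_ceil_ge2.
  by lra.
rewrite [leRHS]mulrC ler_pdivlMr ?mulr_gt0 ?exprn_gt0 //.
apply: (@le_trans _ _ ((n%:R ^+ 15 / 2) ^+ 2)); last first.
  apply: lerXn2r; rewrite ?nnegrE ?divr_ge0 ?exprn_ge0 //; try lra.
have n5 : 32 <= n%:R ^+ 5 :> R.
  rewrite (_ : 32 = 2 ^+ 5); last by rewrite -natrX.
  by apply: lerXn2r; rewrite ?nnegrE ?(ltW n0).
have n4 : 16 <= n%:R ^+ 4 :> R.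
  apply: (@le_trans _ _ (2 ^+ 4)); first lra.
  by apply: lerXn2r; rewrite ?nnegrE ?(ltW n0).
rewrite (_ : (n%:R ^+ 15 / 2) ^+ 2 =
    n%:R ^+ 7 * n%:R ^+ 4 * (n%:R ^+ 5 * n%:R ^+ 5 * n%:R ^+ 5 * (n%:R ^+ 4 / 4))); last by field.
have : 0 <= n%:R ^+ 7 * n%:R ^+ 4 :> R by rewrite mulr_ge0 // exprn_ge0 // ltW.
move: (n%:R ^+ 7 : R) (n%:R ^+ 4 : R) (n%:R ^+ 5 : R) n4 n5 {h n0 n2} => u w x w4 x32 uw.
have xx : 1600 <= 4 * (x * x) by nra.
have c0 : 0 <= 1600 :> R by lra.
move: (1600 : R) xx c0 => a xx a0.
rewrite mulrACA mulrC; apply: (ler_wpM2l uw).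
apply: (@le_trans _ _ (4 * (x * x) * x)); first by apply: ler_pM.
rewrite (_ : 4 * (x * x) * x = x * x * x * 4); last by ring.
by apply: ler_wpM2l; last lra; rewrite !mulr_ge0 //; lra.
Qed.

Lemma powR_root (R : realType) (p : R) (n : nat) : 0 <= p -> (p `^ n.+1%:R^-1) ^+ n.+1 = p.
Proof.
move=> p0; rewrite -powR_mulrn ?powR_ge0 // -powRrM mulVf ?pnatr_eq0 //.
by rewrite powRr1.
Qed.

(** A chain costs at most [13 * N * r] times [Y] or [W], and the wide block has at most [3 * k * s]
    chains. As [W * s = Y], the total is [13 + 39 = 52] units. *)
Lemma count_le (R : realType) (k N r : nat) (Y W s ca cb b1 : R) :
  1 <= k%:R :> R -> 1 <= N%:R :> R -> 1 <= r%:R :> R -> 1 <= Y -> 1 <= W ->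
  1 <= s -> W * s = Y -> 0 <= ca <= 4 * Y + 1 -> 0 <= cb <= 4 * W + 1 ->
  0 <= b1 <= k%:R * s + 1 ->
  k%:R * (N%:R * 2 * (r%:R * ca + 1) + 1) +
  (k%:R + b1) * (N%:R * 2 * (r%:R * cb + 1) + 1) <= 52 * (k%:R * N%:R * r%:R * Y).
Proof.
move: k%:R N%:R r%:R => {}k {}N {}r k1 N1 r1 Y1 W1 s1 WY /andP[ca0 ca1] /andP[cb0 cb1]
  /andP[b0 b1'].
have Nr : 1 <= N * r by nra.
have E (c Z : R) : 1 <= Z -> 0 <= c -> c <= 4 * Z + 1 ->
    N * 2 * (r * c + 1) + 1 <= 13 * (N * r * Z).
  move=> Z1 c0 cZ.
  have rc : r * c <= 5 * (r * Z) by nra.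
  have rZ : 1 <= r * Z by nra.
  have h : N * (r * c + 1) <= N * (6 * (r * Z)) by rewrite ler_wpM2l; nra.
  have : 1 <= N * (r * Z) by nra.
  by lra.
have h1 := E ca Y Y1 ca0 ca1; have h2 := E cb W W1 cb0 cb1.
have kb : k + b1 <= 3 * (k * s) by nra.
apply: (@le_trans _ _ (k * (13 * (N * r * Y)) + 3 * (k * s) * (13 * (N * r * W)))).
  apply: lerD; first by rewrite ler_wpM2l //; lra.
  apply: ler_pM => //; first lra.
  have : 0 <= r * cb by rewrite mulr_ge0 //; lra.
  by move=> ?; rewrite addr_ge0 // !mulr_ge0 //; lra.
by rewrite -WY le_eqVlt; apply/orP; left; apply/eqP; ring.
Qed.

Lemma natr_num_products (R : realType) (N ka kb qa qb : nat) :
  (num_products N ka qa kb qb)%:R =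
    ka%:R * (N%:R * 2 * (qa%:R + 1) + 1) + kb%:R * (N%:R * 2 * (qb%:R + 1) + 1) :> R.
Proof.
have E q : (chain_length N q)%:R = N%:R * 2 * (q%:R + 1) + 1 :> R.
  by rewrite /chain_length -[_.+1%:R]natr1 natrM -muln2 natrM -[q.+1%:R]natr1.
by rewrite natrD [(ka * _)%:R]natrM [(kb * _)%:R]natrM !E.
Qed.

Lemma krylov_exists (R : realType) (n d k N q0 : nat) (Fun : 'M[R]_(n, d) -> 'M[R]_(q0, d))
    (eps p : R) :
  (0 < n)%N -> (0 < N)%N -> (0 < k <= d)%N -> 0 < eps -> 1 <= p ->
  (forall A, (Fun A)^T *m Fun A = (A^T *m A) ^+ N) ->
  exists (disp : measure_display) (Omega : measurableType disp)
    (P : probability Omega R) (q : nat) (alg : mv_algorithm R n d k q Omega),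
    q%:R <= 2340 * (k%:R * N%:R * Num.max 1 (ln (n * k)%:R) *
        p `^ 6^-1 / (Num.min 1 eps) `^ 3^-1) /\ mv_solves P alg p eps Fun.
Proof.
move=> n0 N0 /andP[k0 kd] eps0 p1 FA.
pose e := Num.min 1 eps.
have e0 : 0 < e by rewrite lt_min ltr01.
have e1 : e <= 1 by rewrite ge_min lexx.
have ee : e <= eps by rewrite ge_min lexx orbT.
suff [ka [qa [kb [qb [kkb kakb par cnt]]]]] : exists ka qa kb qb : nat,
    [/\ (k <= kb)%N, (ka <= kb)%N, krylov_parameters n k ka qa kb qb p e &
     (num_products N ka qa kb qb)%:R <= 2340 * (k%:R * N%:R * Num.max 1 (ln (n * k)%:R) *
        p `^ 6^-1 / e `^ 3^-1)].
  exists _, nat, (uniform_nat R #|{: {ffun 'I_n * 'I_kb -> 'I_(20 * n)}}|.-1).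
  exists _, (random_krylov R d k N ka qa kb qb n0); split=> //.
  move=> A; have [E [mE PE hE]] := random_krylov_solves n0 p1 e0 N0 k0 kd kkb kakb par FA A.
  exists E; split=> // w Ew; exact: near_optimal_weaken ee (hE w Ew).
set L := Num.max _ _.
have L1 : 1 <= L by rewrite le_max lexx.
(* With [v = min(1, (p e)^(1/6))] the parameters are [g = e / (16 v ^ 2)] for the block
   of [k] vectors, and [gb = e / (16 v ^ 6)] for the block of [k + k / v ^ 2] vectors;
   the costs [k / sqrt g] and [(k / v ^ 2) / sqrt gb] of the two blocks agree. *)
pose x := p `^ 6^-1; pose y := e `^ 6^-1.
have x6 : x ^+ 6 = p by rewrite /x powR_root //; lra.
have y6 : y ^+ 6 = e by rewrite /y powR_root // ltW.
have x1 : 1 <= x by rewrite -[leLHS](powRr0 p); apply: ler_powR => //; rewrite invr_ge0.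
have y0 : 0 < y by exact: powR_gt0.
have y1 : y <= 1.
  have : e `^ 6^-1 <= 1 `^ 6^-1 by apply: ge0_ler_powR; rewrite ?nnegrE ?invr_ge0 // ltW.
  by rewrite powR1.
have y2 : e `^ 3^-1 = y ^+ 2.
  rewrite -powR_mulrn ?powR_ge0 // /y -powRrM; congr (_ `^ _); lra.
rewrite y2 -/x.
pose v := Num.min 1 (x * y).
have v1 : v <= 1 by rewrite ge_min lexx.
have vxy : v <= x * y by rewrite ge_min lexx orbT.
have yv : y <= v by rewrite le_min y1 ler_peMl // ltW.
have v0 : 0 < v by exact: lt_le_trans yv.
(* [4 * Y], and [4 * W] below, are the inverse square roots of [g] and [gb]: the filter degrees that
   gain a factor 2. *)
pose Y := v / y ^+ 3.
have y30 : 0 < y ^+ 3 by exact: exprn_gt0.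
have v20 : 0 < v ^+ 2 by exact: exprn_gt0.
have y21 : y ^+ 2 <= 1 by rewrite expr_le1 // ltW.
have y3y : y ^+ 3 <= y by rewrite exprS ler_piMr // ltW.
have Y1 : 1 <= Y by rewrite ler_pdivlMr // mul1r (le_trans y3y).
have YX : Y <= x / y ^+ 2.
  rewrite ler_pdivrMr // (_ : x / y ^+ 2 * y ^+ 3 = x * y) //.
  by field; rewrite gt_eqF.
have k1 : 1 <= k%:R :> R by rewrite ler1n.
have N1 : 1 <= N%:R :> R by rewrite ler1n.
have kN0 : 0 <= k%:R * N%:R :> R by rewrite mulr_ge0.
(* The constant 2340 is 52, from [count_le], times 45, from [log_rounds_le]. *)
have finish (c : R) : c <= 52 * (k%:R * N%:R * (45 * L) * Y) ->
    c <= 2340 * (k%:R * N%:R * L * x / y ^+ 2).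
  move=> /le_trans; apply.
  have -> : 2340 * (k%:R * N%:R * L * x / y ^+ 2) =
    52 * (k%:R * N%:R * (45 * L) * (x / y ^+ 2)) by ring.
  by rewrite ler_wpM2l // ler_wpM2l // mulr_ge0 // mulr_ge0 //; lra.
(* If [n <= k * Y], a block of [n + k] chains with [qb = 0] is within budget. Otherwise [k] and [Y]
   are at most [n], so powers of [n] suffice for all accuracies. *)
have [triv|ntriv] := leP (n%:R) (k%:R * Y).
  exists 0%N, 0%N, (n + k)%N, 0%N; split.
  - exact: leq_addl.
  - exact: leq0n.
  - by left; exact: leq_addr.
  apply: finish; rewrite /num_products /chain_length mul0n add0n muln1 natrM natrD.
  rewrite -natr1 -muln2 natrM.
  have kY : k%:R <= k%:R * Y by rewrite ler_peMr.
  apply: (@le_trans _ _ ((2 * (k%:R * Y)) * (3 * N%:R))).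
    have nR : 0 <= n%:R :> R by [].
    by apply: ler_pM; lra.
  have kNY : 0 <= k%:R * N%:R * Y by rewrite mulr_ge0 //; lra.
  have : k%:R * N%:R * Y <= k%:R * N%:R * Y * L by rewrite ler_peMr.
  lra.
have n1 : (1 < n)%N.
  rewrite -(ltr_nat R); apply: le_lt_trans ntriv; nra.
have nR0 : 0 < n%:R :> R by rewrite ltr0n.
have kn : k%:R <= n%:R :> R by apply: le_trans (ltW ntriv); rewrite ler_peMr.
have Yn : Y <= n%:R by apply: le_trans (ltW ntriv); rewrite ler_peMl //; lra.
pose W := v ^+ 3 / y ^+ 3.
have W1 : 1 <= W by rewrite ler_pdivlMr // mul1r; apply: lerXn2r; rewrite ?nnegrE ?(ltW y0) ?(ltW v0).
have WY : W * (v ^+ 2)^-1 = Y by rewrite /W /Y; field; rewrite !gt_eqF.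
have vi1 : 1 <= (v ^+ 2)^-1 by rewrite invf_ge1 // expr_le1 // ltW.
have [b1 /andP[b1l b1u]] := @nat_ceil R (k%:R * (v ^+ 2)^-1) (mulr_ge0 (ler0n _ _) (ltW (lt_le_trans ltr01 vi1))).
have [ca /andP[cal cau]] := @nat_ceil R (4 * Y) (mulr_ge0 (ler0n _ _) (ltW (lt_le_trans ltr01 Y1))).
have [cb /andP[cbl cbu]] := @nat_ceil R (4 * W) (mulr_ge0 (ler0n _ _) (ltW (lt_le_trans ltr01 W1))).
set r := log_rounds n.
have r0 : (0 < r)%N by rewrite /r /log_rounds muln_gt0.
exists k, (r * ca)%N, (k + b1)%N, (r * cb)%N; split.
- exact: leq_addr.
- exact: leq_addr.
- right.
  pose ga := (4 * Y)^-1; pose gb := (4 * W)^-1.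
  have Y40 : 1 <= 4 * Y by move: Y1; clear; lra.
  have W40 : 1 <= 4 * W by move: W1; clear; lra.
  have ga0 : 0 < ga by rewrite invr_gt0 (lt_le_trans ltr01).
  have gb0 : 0 < gb by rewrite invr_gt0 (lt_le_trans ltr01).
  have sga : Num.sqrt (ga ^+ 2) = ga by rewrite sqrtr_sqr gtr0_norm.
  have sgb : Num.sqrt (gb ^+ 2) = gb by rewrite sqrtr_sqr gtr0_norm.
  have ga1 : ga <= 1 by rewrite invf_le1 // (lt_le_trans ltr01).
  have gaE : ga ^+ 2 = e / 16 / v ^+ 2.
    rewrite -y6 /ga /Y; field; rewrite !gt_eqF //.
  have gbE : gb ^+ 2 = e / 16 / v ^+ 6.
    rewrite -y6 /gb /W; field; rewrite !gt_eqF //.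
  (* This [tau] gives [k * tau <= 1 / (32 * n ^ 3)]. It is below [g / 2 = 1 / (32 * Y ^ 2)] because
     [Y <= n], and below [e / 2] because [e >= 1 / n ^ 3]. *)
  have tau0 : 0 <= (32 * n%:R ^+ 4)^-1 :> R by rewrite invr_ge0 mulr_ge0 // exprn_ge0.
  have kt : k%:R * (32 * n%:R ^+ 4)^-1 <= (32 * n%:R ^+ 3)^-1 :> R.
    rewrite ler_pdivrMr ?mulr_gt0 ?exprn_gt0 //.
    rewrite (_ : (32 * n%:R ^+ 3)^-1 * (32 * n%:R ^+ 4) = n%:R) //.
    by field; rewrite gt_eqF.
  exists (ga ^+ 2), (gb ^+ 2), (32 * n%:R ^+ 4)^-1; split.
  + by split=> //; rewrite exprn_gt0 //= expr_le1 // ltW.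
  + by split=> //; exact: sqr_ge0.
  + rewrite sga sgb; split; apply: amplification_ge => //; first by rewrite invrK.
    by rewrite invrK.
  + split; apply: le_trans kt _.
      have : n%:R ^+ 2 <= n%:R ^+ 3 :> R.
        by rewrite [leRHS]exprS ler_peMl ?exprn_ge0 // ler1n ltnW.
      have Y2n : Y ^+ 2 <= n%:R ^+ 2 by apply: lerXn2r; rewrite ?nnegrE ?(ltW nR0) // (le_trans ler01).
      have Y20 : 0 < Y ^+ 2 by rewrite exprn_gt0 // (lt_le_trans ltr01).
      have n30 : 0 < n%:R ^+ 3 :> R by rewrite exprn_gt0.
      rewrite /ga exprVn exprMn -invfM.
      move: (Y ^+ 2) (n%:R ^+ 2 : R) (n%:R ^+ 3 : R) Y2n Y20 n30; clear.
      move=> a b c ab a0 c0 bc; rewrite lef_pV2 ?posrE; lra.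
    have yn : n%:R^-1 <= y ^+ 2.
      rewrite -div1r ler_pdivrMr //.
      have : 1 <= y ^+ 2 * Y.
        rewrite /Y (_ : y ^+ 2 * (v / y ^+ 3) = v / y).
          by rewrite ler_pdivlMr // mul1r.
        by field; rewrite gt_eqF.
      move=> /le_trans; apply; rewrite ler_wpM2l // ?exprn_ge0 // ltW //.
    have en : (n%:R ^+ 3)^-1 <= e.
      rewrite -y6 -exprVn (_ : y ^+ 6 = (y ^+ 2) ^+ 3); last by rewrite -exprM.
      by apply: lerXn2r; rewrite ?nnegrE ?invr_ge0 ?exprn_ge0 // ltW.
    by rewrite invfM; lra.
  + rewrite addKn gaE gbE.
    have e00 := ltW e0.
    have b1e : k%:R * (e / 16 / v ^+ 2) <= b1%:R * (e / 16).
      rewrite (_ : k%:R * (e / 16 / v ^+ 2) = (k%:R * (v ^+ 2)^-1) * (e / 16)); last by ring.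
      by rewrite ler_wpM2r // divr_ge0.
    set a := _ `^ (p - 1); set b := _ `^ p.
    (* [b1 >= k / v ^ 2] absorbs [k] and [v ^ 2]. The remaining cases are [p * e >= 1], where
       [v = 1], and [p * e < 1], where [gb = 1 / (16 * p)]. *)
    suff core : p * a * (e / 16) * b <= (1 + e) `^ p - 1.
      apply: (@le_trans _ _ (b1%:R * (p * a * (e / 16) * b))); last by rewrite ler_wpM2l.
      rewrite (_ : b1%:R * (p * a * (e / 16) * b) = p * a * (b1%:R * (e / 16)) * b); last by ring.
      rewrite ler_wpM2r ?powR_ge0 // ler_wpM2l // mulr_ge0 ?powR_ge0 //; lra.
    rewrite /a /b; case: (lerP 1 (x * y)) => xy.
      have -> : v = 1 by rewrite /v; apply/min_idPl.
      by rewrite !expr1n !divr1; apply: flat_scalar_large => //; rewrite e00.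
    have vE : v = x * y by rewrite /v; apply/min_idPr/ltW.
    have x0 : 0 < x by lra.
    have pE : e / 16 / v ^+ 6 = (16 * p)^-1.
      by rewrite vE -x6 -y6; field; rewrite !gt_eqF.
    rewrite pE; apply: flat_scalar_small => //.
    rewrite divr_ge0 ?(ltW v20) ?divr_ge0 //= -pE.
    have v60 : 0 < v ^+ 6 by rewrite exprn_gt0.
    rewrite ler_wpM2l ?divr_ge0 // lef_pV2 ?posrE //.
    rewrite -[6%N]/(2 + 4)%N exprD ler_piMr ?(ltW v20) // expr_le1 // ltW //.
- have r1 : 1 <= r%:R :> R by rewrite ler1n.
  have rL : r%:R <= 45 * L :> R by exact: log_rounds_le.
  have cnt := @count_le R k N r Y W (v ^+ 2)^-1 ca%:R cb%:R b1%:R k1 N1 r1 Y1 W1 vi1 WY.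
  apply: finish; apply: (@le_trans _ _ (52 * (k%:R * N%:R * r%:R * Y))); last first.
    by apply: ler_wpM2l => //; apply: ler_wpM2r; rewrite ?(le_trans ler01) // ler_wpM2l.
  clearbody r; rewrite natr_num_products [(r * ca)%:R]natrM [(r * cb)%:R]natrM natrD.
  by apply: cnt; apply/andP; split.
Qed.

Lemma trmx_exp (R : comNzRingType) (d l : nat) (B : 'M[R]_d) :
  (B ^+ l)^T = B^T ^+ l.
Proof.
elim: l => [|l IH]; first by rewrite !expr0 trmx1.
by rewrite exprS exprSr [(B * _)^T]trmx_mul IH.
Qed.

Lemma gram_gram_power (R : realType) (n d l : nat) (A : 'M[R]_(n, d)) :
  (gram_power l A)^T *m gram_power l A = (A^T *m A) ^+ (2 * l).
Proof. by rewrite /gram_power trmx_exp trmx_mul trmxK mul2n -addnn exprD. Qed.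

Lemma gram_odd_gram_power (R : realType) (n d l : nat) (A : 'M[R]_(n, d)) :
  (odd_gram_power l A)^T *m odd_gram_power l A = (A^T *m A) ^+ (2 * l + 1).
Proof.
rewrite /odd_gram_power trmx_mul trmx_exp trmx_mul trmxK -mulmxA (mulmxA A^T).
by rewrite mul2n -addnn addn1 -addnS exprD exprS.
Qed.

Theorem theoremB1 (R : realType) :
  exists C : R, 0 < C /\
  forall (n d l k : nat) (eps p : R),
    (0 < n)%N -> (0 < l)%N -> (0 < k <= d)%N -> 0 < eps -> 1 <= p ->
    (exists (disp : measure_display) (Omega : measurableType disp)
            (P : probability Omega R) (q : nat)
            (alg : mv_algorithm R n d k q Omega),
       q%:R <= C * query_bound n k l p eps /\
       mv_solves P alg p eps (gram_power l))
    /\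
    (exists (disp : measure_display) (Omega : measurableType disp)
            (P : probability Omega R) (q : nat)
            (alg : mv_algorithm R n d k q Omega),
       q%:R <= C * query_bound n k l p eps /\
       mv_solves P alg p eps (odd_gram_power l)).
Proof.
have c0 : 0 < 2340 :> R by lra.
have K := @krylov_exists R; move: (2340 : R) c0 K => c c0 K.
(* The power [N] is [2 * l] or [2 * l + 1], at most [3 * l]. *)
exists (c * 3); split; first exact: mulr_gt0.
move=> n d l k eps p n0 l0 kd eps0 p1.
have bound N : (N <= 3 * l)%N ->
    c * (k%:R * N%:R * Num.max 1 (ln (n * k)%:R) * p `^ 6^-1 / (Num.min 1 eps) `^ 3^-1) <=
    c * 3 * query_bound n k l p eps.
  move=> Nl; rewrite /query_bound -[leRHS]mulrA; apply: ler_wpM2l; first exact: ltW.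
  have L0 : 0 <= Num.max 1 (ln (n * k)%:R) :> R by rewrite le_max ler01.
  move: (Num.max _ _) (p `^ _) (powR_ge0 p 6^-1) (_ `^ 3^-1) (powR_ge0 (Num.min 1 eps) 3^-1) L0.
  move=> L x x0 y y0 L0.
  rewrite !mulrA ler_wpM2r ?invr_ge0 // ler_wpM2r // ler_wpM2r //.
  by rewrite -mulrA mulrCA ler_wpM2l // -natrM ler_nat.
split.
  have N0 : (0 < 2 * l)%N by rewrite muln_gt0.
  have [disp [Om [P [q [alg [qle sol]]]]]] := K _ _ _ _ _ _ _ _ n0 N0 kd eps0 p1 (@gram_gram_power R n d l).
  exists disp, Om, P, q, alg; split=> //; apply: le_trans qle (bound _ _); clear -l0; lia.
have N0 : (0 < 2 * l + 1)%N by rewrite addn1.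
have [disp [Om [P [q [alg [qle sol]]]]]] := K _ _ _ _ _ _ _ _ n0 N0 kd eps0 p1 (@gram_odd_gram_power R n d l).
exists disp, Om, P, q, alg; split=> //; apply: le_trans qle (bound _ _); clear -l0; lia.
Qed.
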